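(* Let $\varphi\colon\mathbb{R}_+\to\mathbb{R}_+$ be a map satisfying $\varphi(t)=o\left(t^{1/3}\right)$ as $t\to+\infty$. Then every BSP rank-one system is $\varphi$-integrably orbit equivalent to the universal odometer.
   Context: All probability spaces are standard and atomless. $\mathrm{Aut}(X,\mu)$ is the set of bimeasurable bijections $T$ of $(X,\mathcal{A},\mu)$ preserving the probability measure $\mu$, two such maps being identified if they coincide on a set of full measure. Its elements are called systems or transformations. **Orbit equivalence.** Aperiodic $S\in\mathrm{Aut}(X,\mu)$ and $T\in\mathrm{Aut}(Y,\nu)$ are orbit equivalent if there is a bimeasurable bijection $\Psi\colon X\to Y$ with $\Psi_\star\mu=\nu$ such that $S$ and $\Psi^{-1}T\Psi$ have the same orbits at almost every point. The associated cocycles $c_S\colon X\to\mathbb{Z}$, $c_T\colon Y\to\mathbb{Z}$ are defined almost everywhere by $Sx=\Psi^{-1}T^{c_S(x)}\Psi(x)$ and $Ty=\Psi S^{c_T(y)}\Psi^{-1}(y)$. $S$ and $T$ are $\varphi$-integrably orbit equivalent if some orbit equivalence $\Psi$ satisfies $\int_X\varphi(|c_S|)\,d\mu<+\infty$ and $\int_Y\varphi(|c_T|)\,d\nu<+\infty$. **Universal odometer.** For integers $q_n\ge 2$, the odometer on $\prod_{n\ge0}\{0,\dots,q_n-1\}$ (with the product of the uniform probability measures) is the addition of $(1,0,0,\dots)$ with carry over to the right. It is universal if every prime number has infinite multiplicity as a prime factor among the $q_n$, $n\ge0$. The universal odometer is unique up to conjugacy. **Rank-one systems.** A cutting and spacing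 parameter is a tuple $(q,(\sigma_{\cdot,0},\dots,\sigma_{\cdot,q}))$ with an integer $q\ge2$ and non-negative integers $\sigma_{\cdot,i}$; $\mathcal{P}$ is the set of these. For a sequence $(q_n,(\sigma_{n,0},\dots,\sigma_{n,q_n}))_{n\ge0}\in\mathcal{P}^{\mathbb{N}}$ put $\sigma_n=\sum_{i=0}^{q_n}\sigma_{n,i}$, $h_0=1$, $h_{n+1}=q_nh_n+\sigma_n$, and $Z_n=\max\{\sigma_{j,i}\mid 0\le j\le n,\ 0\le i\le q_j\}$. A transformation $T\in\mathrm{Aut}(X,\mu)$ is of rank one if there are such a sequence with $\sum_{n\ge0}\sigma_n/h_{n+1}<+\infty$ and measurable sets $B_n$, $B_{n,i}$ ($0\le i\le q_n-1$), $\Sigma_{n,i,j}$ ($0\le i\le q_n$, $1\le j\le\sigma_{n,i}$) such that for all $n\ge0$: (a) $B_n,T(B_n),\dots,T^{h_n-1}(B_n)$ are pairwise disjoint; (b) $(B_{n,0},\dots,B_{n,q_n-1})$ is a partition of $B_n$; (c) $T^{h_n}(B_{n,i})=\Sigma_{n,i+1,1}$ if $\sigma_{n,i+1}>0$, and $T^{h_n}(B_{n,i})=B_{n,i+1}$ if $\sigma_{n,i+1}=0$ and $i<q_n-1$; (d) if $\sigma_{n,i}>0$, then $T(\Sigma_{n,i,j})=\Sigma_{n,i,j+1}$ if $j<\sigma_{n,i}$, and $T(\Sigma_{n,i,j})=B_{n,i}$ if $j=\sigma_{n,i}$ and $i\le q_n-1$; (e) $B_{n+1}=\Sigma_{n,0,1}$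 if $\sigma_{n,0}>0$, and $B_{n+1}=B_{n,0}$ if $\sigma_{n,0}=0$; and moreover $\{T^k(B_n)\mid n\ge0,\ 0\le k\le h_n-1\}$ generates $\mathcal{A}$ up to null sets. These data are called a cutting-and-stacking construction of $T$ with the given parameters. **BSP.** A cutting-and-stacking construction is BSP (''bounded-spacing-parameter'') if there is a constant $C>0$ such that $Z_n\le C$ and $\sigma_{n,0}=\sigma_{n,q_n}=0$ for all $n$. A rank-one system is BSP if it admits a BSP cutting-and-stacking construction. *)

(* Defs.v *)
From HB Require Import structures.
From mathcomp Require Import all_boot all_order all_algebra.
From mathcomp Require Import all_classical all_reals all_analysis.
Set Implicit Arguments.
Unset Strict Implicit.
Unset Printing Implicit Defensive.
Import Order.TTheory GRing.Theory Num.Theory.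
Import numFieldNormedType.Exports.
Local Open Scope classical_set_scope.
Local Open Scope ring_scope.

Definition bimeasurable_bijection d1 d2 (X : measurableType d1)
    (Y : measurableType d2) (f : X -> Y) : Prop :=
  [/\ bijective f, measurable_fun [set: X] f
    & forall A, measurable A -> measurable (f @` A)].

(* Standard Borel space: Borel isomorphic to a separable completely metrizable
   space P (a Hausdorff pseudometric space is metric). *)
Definition standard_borel (R : realType) d (X : measurableType d) : Prop :=
  exists P : completePseudoMetricType R,
    [/\ hausdorff_space P,
        exists2 D : set P, countable D & dense D
      & exists f : X -> g_sigma_algebraType (@open P),
          bimeasurable_bijection f].

Definition atomless (R : realType) d (X : measurableType d)
    (mu : probability X R) : Prop :=
  forall A, measurable A -> (0 < mu A)%E ->
    exists B, [/\ measurable B, B `<=` A & (0 < mu B < mu A)%E].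

(* Elements of Aut(X, mu) are represented by everywhere-defined maps; the
   notions below do not depend on the choice of a representative modulo null
   sets. *)
Definition automorphism (R : realType) d (X : measurableType d)
    (mu : probability X R) (T : X -> X) : Prop :=
  bimeasurable_bijection T /\
  forall A, measurable A -> pushforward mu T A = mu A.

Definition aperiodic (R : realType) d (X : measurableType d)
    (mu : probability X R) (T : X -> X) : Prop :=
  \forall x \ae mu, forall n, (0 < n)%N -> iter n T x <> x.

(* pinv is the total inverse of the library; it is the two-sided inverse of a
   bijection, so that iterz T n is the n-th power of T, n an integer. *)
Definition inverse (X Y : pointedType) (f : X -> Y) : Y -> X :=
  pinv [set: X] f.

Definition iterz (X : pointedType) (T : X -> X) (n : int) : X -> X :=
  match n with
  | Posz k => iter k T
  | Negz k => iter k.+1 (inverse T)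
  end.

Definition orbit_of (X : pointedType) (T : X -> X) (x : X) : set X :=
  range (fun n : int => iterz T n x).

Definition orbit_equivalence (R : realType) d1 d2
    (X : measurableType d1) (Y : measurableType d2)
    (mu : probability X R) (nu : probability Y R)
    (S : X -> X) (T : Y -> Y) (Psi : X -> Y) : Prop :=
  [/\ bimeasurable_bijection Psi,
      forall B, measurable B -> pushforward mu Psi B = nu B
    & \forall x \ae mu,
        orbit_of S x = orbit_of (inverse Psi \o T \o Psi) x].

Definition phi_integrable (R : realType) d (X : measurableType d)
    (mu : probability X R) (phi : R -> R) (c : X -> int) : Prop :=
  (\int[mu]_x (phi (`|c x|%:~R))%:E < +oo)%E.

(* The cocycles cS and cT are only determined almost everywhere (and they are,
   by aperiodicity): an everywhere-defined measurable representative is used,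
   int being discrete. *)
Definition phi_integrably_orbit_equivalent (R : realType) d1 d2
    (X : measurableType d1) (Y : measurableType d2)
    (mu : probability X R) (nu : probability Y R) (phi : R -> R)
    (S : X -> X) (T : Y -> Y) : Prop :=
  [/\ automorphism mu S, aperiodic mu S, automorphism nu T, aperiodic nu T
    & exists Psi : X -> Y,
      orbit_equivalence mu nu S T Psi /\
      exists (cS : X -> int) (cT : Y -> int),
      [/\ forall k, measurable (cS @^-1` [set k]),
          forall k, measurable (cT @^-1` [set k]),
          \forall x \ae mu, S x = inverse Psi (iterz T (cS x) (Psi x)),
          \forall y \ae nu, T y = Psi (iterz S (cT y) (inverse Psi y))
        & phi_integrable mu phi cS /\ phi_integrable nu phi cT]].

Record radix := Radix {
  base :> nat -> nat;
  base_ge2 : forall n, (2 <= base n)%N }.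

Definition digit_seq (q : radix) := forall n, 'I_(q n).

Definition zero_digits (q : radix) : digit_seq q :=
  fun n => Ordinal (ltnW (base_ge2 q n)).

HB.instance Definition _ (q : radix) := gen_eqMixin (digit_seq q).
HB.instance Definition _ (q : radix) := gen_choiceMixin (digit_seq q).
HB.instance Definition _ (q : radix) :=
  isPointed.Build (digit_seq q) (zero_digits q).

(* The product sigma-algebra on the product of the finite sets {0,..,q_n-1}. *)
Definition coordinate_sets (q : radix) : set (set (digit_seq q)) :=
  [set A | exists n (a : 'I_(q n)), A = [set y | y n = a]].

Definition odometer_space (q : radix) :=
  g_sigma_algebraType (@coordinate_sets q).

HB.instance Definition _ (q : radix) := Measurable.on (odometer_space q).

(* Addition of (1,0,0,..) with carry: the digit of index n changes exactly when
   all the previous ones are maximal; ordS is the successor modulo q_n. *)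
Definition odometer (q : radix) (y : odometer_space q) : odometer_space q :=
  fun n => if [forall i : 'I_n, (y i).+1 == q i] then ordS (y n) else y n.

Definition is_uniform_product (R : realType) (q : radix)
    (nu : probability (odometer_space q) R) : Prop :=
  forall n (a : digit_seq q),
    nu [set y | forall i, (i < n)%N -> y i = a i] =
    (\prod_(i < n) (q i)%:R^-1)%:E.

(* Existence of the product measure, as the distribution of the sequence of
   digits of a uniformly distributed real number of [0, 1]. *)
Section uniform_product_exists.
Variables (R : realType) (q : radix).

Let Q n : nat := \prod_(i < n) q i.

Let q_gt0 n : (0 < q n)%N. Proof. exact: ltnW (base_ge2 q n). Qed.

Let Q_gt0 n : (0 < Q n)%N.
Proof. by rewrite prodn_gt0. Qed.

Let QS n : Q n.+1 = (Q n * q n)%N.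
Proof. by rewrite /Q big_ord_recr. Qed.

Let expansion (x : measurableTypeR R) : odometer_space q :=
  fun n => Ordinal (ltn_pmod (Num.truncn ((x : R) * (Q n.+1)%:R)) (q_gt0 n)).

Let truncn_div (y : R) (m : nat) : (0 < m)%N -> 0 <= y ->
  (Num.truncn (y * m%:R) %/ m)%N = Num.truncn y.
Proof.
move=> m0 y0; have m0' : (0 : R) < m%:R by rewrite ltr0n.
have ym0 : 0 <= y * m%:R by rewrite mulr_ge0.
apply/esym/truncn_def; have /andP[lo hi] := truncn_itv ym0.
apply/andP; split.
  rewrite -(ler_pM2r m0') -natrM (le_trans _ lo)// ler_nat; exact: leq_divM.
rewrite -(ltr_pM2r m0') -natrM (lt_le_trans hi)// ler_nat; exact: ltn_ceil.
Qed.

Let code (a : digit_seq q) n : nat :=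
  iteri n (fun i k => (k * q i + a i)%N) 0%N.

Let code_lt a n : (code a n < Q n)%N.
Proof.
elim: n => [|n IH]; first exact: Q_gt0.
rewrite QS /= -/(code a n); apply: (@leq_trans ((code a n).+1 * q n)%N).
  by rewrite mulSn addnC ltn_add2r.
by rewrite leq_mul2r IH orbT.
Qed.

Let truncn_code (x : R) a n : 0 <= x < 1 ->
  (forall i, (i < n)%N -> expansion x i = a i) <->
  Num.truncn (x * (Q n)%:R) = code a n.
Proof.
move=> /andP[x0 x1]; elim: n => [|n IH].
  split=> // _; rewrite /Q big_ord0 mulr1 /=.
  by apply: truncn_def; rewrite x0.
have xn0 : 0 <= x * (Q n)%:R by rewrite mulr_ge0.
have := truncn_div (q_gt0 n) xn0; rewrite -mulrA -natrM -QS => divE.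
split=> [H|H].
- rewrite (divn_eq (Num.truncn (x * (Q n.+1)%:R)) (q n)) divE.
  have -> : Num.truncn (x * (Q n)%:R) = code a n.
    by apply/IH => i /ltnW; exact: H.
  by have /(congr1 val)/= -> := H n (ltnSn n).
- have Hn : Num.truncn (x * (Q n)%:R) = code a n.
    by rewrite -divE H /= divnMDl ?q_gt0// divn_small ?addn0 ?ltn_ord.
  move=> i; rewrite ltnS leq_eqVlt => /predU1P[->|]; last exact: (IH.2 Hn).
  by apply/val_inj; rewrite /= H /= modnMDl modn_small.
Qed.

Let measurable_expansion :
  measurable_fun [set: measurableTypeR R] expansion.
Proof.
have : preimage_set_system [set: measurableTypeR R] expansion (@coordinate_sets q)
    `<=` measurable; last first.
  exact: (@measurability _ _ _ (odometer_space q) _ _ (@coordinate_sets q)).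
move=> _ [_ [n [a ->]] <-].
rewrite setTI.
have -> : expansion @^-1` [set y | y n = a] =
  \bigcup_(k in [set k | k %% q n = a]%N)
    [set x : R | Num.truncn (x * (Q n.+1)%:R) = k].
  apply/seteqP; split=> x /=.
    by move=> /(congr1 val)/= xa; exists (Num.truncn (x * (Q n.+1)%:R)).
  by move=> [k /= ka xk]; apply/val_inj; rewrite /= xk.
apply: bigcup_measurable => k _.
have c0 : (0 : R) < (Q n.+1)%:R by rewrite ltr0n.
case: k => [|k].
- have -> : [set x : R | Num.truncn (x * (Q n.+1)%:R) = 0%N] =
     `]-oo, (Q n.+1)%:R^-1[%classic.
    apply/seteqP; split=> x /=; rewrite in_itv/= -[X in _ < X]mul1r
      ltr_pdivlMr//.
      by move=> /eqP; rewrite -leqn0 truncn_le_nat.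
    by move=> h; apply/eqP; rewrite -leqn0 truncn_le_nat.
  exact: measurable_itv.
- have -> : [set x : R | Num.truncn (x * (Q n.+1)%:R) = k.+1] =
     `[(k.+1%:R / (Q n.+1)%:R), (k.+2%:R / (Q n.+1)%:R)[%classic.
    apply/seteqP; split=> x /=; rewrite in_itv/= ler_pdivrMr// ltr_pdivlMr//.
      move=> h; rewrite -truncn_gt_nat -truncn_le_nat h.
      by rewrite leqnn.
    by move=> h; apply: truncn_def.
  exact: measurable_itv.
Qed.

Let P : probability (measurableTypeR R) R := uniform_prob (@ltr01 R).

Let P_itvco (l r : R) : 0 <= l -> l <= r -> r <= 1 ->
  P `[l, r[%classic = (r - l)%:E.
Proof.
move=> l0 lr r1.
rewrite -[LHS]/(uniform_prob (@ltr01 R) `[l, r[%classic) /uniform_prob.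
rewrite integral_uniform_pdf setIidl; last first.
  move=> x /=; rewrite !in_itv/= => /andP[lx xr].
  by rewrite (le_trans l0 lx) (le_trans (ltW xr) r1).
rewrite (eq_integral (fun=> 1%:E)); last first.
  move=> x; rewrite inE/= in_itv/= => /andP[lx xr].
  rewrite /uniform_pdf (le_trans l0 lx) (le_trans (ltW xr) r1)/=.
  by rewrite subr0 invr1.
rewrite integral_cst//= mul1e lebesgue_measure_itv/= lte_fin.
by move: lr; rewrite le_eqVlt => /predU1P[->|->];
  rewrite ?ltxx ?subrr// EFinB.
Qed.

Lemma uniform_product_exists :
  exists nu : probability (odometer_space q) R, is_uniform_product nu.
Proof.
exists (distribution P (mfun_Sub (mem_set measurable_expansion))) => n a.
rewrite /distribution /= /pushforward /=.
set E := expansion @^-1` _.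
pose J := `[(code a n)%:R / (Q n)%:R, (code a n).+1%:R / (Q n)%:R[%classic : set R.
have Qn0 : (0 : R) < (Q n)%:R by rewrite ltr0n.
have l0 : (0 : R) <= (code a n)%:R / (Q n)%:R by rewrite divr_ge0.
have lr : (code a n)%:R / (Q n)%:R <= ((code a n).+1%:R / (Q n)%:R : R).
  by rewrite ler_pM2r ?invr_gt0// ler_nat.
have r1 : (code a n).+1%:R / (Q n)%:R <= (1 : R).
  by rewrite ler_pdivrMr// mul1r ler_nat.
have JE : J `<=` E.
  move=> x; rewrite /J/= in_itv/= => /andP[lx xr].
  apply/truncn_code; first by rewrite (le_trans l0 lx) (lt_le_trans xr r1).
  by apply: truncn_def; rewrite -ler_pdivrMr// lx -ltr_pdivlMr.
have EJ : E `\` J `<=` ~` `[0, 1[%classic.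
  move=> x [Ex nJx] /=; rewrite in_itv/= => x01; apply: nJx.
  have xn0 : 0 <= x * (Q n)%:R by rewrite mulr_ge0 ?(andP x01).1.
  have := truncn_itv xn0; rewrite (iffLR (truncn_code a n x01) Ex) => /andP[lo hi].
  by rewrite /J/= in_itv/= ler_pdivrMr// lo ltr_pdivlMr.
have mJ : measurable J by exact: measurable_itv.
have mE : measurable E.
  have -> : E = \bigcap_(i in [set i | (i < n)%N])
      (expansion @^-1` [set y : odometer_space q | y i = a i]) by [].
  apply: bigcap_measurableType => i _.
  rewrite -[X in measurable X]setTI; apply: measurable_expansion => //.
  by apply: sub_sigma_algebra; exists i, (a i).
have PD0 : P (E `\` J) = 0%E.
  apply: (@subset_measure0 _ _ _ P _ (~` `[0, 1[%classic)) => //.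
  - exact: measurableD.
  - by apply: measurableC; exact: measurable_itv.
  - rewrite [LHS](probability_setC P); last exact: measurable_itv.
    by rewrite P_itvco// subr0 subee.
have -> : P E = P J.
  rewrite -(setDUK JE) measureU//.
  - by rewrite [X in (_ + X)%E]PD0 adde0.
  - exact: measurableD.
  - by rewrite setDE setICA setICr setI0.
rewrite P_itvco// -mulrBl -natrB// subSnn mul1r.
by rewrite /Q natr_prod prodfV.
Qed.

End uniform_product_exists.

Definition odometer_measure (R : realType) (q : radix) :
    probability (odometer_space q) R :=
  projT1 (cid (uniform_product_exists R q)).

Lemma odometer_measureP (R : realType) (q : radix) :
  is_uniform_product (odometer_measure R q).
Proof. exact: (projT2 (cid (uniform_product_exists R q))). Qed.

(* The multiplicity of p among q_0, .., q_{n-1} is unbounded in n. *)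
Definition universal (q : radix) : Prop :=
  forall p, prime p ->
  forall m, exists n, (m <= \sum_(i < n) logn p (q i))%N.

Record cs_param := CSParam {
  cut : nat;
  cut_ge2 : (2 <= cut)%N;
  spacers : (cut.+1).-tuple nat }.

(* spacer p n i is sigma_{n,i}, for 0 <= i <= q_n, where q_n = cut (p n). *)
Definition spacer (p : nat -> cs_param) (n i : nat) : nat :=
  nth 0%N (spacers (p n)) i.

Definition total_spacers (p : nat -> cs_param) (n : nat) : nat :=
  \sum_(i < (cut (p n)).+1) spacer p n i.

Fixpoint height (p : nat -> cs_param) (n : nat) : nat :=
  if n is m.+1 then (cut (p m) * height p m + total_spacers p m)%N else 1%N.

Definition max_spacer (p : nat -> cs_param) (n : nat) : nat :=
  \max_(j < n.+1) \max_(i < (cut (p j)).+1) spacer p j i.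

Record cutting_and_stacking (R : realType) d (X : measurableType d)
    (mu : probability X R) (T : X -> X) (p : nat -> cs_param)
    (B : nat -> set X) (Bsub : nat -> nat -> set X)
    (Sigma : nat -> nat -> nat -> set X) : Prop := {
  cs_summable :
    (\sum_(0 <= n <oo)
       ((total_spacers p n)%:R / (height p n.+1)%:R : R)%:E < +oo)%E;
  cs_measurable_base : forall n, measurable (B n);
  cs_measurable_sub : forall n i, (i < cut (p n))%N -> measurable (Bsub n i);
  cs_measurable_spacer : forall n i j, (i <= cut (p n))%N ->
    (1 <= j <= spacer p n i)%N -> measurable (Sigma n i j);
  cs_disjoint : forall n,
    trivIset [set k | (k < height p n)%N] (fun k => iter k T @` B n);
  cs_partition_disjoint : forall n,
    trivIset [set i | (i < cut (p n))%N] (Bsub n);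
  cs_partition_cover : forall n,
    \bigcup_(i in [set i | (i < cut (p n))%N]) Bsub n i = B n;
  cs_top_spacer : forall n i, (i < cut (p n))%N ->
    (0 < spacer p n i.+1)%N ->
    iter (height p n) T @` Bsub n i = Sigma n i.+1 1%N;
  cs_top_no_spacer : forall n i, (i < (cut (p n)).-1)%N ->
    spacer p n i.+1 = 0%N ->
    iter (height p n) T @` Bsub n i = Bsub n i.+1;
  cs_spacer_next : forall n i j, (i <= cut (p n))%N ->
    (1 <= j < spacer p n i)%N ->
    T @` Sigma n i j = Sigma n i j.+1;
  cs_spacer_last : forall n i, (i <= (cut (p n)).-1)%N ->
    (0 < spacer p n i)%N ->
    T @` Sigma n i (spacer p n i) = Bsub n i;
  cs_base_spacer : forall n, (0 < spacer p n 0)%N ->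
    B n.+1 = Sigma n 0%N 1%N;
  cs_base_no_spacer : forall n, spacer p n 0 = 0%N ->
    B n.+1 = Bsub n 0%N;
  cs_generates : forall A, measurable A ->
    exists2 A',
      <<s [set L | exists n k, (k < height p n)%N /\ L = iter k T @` B n] >> A'
      & mu (A `+` A') = 0%E }.

Definition BSP_param (p : nat -> cs_param) : Prop :=
  exists C, (0 < C)%N /\ forall n,
    [/\ (max_spacer p n <= C)%N, spacer p n 0 = 0%N
      & spacer p n (cut (p n)) = 0%N].

Definition BSP_rank_one (R : realType) d (X : measurableType d)
    (mu : probability X R) (T : X -> X) : Prop :=
  automorphism mu T /\
  exists p B Bsub Sigma,
    cutting_and_stacking mu T p B Bsub Sigma /\ BSP_param p.

(* Main.v *)
(* Let h be the height of a tower of T. A string of H < h of its levels, listed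
   in some order close to the natural one, is the tower of an odometer acting
   along the orbits of T. A later tower of T consists of copies of the first one,
   at most C apart since the spacers are bounded: its levels are listed by reading
   the copies in order, each of them contributing its string of H levels, while
   the levels skipped by the strings and the spacers wait in a queue and are
   inserted in blocks of length H. Every copy adds at least one level to the
   queue, so a level never waits for more than H copies and the listing displaces
   it by at most (H + 1)(h + C). Truncating the new listing to a suitable multiple
   H' of H skips a number of levels bounded in terms of H and of the radix only.

   Along a sparse sequence of towers, Borel-Cantelli turns these listings into a
   factor map to the odometer, which is invertible because T is of rank one. A
   point whose cocycles are not determined at the stage of height h is at a skipped
   level, at a spacer or next to one; such points have measure O((r + C) / h), r
   being the number of skipped levels, which is bounded before h is chosen. At the
   next stage the cocycles of this point are O(h^2). Hence the cost is
   O((r + C) phi(h^2) / h), which is as small as desired if h is chosen large.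

   The factor map is turned into a bijection defined everywhere by a
   Cantor-Bernstein argument, which needs a null Borel copy of the odometer space
   inside a given set of full measure. *)
Require Import Defs.
From mathcomp Require Import all_boot all_order all_algebra.
From mathcomp Require Import all_classical all_reals all_analysis.
From mathcomp Require Import measurable_realfun zify ring lra.
Import Order.TTheory GRing.Theory Num.Theory.
Import numFieldNormedType.Exports.
Set Implicit Arguments.
Unset Strict Implicit.
Unset Printing Implicit Defensive.

(** * Listing a tower from the listings of its subtowers *)

(** Spacers prevent the heights of the towers of [T] from dividing one another, whereas the heights
    of the towers of an odometer must; this is why only [H < h] levels are listed. Strings and
    flushed blocks all have lengths divisible by [H], so each string starts at a multiple of [H].
    Hence the successive ranks of a point in the listings are congruent modulo the earlier [H], and
    these congruences are the digits of its image.

    Divisibility is arranged in both directions. Each [scale q m] divides the later [H n], so that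
    ranks determine digits and every residue has the same weight. Each [H n] divides some
    [scale q r] because the odometer is universal, so that digits determine ranks, hence levels,
    hence almost every point.

    The function [phi] is arbitrary, neither monotone nor measurable. Costs are therefore stated
    with numbers [Phi n] bounding [phi j] for all integers [j] up to the bound on the cocycles, and
    the integrals are compared with a series indexed by the last bad stage of a point. *)

Section listing.
Variables (h C k : nat) (o : nat -> nat) (l : seq nat).
Hypotheses (o0 : o 0 = 0) (oS : forall i, i < k -> o i + h <= o i.+1 <= o i + h + C).
Hypotheses (l_uniq : uniq l) (l_lt : {in l, forall p, p < h}).
Hypothesis l_size : 0 < size l < h.

Let H := size l.

Definition fresh i :=
  [seq o i + p | p <- iota 0 h & p \notin l] ++ iota (o i + h) (o i.+1 - (o i + h)).

(** Rounding down to a multiple of [H] keeps the length of the listing divisible by [H], so that the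
    next string is aligned. *)
Definition flush (s : seq nat) := (size s %/ H) * H.

(* A state is the listing built so far and the queue of points waiting to be
   gathered in a block of length [H]. *)
Definition run_step (st : seq nat * seq nat) i :=
  let s := st.2 ++ fresh i in
  (st.1 ++ [seq o i + p | p <- l] ++ take (flush s) s, drop (flush s) s).

Fixpoint run i := if i is j.+1 then run_step (run j) j else ([::], [::]).

Lemma flush_le s : flush s <= size s.
Proof. exact: leq_divM. Qed.

Lemma filter_perm : perm_eq (l ++ [seq p <- iota 0 h | p \notin l]) (iota 0 h).
Proof.
apply: uniq_perm; last 1 first.
- move=> p; rewrite mem_cat mem_filter mem_iota /=.
  by case: (boolP (p \in l)) => //= /l_lt ->.
- rewrite cat_uniq l_uniq filter_uniq ?iota_uniq// andbT /=.
  by apply/hasPn => p; rewrite mem_filter => /andP[].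
- exact: iota_uniq.
Qed.

Lemma size_filter_notin : size [seq p <- iota 0 h | p \notin l] = h - H.
Proof. by have /perm_size := filter_perm; rewrite size_cat size_iota -/H; lia. Qed.

Lemma size_fresh i : i < k -> h - H <= size (fresh i) <= h + C.
Proof.
move=> /oS ih; rewrite size_cat size_map size_filter_notin size_iota.
by lia.
Qed.

Lemma fresh_perm i : i < k ->
  perm_eq ([seq o i + p | p <- l] ++ fresh i) (iota (o i) (o i.+1 - o i)).
Proof.
move=> /oS ih; rewrite /fresh catA -map_cat.
have -> : o i.+1 - o i = h + (o i.+1 - (o i + h)) by lia.
rewrite iotaD perm_cat2r -[in iota (o i) h](addn0 (o i)) iotaDl.
exact: perm_map filter_perm.
Qed.

Lemma run_perm i : i <= k -> perm_eq ((run i).1 ++ (run i).2) (iota 0 (o i)).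
Proof.
elim: i => [|i IH] ik; first by rewrite /= o0.
have /andP[oi _] := oS ik.
have -> : o i.+1 = o i + (o i.+1 - o i) by lia.
rewrite iotaD add0n /= -!catA cat_take_drop.
rewrite (perm_trans _ (perm_cat (IH (ltnW ik)) (fresh_perm ik)))//.
by rewrite -!catA perm_cat2l perm_catCA.
Qed.

Lemma dvdn_run i : H %| size (run i).1.
Proof.
elim: i => [|i IH] //=; rewrite !size_cat size_map -/H size_take_min.
by rewrite (minn_idPl (flush_le _)) !dvdn_add// /flush dvdn_mull.
Qed.

Lemma pend_lt i : size (run i).2 < H.
Proof.
case: i => [|i] /=; first by case/andP: l_size.
set s := _ ++ _; rewrite size_drop /flush {1}(divn_eq (size s) H) addKn.
by rewrite ltn_pmod//; case/andP: l_size.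
Qed.

Lemma run_size i : i <= k -> size (run i).1 + size (run i).2 = o i.
Proof. by move=> /run_perm/perm_size; rewrite size_cat size_iota. Qed.

Lemma fresh_bound i x : i < k -> x \in fresh i -> o i <= x < o i.+1.
Proof.
move=> ik xf; have := perm_mem (fresh_perm ik) x.
rewrite mem_cat xf orbT mem_iota => /esym; have := oS ik; lia.
Qed.

(* At least one point is queued at each step, so a point at distance [d] from
   the end of the queue was queued at most [d] steps ago. *)
Lemma pend_recent i j : i <= k -> j < size (run i).2 ->
  o i <= nth 0 (run i).2 j + (size (run i).2 - j) * (h + C).
Proof.
elim: i j => [|i IH] j ik; first by rewrite o0.
rewrite /=; set s := _ ++ _; rewrite size_drop nth_drop => js.
have fs := flush_le s; have fr := size_fresh ik; have oi := oS ik.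
set f := flush s; have {js} fjs : f + j < size s by rewrite /f; lia.
have -> : size s - f - j = size s - (f + j) by lia.
move: (f + j) fjs => {}j js; rewrite {1}/s nth_cat.
have lH : 0 < H < h := l_size.
have sE : size s = size (run i).2 + size (fresh i) by rewrite size_cat.
case: ltnP => jp.
  have := IH _ (ltnW ik) jp.
  have [d dE] : exists d, size s - j = (size (run i).2 - j) + d.+1.
    by exists (size s - size (run i).2).-1; lia.
  rewrite dE mulnDl mulSn; lia.
have /(fresh_bound ik) : nth 0 (fresh i) (j - size (run i).2) \in fresh i.
  by apply: mem_nth; rewrite ltn_subLR// -sE.
have [d ->] : exists d, size s - j = d.+1 by exists (size s - j).-1; lia.
rewrite mulSn; lia.
Qed.

Lemma pend_recentH i x : i <= k -> x \in (run i).2 -> o i <= x + H * (h + C).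
Proof.
move=> ik /(nthP 0)[j js <-]; have := pend_recent ik js.
have := pend_lt i; move: (size _) js => s js sH.
have : (s - j) * (h + C) <= H * (h + C) by rewrite leq_mul2r; lia.
by move=> E F; apply: (leq_trans F); rewrite leq_add2l.
Qed.

(** The queue has fewer than [H] points, so a position filled at step [i] lies between [o i - H] and
    [o i.+1]. The value put there is below [o i.+1] and, by [pend_recentH], at least
    [o i - H * (h + C)]. The length of the current step, at most [h + C], accounts for the successor
    in [H.+1]. *)
Lemma run_displacement i j : i <= k -> j < size (run i).1 ->
  let x := nth 0 (run i).1 j in
  x <= j + H.+1 * (h + C) /\ j <= x + H.+1 * (h + C).
Proof.
elim: i => [|i IH] // ik js /=.
rewrite nth_cat; case: ltnP => jp; first exact: (IH (ltnW ik)).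
have s0 := run_size (ltnW ik); have s1 := run_size ik; have p0 := pend_lt i.
have oi := oS ik.
move: js; set x := nth _ _ _ => js.
have : (x < o i.+1) /\ (o i <= x + H * (h + C)).
  have : x \in [seq o i + p | p <- l] ++ take (flush ((run i).2 ++ fresh i))
      ((run i).2 ++ fresh i).
    by apply: mem_nth; move: js; rewrite /= size_cat; lia.
  rewrite mem_cat => /orP[/mapP[p /l_lt ph ->]|/mem_take]; first by lia.
  rewrite mem_cat => /orP[xp|/(fresh_bound ik)]; last by lia.
  split; last exact: (pend_recentH (ltnW ik)).
  have := perm_mem (run_perm (ltnW ik)) x; rewrite mem_cat xp orbT mem_iota.
  by move/esym; lia.
rewrite mulSn; move: l_size; rewrite -/H; nia.
Qed.

(** The string of copy [j] is appended to a listing whose length is divisible by [H], and later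
    steps only append. *)
Lemma run_block i j : j < i -> i <= k ->
  exists b, b.+1 * H <= size (run i).1 /\
    forall t, t < H -> nth 0 (run i).1 (b * H + t) = o j + nth 0 l t.
Proof.
elim: i => [|i IH] //; rewrite ltnS leq_eqVlt => /orP[/eqP ->|ji] ik.
- exists (size (run i).1 %/ H); have /divnK -> := dvdn_run i; split.
    by rewrite mulSn (divnK (dvdn_run i)) /= !size_cat size_map -/H; lia.
  move=> t tH /=; rewrite nth_cat ifN -?leqNgt ?leq_addr// addKn nth_cat.
  by rewrite size_map tH (nth_map 0).
- have [b [bs bE]] := IH ji (ltnW ik); exists b; split.
    by rewrite (leq_trans bs)//= size_cat leq_addr.
  move=> t tH /=; rewrite nth_cat ifT ?bE//.
  by rewrite (leq_trans _ bs)// mulSn addnC ltn_add2r.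
Qed.

(** Cutting at a multiple of [H] never cuts a string in two, whence the alternative in the last
    clause. The margin [H] in [H' + H <= o k] covers the queue left after the last step. *)
Lemma listing_step H' : H %| H' -> H' + H <= o k ->
  exists l' : seq nat, [/\ uniq l', {in l', forall p, p < o k}, size l' = H',
    forall j, j < H' -> nth 0 l' j <= j + H.+1 * (h + C) /\
      j <= nth 0 l' j + H.+1 * (h + C)
    & forall i, i < k ->
      (exists b, b.+1 * H <= H' /\
        forall t, t < H -> nth 0 l' (b * H + t) = o i + nth 0 l t)
      \/ (forall t, t < H -> o i + nth 0 l t \notin l')].
Proof.
move=> HH' H'k; exists (take H' (run k).1).
have s := run_size (leqnn k); have p := pend_lt k.
have := perm_uniq (run_perm (leqnn k)); rewrite iota_uniq cat_uniq.
move=> /and3P[u _ _].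
have sz : size (take H' (run k).1) = H' by rewrite size_take_min; lia.
split=> //.
- exact: take_uniq.
- move=> x /mem_take xr; have := perm_mem (run_perm (leqnn k)) x.
  by rewrite mem_cat xr mem_iota => /esym.
- by move=> j jH; rewrite nth_take//; apply: run_displacement => //; lia.
- move=> i ik; have [b [bs bE]] := run_block ik (leqnn k).
  have H0 : 0 < H by case/andP: l_size.
  have [bH|bH] := leqP (b.+1 * H) H'; [left|right].
    exists b; split=> // t tH; rewrite nth_take ?bE//.
    by rewrite (leq_trans _ bH)// mulSn addnC ltn_add2r.
  move=> t tH; rewrite -bE//; apply/negP => /(nthP 0)[j]; rewrite sz => jH.
  have jr : j < size (run k).1 by lia.
  have br : b * H + t < size (run k).1.
    by rewrite (leq_trans _ bs)// mulSn addnC ltn_add2r.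
  rewrite nth_take// => E; have /eqP jE : j == b * H + t.
    by rewrite -(nth_uniq 0 jr br u) E.
  have : H' <= b * H.
    have /dvdnP[c cE] := HH'; move: bH; rewrite cE ltn_pmul2r// ltnS.
    by rewrite leq_pmul2r.
  lia.
Qed.

End listing.

Local Open Scope classical_set_scope.
Local Open Scope ring_scope.

(** * Powers of bijections and the odometer *)

Section iterz_theory.
Variables (X : pointedType) (T : X -> X) (bijT : bijective T).

Lemma inverseK (X1 X2 : pointedType) (f : X1 -> X2) :
  bijective f -> cancel f (inverse f).
Proof.
by move=> /bij_inj fI x; apply: pinvKV; rewrite ?inE//; apply: in2W.
Qed.

Lemma inverseKV (X1 X2 : pointedType) (f : X1 -> X2) :
  bijective f -> cancel (inverse f) f.
Proof.
by move=> [g fK gK] y; apply: pinvK; rewrite inE; exists (g y).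
Qed.

Lemma iterzS n x : iterz T (n + 1) x = T (iterz T n x).
Proof.
case: n => [n|[|n]] /=.
- by rewrite addn1.
- by rewrite inverseKV.
- by rewrite subn1 /= inverseKV.
Qed.

Lemma iterzB1 n x : iterz T (n - 1) x = inverse T (iterz T n x).
Proof.
by rewrite -[in RHS](subrK 1 n) iterzS inverseK.
Qed.

Lemma iterzD m n x : iterz T (m + n) x = iterz T m (iterz T n x).
Proof.
elim/int_ind: m => [|m IH|m IH]; first by rewrite add0r.
- rewrite (_ : m.+1%:Z + n = m%:Z + n + 1); last by lia.
  by rewrite iterzS IH -iterzS; congr iterz; lia.
- rewrite (_ : - m.+1%:Z + n = - m%:Z + n - 1); last by lia.
  by rewrite iterzB1 IH -iterzB1; congr iterz; lia.
Qed.

Lemma iterzB (u t : nat) x y : iter t T y = iter u T x ->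
  y = iterz T (u%:Z - t%:Z) x.
Proof.
move=> E; rewrite addrC iterzD -[iterz T u x]/(iter u T x) -E.
by rewrite -[iter t T y]/(iterz T t y) -iterzD addNr.
Qed.

End iterz_theory.

Section odometer_codes.
Variable q : radix.
Local Open Scope nat_scope.
Implicit Types y z : odometer_space q.

Definition scale n := \prod_(i < n) q i.

Lemma radix_gt0 n : 0 < q n. Proof. exact: ltnW (base_ge2 q n). Qed.

Lemma scale_gt0 n : 0 < scale n.
Proof. by rewrite prodn_gt0// => i; exact: radix_gt0. Qed.

Lemma scaleS n : scale n.+1 = q n * scale n.
Proof. by rewrite /scale big_ord_recr mulnC. Qed.

Lemma scale_dvd m n : m <= n -> scale m %| scale n.
Proof.
move=> /subnK <-; elim: (n - m) => // k; rewrite addSn scaleS.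
exact: dvdn_mull.
Qed.

Lemma ltn_scale n : n < scale n.
Proof.
elim: n => [|n IH]; first exact: scale_gt0.
by rewrite scaleS; have := base_ge2 q n; nia.
Qed.

(* Little-endian: the odometer carries to the right, so it adds 1 to the
   codes modulo [scale n]. *)
Definition code y n := \sum_(i < n) y i * scale i.

Lemma code0 y : code y 0 = 0. Proof. by rewrite /code big_ord0. Qed.

Lemma codeS y n : code y n.+1 = code y n + y n * scale n.
Proof. by rewrite /code big_ord_recr. Qed.

Lemma code_lt y n : code y n < scale n.
Proof.
elim: n => [|n IH]; first by rewrite code0 scale_gt0.
rewrite codeS scaleS; have := ltn_ord (y n); nia.
Qed.

Lemma code_mod y m n : m <= n -> code y n = code y m %[mod scale m].
Proof.
move=> /subnK <-; elim: (n - m) => // k IH.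
rewrite addSn codeS -modnDmr.
by rewrite (eqP (dvdn_mull _ (scale_dvd (leq_addl k m)))) addn0.
Qed.

Lemma code_modE y m n : m <= n -> code y n %% scale m = code y m.
Proof. by move=> mn; rewrite code_mod// modn_small// code_lt. Qed.

Lemma code_digit y n : code y n.+1 %/ scale n = y n.
Proof. by rewrite codeS addnC divnMDl ?scale_gt0// divn_small ?addn0 ?code_lt. Qed.

Lemma code_inj y z : code y =1 code z -> y = z.
Proof.
move=> E; apply: functional_extensionality_dep => n; apply/val_inj => /=.
by rewrite -!code_digit E.
Qed.

Definition digits k : odometer_space q :=
  fun n => Ordinal (ltn_pmod (k %/ scale n) (radix_gt0 n)).

Lemma code_digits k n : code (digits k) n = k %% scale n.
Proof.
elim: n => [|n IH]; first by rewrite code0 /scale big_ord0 modn1.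
rewrite codeS IH /= scaleS.
have := divn_eq k (scale n); have := ltn_pmod k (scale_gt0 n).
move: (k %/ scale n) (k %% scale n) => a b bs ->.
have aq := ltn_pmod a (radix_gt0 n).
rewrite [in RHS](divn_eq a (q n)) mulnDl -addnA -mulnA modnMDl [in RHS]modn_small.
  by rewrite addnC.
nia.
Qed.

(** The odometer space is the inverse limit of the integers modulo [scale n]; digit [n] is read off
    the residue modulo [scale n.+1]. *)
Definition of_residues (r : nat -> nat) : odometer_space q :=
  fun n => digits (r n.+1) n.

Lemma code_of_residues r n : (forall n, r n.+1 = r n %[mod scale n]) ->
  code (of_residues r) n = r n %% scale n.
Proof.
move=> rP; elim: n => [|n IH]; first by rewrite code0 /scale big_ord0 modn1.
by rewrite codeS IH -rP -!code_digits [RHS]codeS.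
Qed.

Lemma maxdigitsP y n :
  reflect ((code y n).+1 = scale n) [forall i : 'I_n, (y i).+1 == q i].
Proof.
apply: (iffP forallP) => [H|].
- suff: forall m, m <= n -> (code y m).+1 = scale m by apply.
  elim=> [|m IH] mn; first by rewrite code0 /scale big_ord0.
  have /eqP := H (Ordinal mn); have := IH (ltnW mn); rewrite codeS scaleS /=.
  nia.
- elim: n => [|n IH]; first by move=> _ [].
  rewrite codeS scaleS => H.
  have c := code_lt y n; have d := ltn_ord (y n); have s := scale_gt0 n.
  have yq : (y n).+1 = q n by nia.
  have /IH{}IH : (code y n).+1 = scale n by nia.
  move=> [i]; rewrite /= ltnS leq_eqVlt => /orP[/eqP ->|i_n].
    by rewrite yq.
  exact: (IH (Ordinal i_n)).
Qed.

Lemma code_odometer y n : code (odometer y) n = (code y n).+1 %% scale n.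
Proof.
elim: n => [|n IH]; first by rewrite code0 /scale big_ord0 modn1.
have c := code_lt y n; have d := ltn_ord (y n).
rewrite !codeS IH /odometer; case: maxdigitsP => H.
- by rewrite H modnn add0n /= -addSn H scaleS muln_modl mulSn.
- rewrite modn_small; last by lia.
  by rewrite modn_small ?addSn// scaleS; nia.
Qed.

Lemma code_iter k y n : code (iter k (@odometer q) y) n = (code y n + k) %% scale n.
Proof.
elim: k => [|k IH]; first by rewrite addn0 modn_small// code_lt.
by rewrite iterS code_odometer IH -addn1 modnDml addn1 addnS.
Qed.

Lemma odometer_bij : bijective (@odometer q).
Proof.
(* The inverse subtracts 1; adding [(scale n).-1] does this modulo [scale n] within the natural
   numbers. *)
pose g y := of_residues (fun n => code y n + (scale n).-1).
have gE y n : code (g y) n = (code y n + (scale n).-1) %% scale n.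
  apply: code_of_residues => m; have := @code_mod y m m.+1 (leqnSn m).
  rewrite -modnDml => ->; rewrite modnDml; apply/eqP; rewrite eqn_modDl scaleS.
  have := scale_gt0 m; case: (scale m) => // s _; have := radix_gt0 m.
  by case: (base q m) => // r _; rewrite mulSn addSn/= addnC modnMDl.
exists g => y; apply: code_inj => n.
- rewrite gE code_odometer modnDml addSn -addnS prednK ?scale_gt0//.
  by rewrite modnDr modn_small ?code_lt.
- rewrite code_odometer gE -addn1 modnDml -addnA addn1 prednK ?scale_gt0//.
  by rewrite modnDr modn_small ?code_lt.
Qed.

Lemma odometer_free y n : 0 < n -> iter n (@odometer q) y <> y.
Proof.
move=> n0 /(congr1 (fun z => code z n)); rewrite code_iter => E.
have := ltn_scale n; have := code_lt y n => c s.
move: E; case: (ltnP (code y n + n) (scale n)) => H.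
  by rewrite modn_small//; lia.
by rewrite -(subnK H) modnDr modn_small; lia.
Qed.

Lemma odometer_iterz (u t : nat) y z :
  (forall n, code z n + t = code y n + u %[mod scale n]) ->
  z = iterz (@odometer q) (u%:Z - t%:Z)%R y.
Proof.
move=> E; apply: iterzB; first exact: odometer_bij.
by apply: code_inj => n; rewrite !code_iter.
Qed.

End odometer_codes.

(** * Measurability of the odometer and invariance of the product measure *)

Section odometer_measurability.
Variable q : radix.
Implicit Types y z : odometer_space q.

Lemma measurable_digit n (a : 'I_(q n)) :
  measurable ([set y | y n = a] : set (odometer_space q)).
Proof. by apply: sub_sigma_algebra; exists n, a. Qed.

Lemma measurable_code_eq n c :
  measurable ([set y | code y n = c] : set (odometer_space q)).
Proof.
elim: n c => [|n IH] c.
  have [->|/eqP c0] := eqVneq c 0%N.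
    rewrite [X in measurable X](_ : _ = setT); first exact: measurableT.
    by apply/seteqP; split=> y //= _; rewrite code0.
  rewrite [X in measurable X](_ : _ = set0); first exact: measurable0.
  by apply/seteqP; split=> y //=; rewrite code0 => /esym.
have -> : [set y | code y n.+1 = c] = \bigcup_(a in [set: 'I_(q n)])
    ([set y | y n = a] `&` \bigcup_(b in [set b | b + a * scale q n = c]%N)
      [set y | code y n = b]).
  apply/seteqP; split=> y /=.
  - by move=> <-; exists (y n) => //; split=> //; exists (code y n);
      rewrite //= codeS.
  - by move=> [a _ [/= <- [b /= <- <-]]]; rewrite codeS.
apply: fin_bigcup_measurable => // a _; apply: measurableI.
  exact: measurable_digit.
by apply: bigcup_measurable => b _.
Qed.

Lemma measurable_code n (P : nat -> Prop) :
  measurable ([set y | P (code y n)] : set (odometer_space q)).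
Proof.
rewrite [X in measurable X](_ : _ = \bigcup_(c in P) [set y | code y n = c]).
  by apply: bigcup_measurable => c _; exact: measurable_code_eq.
apply/seteqP; split=> y /=; first by move=> ?; exists (code y n).
by move=> [c Pc /= ->].
Qed.

Lemma digit_code n (a : 'I_(q n)) : [set y : odometer_space q | y n = a] =
  [set y : odometer_space q | (code y n.+1 %/ scale q n)%N = a].
Proof.
apply/seteqP; split=> y /=; rewrite code_digit; first by move=> ->.
exact: val_inj.
Qed.

Lemma odometer_sigma_ind (C : set (set (odometer_space q))) :
  sigma_algebra setT C ->
  (forall n (P : nat -> Prop), C [set y | P (code y n)]) ->
  forall A, measurable A -> C A.
Proof.
move=> sC CP A; apply: smallest_sub => // _ [n [a ->]].
by rewrite digit_code; exact: (CP n.+1 (fun c => (c %/ scale q n)%N = a)).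
Qed.

Lemma measurable_odometer : measurable_fun setT (@odometer q).
Proof.
have : preimage_set_system setT (@odometer q) (@coordinate_sets q) `<=` measurable;
  last exact: (@measurability _ _ _ (odometer_space q) _ _ (@coordinate_sets q)).
move=> _ [_ [n [a ->]] <-]; rewrite setTI digit_code.
rewrite [X in measurable X](_ : _ = [set y | (fun c =>
    (c.+1 %% scale q n.+1) %/ scale q n = a)%N (code y n.+1)]).
  exact: (measurable_code n.+1
    (fun c => (c.+1 %% scale q n.+1) %/ scale q n = a)%N).
by apply/seteqP; split=> y /=; rewrite code_odometer.
Qed.

Lemma odometer_bimeasurable : bimeasurable_bijection (@odometer q).
Proof.
split; [exact: odometer_bij|exact: measurable_odometer|].
have [g K gK] := odometer_bij q.
apply: odometer_sigma_ind; first split.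
- by rewrite image_set0.
- move=> A mA; rewrite setTD.
  rewrite [X in measurable X](_ : _ = ~` (@odometer q @` A)).
    exact: measurableC.
  apply/seteqP; split=> y /=.
    by move=> [z nA <-] [w Aw /(bij_inj (odometer_bij q)) wz]; rewrite -wz in nA.
  move=> nA; exists (g y) => // Agy; apply: nA; by exists (g y).
- by move=> A mA; rewrite image_bigcup; exact: bigcupT_measurable.
- move=> n P.
  rewrite [X in measurable X](_ : _ = [set y | (fun c =>
      P ((c + (scale q n).-1) %% scale q n)%N) (code y n)]).
    exact: (measurable_code n
      (fun c => P ((c + (scale q n).-1) %% scale q n)%N)).
  apply/seteqP; split=> y /=.
    move=> [z Pz <-]; rewrite code_odometer modnDml addSn -addnS.
    by rewrite prednK ?scale_gt0// modnDr modn_small ?code_lt.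
  move=> Py; exists (g y) => //=; move: Py; rewrite -{1}(gK y) code_odometer.
  rewrite modnDml addSn -addnS.
  by rewrite prednK ?scale_gt0// modnDr modn_small ?code_lt.
Qed.

Lemma odometer_measure_unique (R : realType)
    (m1 m2 : {measure set (odometer_space q) -> \bar R}) :
  (m1 setT < +oo)%E ->
  (forall n c, (c < scale q n)%N -> m1 [set y | code y n = c] =
    m2 [set y | code y n = c]) ->
  forall A, measurable A -> m1 A = m2 A.
Proof.
move=> m1oo m12 A mA.
pose G := [set A : set (odometer_space q) | A = set0 \/
  exists n c, A = [set y | code y n = c]].
have GT : G setT.
  by right; exists 0%N, 0%N; apply/seteqP; split=> y //= _; rewrite code0.
apply: (measure_unique G (fun=> setT)) => //.
- apply/seteqP; split; last first.
    apply: smallest_sub; first exact: sigma_algebra_measurable.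
    by move=> _ [->|[n [c ->]]]; [exact: measurable0|exact: measurable_code_eq].
  apply: odometer_sigma_ind; first exact: smallest_sigma_algebra.
  move=> n P; have [s0 sC sU] := smallest_sigma_algebra setT G.
  rewrite [X in _ X](_ : _ = \bigcup_i
    if `[< P i >] then [set y | code y n = i] else set0).
    apply: sU => i; case: ifP => // _.
    by apply: sub_sigma_algebra; right; exists n, i.
  apply/seteqP; split=> y /=; last by move=> [c _]; case: asboolP => //= ? ->.
  by move=> ?; exists (code y n) => //; case: asboolP.
(* Two cylinders are nested or disjoint, so with the empty set they form a family closed under
   intersection. *)
- move=> _ _ [->|[n [c ->]]] [->|[m [e ->]]]; try by left; rewrite ?set0I ?setI0.
  wlog nm : n c m e / (n <= m)%N => [H|].
    by have [?|/ltnW ?] := leqP n m; [exact: H|rewrite setIC; exact: H].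
  have [ec|ec] := eqVneq (e %% scale q n)%N c.
    right; exists m, e; apply/seteqP; split=> y /=; first by case.
    by move=> ye; split=> //; rewrite -(code_modE _ nm) ye.
  left; apply/seteqP; split=> y //= [yc ye]; move/eqP: ec; apply.
  by rewrite -ye code_modE.
- by apply/seteqP; split=> y //= _; exists 0%N.
- move=> _ [->|[n [c ->]]]; first by rewrite !measure0.
  have [cn|cn] := ltnP c (scale q n); first exact: m12.
  rewrite (_ : [set _ | _] = set0) ?measure0//.
  by apply/seteqP; split=> y //= yc; have := code_lt y n; rewrite yc ltnNge cn.
Qed.

Variable R : realType.
Let nu := odometer_measure R q.

Lemma odometer_measure_code n c : (c < scale q n)%N ->
  nu [set y | code y n = c] = ((scale q n)%:R^-1)%:E.
Proof.
move=> cn; have := @odometer_measureP R q n (digits q c).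
rewrite /scale natr_prod -prodfV => <-; congr (nu _).
apply/seteqP; split=> y /= E; last first.
  rewrite -(modn_small cn) -code_digits.
  by apply: eq_bigr => i _; rewrite E.
move=> i i_n; apply/val_inj => /=.
have H m : (m <= n)%N -> code y m = code (digits q c) m.
  by move=> mn; rewrite code_digits -E code_modE.
rewrite -[LHS]code_digit -[RHS](code_digit (digits q c)).
by rewrite H.
Qed.

Lemma odometer_automorphism : automorphism nu (@odometer q).
Proof.
split; first exact: odometer_bimeasurable.
pose m : probability (odometer_space q) R := distribution nu (mfun_Sub (mem_set measurable_odometer)).
change (forall A, measurable A -> m A = nu A).
apply: odometer_measure_unique.
  exact: (le_lt_trans (@probability_le1 _ _ R m setT measurableT) (ltry 1)).
move=> n c cn.
transitivity (nu [set y | code y n = (c + (scale q n).-1) %% scale q n]%N).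
  congr (nu _); apply/seteqP; split=> y /=; rewrite code_odometer => E.
    rewrite -E modnDml addSn -addnS prednK ?scale_gt0//.
    by rewrite modnDr modn_small ?code_lt.
  rewrite E -addn1 modnDml -addnA addn1 prednK ?scale_gt0//.
  by rewrite modnDr modn_small.
have cm : ((c + (scale q n).-1) %% scale q n < scale q n)%N.
  by rewrite ltn_pmod// scale_gt0.
exact: etrans (odometer_measure_code cm) (esym (odometer_measure_code cn)).
Qed.

Lemma odometer_aperiodic : aperiodic nu (@odometer q).
Proof. by apply: aeW => y n; exact: odometer_free. Qed.

End odometer_measurability.

(** * Real-valued probabilities and measurable embeddings *)

Lemma set_of_cons (I : eqType) (i : I) s : [set` i :: s] = i |` [set` s].
Proof.
apply/seteqP; split=> j /=.
  by rewrite in_cons => /orP[/eqP ->|]; [left|right].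
by move=> [->|js]; rewrite in_cons ?eqxx// js orbT.
Qed.

Lemma geometric_half_le (R : realFieldType) n : \sum_(i < n) (2^-1 : R) ^+ i <= 2.
Proof.
have -> : \sum_(i < n) (2^-1 : R) ^+ i = 2 - 2 * 2^-1 ^+ n.
  elim: n => [|n IH]; first by rewrite big_ord0 expr0; lra.
  by rewrite big_ord_recr /= IH exprS; lra.
by rewrite lerBlDr lerDl mulr_ge0// exprn_ge0.
Qed.

Section real_valued_probability.
Context d (T : measurableType d) (R : realType) (mu : probability T R).
Implicit Types A B : set T.

Definition pr A : R := fine (mu A).

Lemma prE A : measurable A -> mu A = (pr A)%:E.
Proof. by move=> mA; rewrite fineK// fin_num_measure. Qed.

Lemma pr0 : pr set0 = 0. Proof. by rewrite /pr measure0. Qed.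

Lemma prT : pr setT = 1. Proof. by rewrite /pr probability_setT. Qed.

Lemma pr_ge0 A : 0 <= pr A. Proof. exact/fine_ge0/measure_ge0. Qed.

Lemma le_pr A B : measurable A -> measurable B -> A `<=` B -> pr A <= pr B.
Proof.
by move=> mA mB AB; rewrite -lee_fin -!prE// le_measure// inE.
Qed.

Lemma pr_le1 A : measurable A -> pr A <= 1.
Proof. by move=> mA; rewrite -prT le_pr. Qed.

Lemma prU A B : measurable A -> measurable B -> A `&` B = set0 ->
  pr (A `|` B) = pr A + pr B.
Proof.
move=> mA mB AB; apply/EFin_inj; rewrite EFinD -!prE//; last exact: measurableU.
by rewrite measureU.
Qed.

Lemma prD A B : measurable A -> measurable B -> B `<=` A ->
  pr (A `\` B) = pr A - pr B.
Proof.
move=> mA mB BA; rewrite -[in RHS](setDUK BA) prU//.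
- by rewrite addrC addKr.
- exact: measurableD.
- by rewrite setDE setICA setICr setI0.
Qed.

Lemma prC A : measurable A -> pr (~` A) = 1 - pr A.
Proof. by move=> mA; rewrite -setTD prD// prT. Qed.

Lemma prU_le A B : measurable A -> measurable B -> pr (A `|` B) <= pr A + pr B.
Proof.
move=> mA mB; rewrite -(setDUK (@subsetUl _ A B)) prU//.
- rewrite lerD2l; apply: le_pr => //.
    by apply: measurableD => //; exact: measurableU.
  by move=> x [[]].
- by apply: measurableD => //; exact: measurableU.
- by rewrite setDE setICA setICr setI0.
Qed.

Lemma pr_seq (I : eqType) (s : seq I) (F : I -> set T) : uniq s ->
  (forall i, i \in s -> measurable (F i)) -> trivIset [set` s] F ->
  pr (\bigcup_(i in [set` s]) F i) = \sum_(i <- s) pr (F i).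
Proof.
elim: s => [|i s IH] /=; first by rewrite set_nil bigcup_set0 big_nil pr0.
move=> /andP[nis us] mF tF.
rewrite set_of_cons bigcup_setU1 big_cons -IH//; last 2 first.
- by move=> j js; apply: mF; rewrite inE js orbT.
- by apply: sub_trivIset tF => j /=; rewrite inE => ->; rewrite orbT.
rewrite prU//.
- by apply: mF; rewrite inE eqxx.
- apply: fin_bigcup_measurable => // j js.
  by apply: mF; rewrite inE; apply/orP; right.
- apply/seteqP; split=> x //= [Fi [j js Fj]].
  have ij : i = j.
    apply: tF; rewrite /= ?inE ?eqxx//; first by apply/orP; right.
    by exists x.
  by rewrite ij js in nis.
Qed.

Lemma pr_seq_le (I : eqType) (s : seq I) (F : I -> set T) :
  (forall i, i \in s -> measurable (F i)) ->
  pr (\bigcup_(i in [set` s]) F i) <= \sum_(i <- s) pr (F i).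
Proof.
elim: s => [|i s IH] /=; first by rewrite set_nil bigcup_set0 big_nil pr0.
move=> mF; rewrite set_of_cons bigcup_setU1 big_cons.
have mFs j : j \in s -> measurable (F j).
  by move=> js; apply: mF; rewrite inE js orbT.
apply: le_trans (prU_le _ _) _.
- by apply: mF; rewrite inE eqxx.
- exact: fin_bigcup_measurable.
- by rewrite lerD2l IH.
Qed.

Lemma pr_bigcup_cvg (F : nat -> set T) (e : R) : (forall n, measurable (F n)) ->
  (forall m n, (m <= n)%N -> F m `<=` F n) -> 0 < e ->
  exists n, pr (\bigcup_n F n) < pr (F n) + e.
Proof.
move=> mF ndF e0.
have mU : measurable (\bigcup_n F n) by exact: bigcupT_measurable.
have : mu (F n) @[n --> \oo] --> (pr (\bigcup_n F n))%:E.
  rewrite -prE//; apply: nondecreasing_cvg_mu => // m n mn.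
  exact/subsetPset/ndF.
move=> /fine_cvgP[_ /cvgrPdist_lt /(_ _ e0)[n _]].
move=> /(_ n (leqnn n)) /=; rewrite -/(pr _) ltr_distl => /andP[_ ?].
by exists n.
Qed.

Lemma pr_bigcup_le (F : nat -> set T) (M : R) : (forall n, measurable (F n)) ->
  (forall n, \sum_(i < n) pr (F i) <= M) -> pr (\bigcup_n F n) <= M.
Proof.
move=> mF FM; apply/ler_addgt0Pr => e e0.
pose G n := \bigcup_(i in [set` iota 0 n]) F i.
have mG n : measurable (G n) by apply: fin_bigcup_measurable.
have GF : \bigcup_n G n = \bigcup_n F n.
  apply/seteqP; split=> x [n _]; first by move=> [i _ ?]; exists i.
  have nn : n \in iota 0 n.+1 by rewrite mem_iota ltnSn.
  by move=> Fnx; exists n.+1 => //; exists n; [exact: nn|].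
have [|n] := pr_bigcup_cvg mG _ e0.
  move=> m n mn x [i /=]; rewrite mem_iota /= add0n => im Fi; exists i => //=.
  by rewrite mem_iota /= add0n (leq_trans im).
rewrite GF => /ltW h; apply: le_trans h _; rewrite lerD2r.
apply: le_trans (FM n); rewrite -(big_mkord xpredT (fun i => pr (F i))).
by rewrite /index_iota subn0; exact: pr_seq_le.
Qed.

Lemma pr_bigcup0 (F : nat -> set T) : (forall n, measurable (F n)) ->
  (forall n, pr (F n) = 0) -> pr (\bigcup_n F n) = 0.
Proof.
move=> mF F0; apply/eqP; rewrite eq_le pr_ge0 andbT.
by apply: pr_bigcup_le => // n; rewrite big1.
Qed.

Lemma pr_tail (F : nat -> set T) n : (forall n, measurable (F n)) ->
  (forall n, pr (F n) <= 2^-1 ^+ n) ->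
  pr (\bigcup_(j in [set j | (n <= j)%N]) F j) <= 2 * 2^-1 ^+ n.
Proof.
move=> mF F2; rewrite (_ : \bigcup_(_ in _) _ = \bigcup_k F (k + n)%N); last first.
  apply/seteqP; split=> x [j jn Fj]; last first.
    by exists (j + n)%N => //=; rewrite leq_addl.
  by exists (j - n)%N => //; rewrite subnK.
apply: pr_bigcup_le => // k.
apply: (@le_trans _ _ (\sum_(i < k) 2^-1 ^+ i * 2^-1 ^+ n)).
  by apply: ler_sum => i _; rewrite -exprD.
rewrite -mulr_suml ler_pM2r ?exprn_gt0//.
exact: geometric_half_le.
Qed.

Lemma pr_borel_cantelli (F : nat -> set T) : (forall n, measurable (F n)) ->
  (forall n, pr (F n) <= 2^-1 ^+ n) ->
  {ae mu, forall x, exists n, forall j, (n <= j)%N -> ~ F j x}.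
Proof.
move=> mF F2; pose U n := \bigcup_(j in [set j | (n <= j)%N]) F j.
have mU n : measurable (U n) by apply: bigcup_measurable.
have mI : measurable (\bigcap_n U n) by exact: bigcap_measurableType.
exists (\bigcap_n U n); split=> //; last first.
  move=> x /= H n _; apply: contrapT => nU; apply: H; exists n => j nj Fj.
  by apply: nU; exists j.
rewrite prE//; congr (_%:E); apply/eqP; rewrite eq_le pr_ge0 andbT.
apply/ler_addgt0Pr => e e0; rewrite add0r.
have [n nP] : exists n, 2 * 2^-1 ^+ n < e :> R.
  have : (2^-1 : R) ^+ n @[n --> \oo] --> 0 by apply: cvg_expr; rewrite ger0_norm; lra.
  move=> /cvgrPdist_lt /(_ (e / 2)); rewrite divr_gt0// => /(_ erefl)[n _].
  move=> /(_ n (leqnn n)) /=; rewrite sub0r normrN ger0_norm ?exprn_ge0// => h.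
  by exists n; lra.
apply: le_trans (ltW nP); apply: le_trans (pr_tail n mF F2).
by apply: le_pr => //; [exact: mU|move=> x; apply].
Qed.

End real_valued_probability.

Section measurable_predicates.
Context d (T : measurableType d).

Lemma measurable_all (P : nat -> T -> Prop) :
  (forall n, measurable [set x | P n x]) -> measurable [set x | forall n, P n x].
Proof.
move=> mP; rewrite (_ : [set _ | _] = \bigcap_n [set x | P n x]).
  exact: bigcap_measurableType.
by apply/seteqP; split=> x /= H => [n _|n]; exact: H.
Qed.

Lemma measurable_ex (P : nat -> T -> Prop) :
  (forall n, measurable [set x | P n x]) -> measurable [set x | exists n, P n x].
Proof.
move=> mP; rewrite (_ : [set _ | _] = \bigcup_n [set x | P n x]).
  exact: bigcupT_measurable.
by apply/seteqP; split=> x /= [n]; [exists n|move=> _; exists n].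
Qed.

Lemma measurable_cstP (P : Prop) : measurable [set x : T | P].
Proof.
have [p|np] := pselect P.
  by rewrite (_ : [set _ | _] = setT)//; apply/seteqP; split.
by rewrite (_ : [set _ | _] = set0)//; apply/seteqP; split.
Qed.

Lemma measurable_conj (P Q : T -> Prop) : measurable [set x | P x] ->
  measurable [set x | Q x] -> measurable [set x | P x /\ Q x].
Proof. exact: measurableI. Qed.

Lemma measurable_imp (P Q : T -> Prop) : measurable [set x | P x] ->
  measurable [set x | Q x] -> measurable [set x | P x -> Q x].
Proof.
move=> mP mQ; rewrite (_ : [set _ | _] = ~` [set x | P x] `|` [set x | Q x]).
  by apply: measurableU => //; exact: measurableC.
apply/seteqP; split=> x /= => [H|[nP|Qx]] //.
by have [Px|] := pselect (P x); [right; exact: H|left].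
Qed.

Variable q : radix.

Lemma measurable_to_odometer (f : T -> odometer_space q) :
  (forall n a, measurable [set x | f x n = a]) -> measurable_fun setT f.
Proof.
move=> mf.
have : preimage_set_system setT f (@coordinate_sets q) `<=` measurable;
  last exact: (@measurability _ _ _ (odometer_space q) _ _ (@coordinate_sets q)).
by move=> _ [_ [n [a ->]] <-]; rewrite setTI; exact: mf.
Qed.

Lemma measurable_preimage d2 (T2 : measurableType d2) (f : T -> T2) A :
  measurable_fun setT f -> measurable A -> measurable (f @^-1` A).
Proof. by move=> mf mA; rewrite -[X in measurable X]setTI; exact: mf. Qed.

Lemma measurable_odometer_eq (f g : T -> odometer_space q) :
  measurable_fun setT f -> measurable_fun setT g ->
  measurable [set x | f x = g x].
Proof.
move=> mf mg; rewrite (_ : [set _ | _] =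
    [set x | forall n, exists c, code (f x) n = c /\ code (g x) n = c]).
  apply: measurable_all => n; apply: measurable_ex => c.
  apply: (@measurableI _ _ [set x | code (f x) n = c] [set x | code (g x) n = c]).
    exact: (measurable_preimage mf (measurable_code_eq n c)).
  exact: (measurable_preimage mg (measurable_code_eq n c)).
apply/seteqP; split=> x /= => [-> n|H]; first by eexists.
by apply: code_inj => n; have [c [-> ->]] := H n.
Qed.

End measurable_predicates.

(** * Cantor-Bernstein for measurable embeddings *)

Section bernstein.
Context d1 d2 (X : measurableType d1) (Y : measurableType d2).

Definition measurable_embedding d1' d2' (X' : measurableType d1')
    (Y' : measurableType d2') (f : X' -> Y') : Prop :=
  [/\ injective f, measurable_fun setT f
    & forall A, measurable A -> measurable (f @` A)].

(** The last clause tells which of the two embeddings was used at [x]; it is what makes it possible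
    to identify [H] with a given map almost everywhere. *)
Lemma measurable_bernstein (F : X -> Y) (G : Y -> X) :
  measurable_embedding F -> measurable_embedding G ->
  exists H : X -> Y, bimeasurable_bijection H /\
    forall x, H x = F x \/ G (H x) = x.
Proof.
move=> [Fi Fm FA] [Gi Gm GA].
(* [A] collects the points whose backward history under [G] and [F] stops outside the range of [G]:
   [F] must be used there, and [G] can be inverted elsewhere. *)
pose A_ := fix A_ n : set X := if n is m.+1 then G @` (F @` A_ m) else ~` range G.
pose A := \bigcup_n A_ n.
have mA : measurable A.
  apply: bigcupT_measurable; elim=> [|n IH] /=; first exact/measurableC/GA.
  exact/GA/FA.
pose G' := inverse G.
have G'K y : G' (G y) = y by apply: pinvKV; rewrite ?inE//; apply: in2W.
have nAG x : ~ A x -> G (G' x) = x.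
  move=> nAx; have [[y _ <-]|nG] := pselect (range G x); first by rewrite G'K.
  by exfalso; apply: nAx; exists 0%N.
have AGF x : A x -> A (G (F x)).
  by move=> [n _ Ax]; exists n.+1 => //=; exists (F x) => //; exists x.
pose H x := if `[< A x >] then F x else G' x.
have HA x : A x -> H x = F x by rewrite /H; case: asboolP.
have HnA x : ~ A x -> H x = G' x by rewrite /H; case: asboolP.
have Hi : injective H.
  move=> x z; have [Ax|nAx] := pselect (A x); have [Az|nAz] := pselect (A z).
  - by rewrite !HA//; exact: Fi.
  - by rewrite HA// HnA// => E; exfalso; apply: (nAz); rewrite -(nAG z)// -E; exact: AGF.
  - by rewrite HnA// HA// => E; exfalso; apply: (nAx); rewrite -(nAG x)// E; exact: AGF.
  - by rewrite !HnA// => E; rewrite -(nAG x)// E nAG.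
have Hs y : exists x, H x = y.
  have [[[|n] _ /=]|nA] := pselect (A (G y)).
  - by move=> nr; exfalso; apply: nr; exists y.
  - move=> [_ [x Ax <-] /Gi yE]; exists x; rewrite HA//; by exists n.
  - by exists (G y); rewrite HnA.
exists H; split; last first.
  move=> x; have [Ax|nAx] := pselect (A x); first by left; exact: HA.
  by right; rewrite HnA// nAG.
split.
- exists (fun y => projT1 (cid (Hs y))) => x; last by case: cid.
  by case: cid => z /= /Hi.
- move=> _ B mB; rewrite setTI.
  rewrite (_ : H @^-1` B = (A `&` F @^-1` B) `|` (G @` B `\` A)).
    apply: measurableU; last by apply: measurableD => //; exact: GA.
    by apply: measurableI => //; exact: measurable_preimage.
  apply/seteqP; split=> x /=.
    have [Ax|nAx] := pselect (A x); first by rewrite HA//; left.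
    by rewrite HnA// => BG; right; split=> //; exists (G' x) => //; exact: nAG.
  by move=> [[Ax]|[[y By <-] nA]]; [rewrite HA|rewrite HnA// G'K].
- move=> B mB.
  rewrite (_ : H @` B = F @` (B `&` A) `|` G @^-1` (B `\` A)).
    apply: measurableU; first by apply: FA; exact: measurableI.
    by apply: measurable_preimage => //; exact: measurableD.
  apply/seteqP; split=> y /=.
    move=> [x Bx <-]; have [Ax|nAx] := pselect (A x).
      by left; exists x; rewrite ?HA.
    by right; rewrite HnA// nAG.
  move=> [[x [Bx Ax] <-]|[BG nA]]; first by exists x; rewrite ?HA.
  by exists (G y) => //; rewrite HnA.
Qed.

End bernstein.

(** * Embedding a standard Borel space in the odometer space *)

Section standard_embedding.
Variables (R : realType) (P : completePseudoMetricType R) (q : radix).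
Variables (D : set P) (D_countable : countable D) (D_dense : dense D).
Hypothesis P_hausdorff : hausdorff_space P.

Let radius (k : nat) : R := k.+1%:R^-1.

Let radius_gt0 k : 0 < radius k. Proof. by rewrite invr_gt0. Qed.

Let small_radius (e : R) k0 : 0 < e -> exists2 k, (k0 <= k)%N & radius k < e.
Proof.
move=> e0; exists (maxn k0 (Num.truncn e^-1)); first exact: leq_maxl.
rewrite /radius invf_plt ?posrE// (lt_le_trans (truncnS_gt _))// ler_nat.
by rewrite ltnS leq_maxr.
Qed.

(** An integer encodes a pair made of a centre and a radius. Integers encoding no pair fall back on
    [(0, 0)], which merely repeats a member of the base. *)
Definition base_set (d : nat -> P) j : set P :=
  let: (i, k) := odflt (0, 0)%N (unpickle j : option (nat * nat)) in
  (ball (d i) (radius k))°.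

Definition base_rank j : nat :=
  (odflt (0, 0)%N (unpickle j : option (nat * nat))).2.

Lemma base_set_open d j : open (base_set d j).
Proof. by rewrite /base_set; case: (odflt _ _) => i k; exact: open_interior. Qed.

Lemma base_set_neq0 d j : base_set d j !=set0.
Proof.
rewrite /base_set; case: (odflt _ _) => i k; exists (d i).
exact/nbhsx_ballx/radius_gt0.
Qed.

Lemma base_set_center d j : exists x, base_set d j `<=` ball x (radius (base_rank j)).
Proof.
rewrite /base_set /base_rank; case: (odflt _ _) => i k /=; exists (d i).
exact: interior_subset.
Qed.

Lemma dense_sequence : exists d : nat -> P, forall O, open O -> O !=set0 ->
  exists i, O (d i).
Proof.
have /countable_injP[f fI] := D_countable.
have [x0 [_ Dx0]] : (setT `&` D) !=set0 by apply: D_dense; [exists point|exact: openT].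
exists (fun i => xget x0 [set x | D x /\ f x = i]) => O oO O0.
have [x [Ox Dx]] := D_dense O0 oO; exists (f x).
case: xgetP => [y _ [Dy fyx]|/(_ x)]; last by case.
by rewrite (fI y x) ?inE.
Qed.

Lemma base_set_basis d : (forall O, open O -> O !=set0 -> exists i, O (d i)) ->
  forall (O : set P) x k0, open O -> O x -> exists j,
    [/\ (k0 <= base_rank j)%N, base_set d j x & closure (base_set d j) `<=` O].
Proof.
move=> dP O x k0 oO Ox.
have /nbhs_ballP[e /= e0 eO] : nbhs x O by exact: open_nbhs_nbhs.
(* The closure of a ball of radius [r] whose centre is within [r / 2] of [x] stays within [5 r / 2]
   of [x]; [r < e / 4] suffices. *)
have [|k kk0 ke] := @small_radius (e / 4) k0; first by lra.
have r0 := radius_gt0 k; set r := radius k in ke r0.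
have [||i xi] := dP (ball x (r / 2))°.
- exact: open_interior.
- by exists x; apply: nbhsx_ballx; lra.
have {}xi := interior_subset xi.
exists (pickle (i, k)); rewrite /base_rank /base_set pickleK /=; split=> //.
- apply/nbhs_ballP; exists (r / 2) => /=; first by lra.
  move=> y xy; rewrite [radius k](_ : _ = r / 2 + r / 2); last by rewrite -/r; lra.
  apply: ball_triangle xy; exact: ball_sym.
- move=> y cy; apply: eO.
  have /cy[z [/interior_subset bz yz]] : nbhs y (ball y r) by exact: nbhsx_ballx.
  apply: (@le_ball _ _ _ (r / 2 + r + r)); first by lra.
  apply: ball_triangle (ball_sym yz).
  by apply: ball_triangle xi _.
Qed.

(** Every radix is at least 2, so sequences of bits live in any odometer space. *)
Definition bit (b : bool) n : 'I_(q n) := Ordinal (leq_ltn_trans (leq_b1 b) (base_ge2 q n)).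

Definition bits (U : nat -> set P) (x : P) : odometer_space q :=
  fun n => bit `[< U n x >] n.

Lemma bits1 U x n : (bits U x n = 1 :> nat)%N <-> U n x.
Proof. by rewrite /bits /=; case: asboolP. Qed.

(* The coded subfamilies of the base which are the neighbourhood traces of a
   point; completeness produces the point. *)
Definition bits_image (U : nat -> set P) : set (odometer_space q) :=
  [set z | [/\ forall n, (z n <= 1)%N,
    forall k, exists j, (k <= base_rank j)%N /\ z j = 1 :> nat,
    forall i j, z i = 1 :> nat -> z j = 1 :> nat -> exists k, z k = 1 :> nat /\
      closure (U k) `<=` U i `&` U j
    & forall i j, z i = 1 :> nat -> U i `<=` U j -> z j = 1 :> nat]].

Lemma range_bits d : (forall O, open O -> O !=set0 -> exists i, O (d i)) ->
  range (bits (base_set d)) = bits_image (base_set d).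
Proof.
move=> /base_set_basis dB; pose U := base_set d.
have Uo j : open (U j) := base_set_open d j.
apply/seteqP; split=> z.
  move=> [x _ <-]; split.
  - by move=> n; rewrite /= leq_b1.
  - move=> k; have [j [kj Ujx _]] := dB setT x k openT I.
    by exists j; split=> //; apply/bits1.
  - move=> i j /bits1 Uix /bits1 Ujx.
    have [|//|k [_ Ukx kU]] := dB (U i `&` U j) x 0%N; first exact: openI.
    by exists k; split=> //; apply/bits1.
  - by move=> i j /bits1 Uix ij; apply/bits1/ij.
move=> [z01 zr zI zS].
(* The filter generated by the coded sets: the third clause of [bits_image] makes them a filter
   base, and the second provides arbitrarily small members, so that [F] is Cauchy. *)
pose F := [set A : set P | exists j, z j = 1 :> nat /\ U j `<=` A].
have FF : ProperFilter F.
  split; first by move=> [j [_ H]]; have [x /H] := base_set_neq0 d j.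
  split.
  - by have [j [_ zj]] := zr 0%N; exists j.
  - move=> A B [i [zi iA]] [j [zj jB]].
    have [k [zk kij]] := zI _ _ zi zj; exists k; split=> // x /subset_closure.
    by move=> /kij[? ?]; split; [exact: iA|exact: jB].
  - by move=> A B AB [i [zi iA]]; exists i; split=> // x /iA; exact: AB.
have /cauchy_cvg cvF : cauchy F.
  apply: cauchy_exP => e e0; have [k _ ke] := small_radius 0 e0.
  have [j [kj zj]] := zr k; have [x xj] := base_set_center d j.
  exists x, j; split=> // y /xj; apply: le_ball; apply: le_trans (ltW ke).
  by rewrite /radius lef_pV2 ?posrE// ler_nat ltnS.
pose x := lim F; have Fx : nbhs x `<=` F := cvF.
(* A coded [U j] contains the closure of a coded set, hence the limit [x]. Conversely a
   neighbourhood [U j] of [x] contains a coded set, and the last clause then codes [U j] itself. *)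
exists x => //; have zU j : z j = 1 :> nat <-> U j x.
  split=> [zj|Ujx].
    have [k [zk kU]] := zI _ _ zj zj; suff /kU[] : closure (U k) x by [].
    move=> B /Fx FB; have /filter_ex[y [yk yB]] : F (U k `&` B).
      by apply: filterI => //; exists k; split.
    by exists y.
  have /Fx[i [zi iU]] : nbhs x (U j) by exact: open_nbhs_nbhs.
  exact: zS zi iU.
apply: functional_extensionality_dep => n; apply/val_inj => /=.
case: asboolP => [/zU ->//|nU].
have : z n <> 1%N :> nat by move/zU.
by have := z01 n; case: (nat_of_ord (z n)) => [|[|]].
Qed.

Lemma measurable_bits_image U : measurable (bits_image U).
Proof.
have m1 n : measurable [set z : odometer_space q | z n = 1 :> nat].
  rewrite (_ : [set _ | _] = [set z | z n = bit true n]).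
    exact: measurable_digit.
  by apply/seteqP; split=> z /=; [move=> zn; exact: val_inj|move=> ->].
rewrite (_ : bits_image U =
    ([set z | forall n, (z n <= 1)%N] `&`
     [set z | forall k, exists j, (k <= base_rank j)%N /\ z j = 1 :> nat]) `&`
    ([set z | forall i j, z i = 1 :> nat -> z j = 1 :> nat ->
        exists k, z k = 1 :> nat /\ closure (U k) `<=` U i `&` U j] `&`
     [set z | forall i j, z i = 1 :> nat -> U i `<=` U j -> z j = 1 :> nat])); last first.
  by apply/seteqP; split=> z /=; [move=> []|move=> [[] ? ? []]].
apply: measurableI; apply: measurableI.
- apply: measurable_all => n.
  rewrite (_ : [set _ | _] = [set z | z n = bit true n] `|` [set z | z n = bit false n]).
    by apply: measurableU; exact: measurable_digit.
  apply/seteqP; split=> z /=; last by move=> [|] ->.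
  case E : (nat_of_ord (z n)) => [|[|//]] _; [right|left]; exact: val_inj.
- apply: measurable_all => k; apply: measurable_ex => j.
  apply: measurable_conj => //; exact: measurable_cstP.
- apply: measurable_all => i; apply: measurable_all => j.
  do 2 (apply: measurable_imp => //); apply: measurable_ex => k.
  apply: measurable_conj => //; exact: measurable_cstP.
- apply: measurable_all => i; apply: measurable_all => j.
  do 2 (apply: measurable_imp => //); exact: measurable_cstP.
Qed.

Lemma bits_embedding : exists U : nat -> set P,
  (forall n, open (U n)) /\
  @measurable_embedding _ _ (g_sigma_algebraType (@open P)) (odometer_space q) (bits U).
Proof.
have [d dP] := dense_sequence; have dB := base_set_basis dP.
exists (base_set d); set U := base_set d.
have Uo j : open (U j) := base_set_open d j; split=> //.
have inj : injective (bits U).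
  move=> x y xy; apply: contrapT => /eqP xny.
  move: P_hausdorff; rewrite open_hausdorff => /(_ x y xny)[[A B] /=].
  rewrite !inE => -[Ax By] [oA _ /eqP AB].
  have [j [_ Ujx jA]] := dB A x 0%N oA Ax.
  have /bits1 Ujy : bits U y j = 1 :> nat by rewrite -xy; apply/bits1.
  have : (A `&` B) y by split=> //; exact/jA/subset_closure.
  by rewrite (eqP AB).
split=> //.
- apply: measurable_to_odometer => n a.
  have mU : measurable (U n : set (g_sigma_algebraType (@open P))).
    by apply: sub_sigma_algebra; exact: Uo.
  rewrite (_ : [set x | bits U x n = a] =
    (U n `&` [set _ | bit true n = a]) `|` (~` U n `&` [set _ | bit false n = a])).
    apply: measurableU; apply: measurableI => //; try exact: measurable_cstP.
    exact: measurableC.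
  apply/seteqP; split=> x /=; rewrite /bits; first by case: asboolP => ? ?; [left|right].
  by case: asboolP => ? [] [].
(* By injectivity, the image of a base set is cut out of the Borel range by one digit; as injective
   images commute with complements inside the range, all Borel sets follow. *)
- have mR : measurable (range (bits U)).
    rewrite range_bits//; exact: measurable_bits_image.
  have mUj j : measurable (bits U @` U j).
    rewrite (_ : _ @` _ = range (bits U) `&` [set z | z j = bit true j]).
      apply: measurableI => //; exact: measurable_digit.
    apply/seteqP; split=> z.
      move=> [x Ujx <-]; split; first by exists x.
      by apply/val_inj/bits1.
    move=> [[x _ <-] /= E]; exists x => //; apply/bits1; by rewrite E.
  move=> A; apply: (@smallest_sub _ _ _ [set A : set P | measurable (bits U @` A)]).
    split=> /=.
    + by rewrite image_set0.
    + move=> B mB; rewrite setTD (_ : _ @` _ = range (bits U) `\` (bits U @` B)).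
        exact: measurableD.
      apply/seteqP; split=> z.
        move=> [x nB <-]; split; first by exists x.
        by move=> [y By /inj yx]; rewrite -yx in nB.
      by move=> [[x _ <-] nB]; exists x => // Bx; apply: nB; exists x.
    + by move=> F mF; rewrite image_bigcup; exact: bigcupT_measurable.
  move=> O oO /=; rewrite (_ : O = \bigcup_(j in [set j | U j `<=` O]) U j).
    by rewrite image_bigcup; apply: bigcup_measurable => j _; exact: mUj.
  apply/seteqP; split=> x; last by move=> [j /= jO /jO].
  move=> Ox; have [j [_ Ujx jO]] := dB O x 0%N oO Ox.
  by exists j => //= y /subset_closure; exact: jO.
Qed.

End standard_embedding.

Lemma standard_borel_embedding (R : realType) d (X : measurableType d) (q : radix) :
  standard_borel R X -> exists e : X -> odometer_space q,
    measurable_embedding e /\ forall x n, (e x n <= 1)%N.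
Proof.
move=> [P [hP [D cD dD] [f [fb fm fA]]]].
have [U [Uo [bI bm bA]]] := bits_embedding q cD dD hP.
exists (bits q U \o f); split; last by move=> x n; rewrite /= leq_b1.
split.
- exact: inj_comp bI (bij_inj fb).
- exact: measurableT_comp.
- by move=> A mA; rewrite -image_comp; exact: (bA _ (fA _ mA)).
Qed.

(** * Null copies of the odometer space *)

Section null_copy.
Variables (R : realType) (q : radix).

Let nu := odometer_measure R q.
Implicit Types (y z : odometer_space q) (U V A K : set (odometer_space q)).

Definition cyl (v : nat * nat) : set (odometer_space q) :=
  [set y | code y v.1 = v.2].

Lemma measurable_cyl v : measurable (cyl v).
Proof. exact: measurable_code_eq. Qed.

(** Openness in the product topology, expressed by cylinders. *)
Definition odometer_open U := forall y, U y ->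
  exists n, forall z, code z n = code y n -> U z.

Lemma odometer_open_bigcup (F : nat -> set (odometer_space q)) :
  (forall n, odometer_open (F n)) -> odometer_open (\bigcup_n F n).
Proof.
move=> oF y [i _ /oF[n H]]; exists n => z /H Fz; by exists i.
Qed.

Lemma code_le y z m n : (m <= n)%N -> code y n = code z n -> code y m = code z m.
Proof. by move=> mn yz; rewrite -(code_modE y mn) yz code_modE. Qed.

Lemma odometer_openI U V : odometer_open U -> odometer_open V ->
  odometer_open (U `&` V).
Proof.
move=> oU oV y [/oU[m Hm] /oV[n Hn]]; exists (maxn m n) => z yz; split.
  by apply: Hm; apply: code_le yz; exact: leq_maxl.
by apply: Hn; apply: code_le yz; exact: leq_maxr.
Qed.

Lemma odometer_open_measurable U : odometer_open U -> measurable U.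
Proof.
move=> oU; rewrite (_ : U = [set y | exists n c, cyl (n, c) y /\ cyl (n, c) `<=` U]).
  apply: measurable_ex => n; apply: measurable_ex => c; apply: measurable_conj.
    exact: measurable_cyl.
  exact: measurable_cstP.
apply/seteqP; split=> y; last by move=> [n [c [yc]]]; apply.
by move=> /oU[n H]; exists n, (code y n); split=> // z /H.
Qed.

Lemma odometer_open_bigcapn (F : nat -> set (odometer_space q)) n :
  (forall n, odometer_open (F n)) ->
  odometer_open (\bigcap_(i in [set i | (i < n)%N]) F i).
Proof.
move=> oF; elim: n => [|n IH]; first by move=> y _; exists 0%N.
rewrite (_ : \bigcap_(_ in _) _ = (\bigcap_(i in [set i | (i < n)%N]) F i) `&` F n).
  exact: odometer_openI.
apply/seteqP; split=> y H.
  by split=> [i /= i_n|]; apply: H; rewrite /= ltnS // ltnW.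
move=> i /=; rewrite ltnS leq_eqVlt => /orP[/eqP->|]; first by case: H.
by case: H => H _ /H.
Qed.

(** Regularity is stated for a set and its complement together: the statement is then symmetric
    under complementation, and only countable unions take work. *)
Lemma odometer_regular A : measurable A -> forall e : R, 0 < e ->
  exists U V, [/\ odometer_open U, odometer_open V, A `<=` U, ~` A `<=` V
    & pr nu (U `&` V) < e].
Proof.
move: A; apply: odometer_sigma_ind.
  split=> /=.
  - move=> e e0; exists set0, setT; split=> //.
    + by move=> y _; exists 0%N.
    + by rewrite set0I pr0.
  - move=> A AP e /AP[U [V [oU oV AU AV UV]]]; exists V, U; split=> //.
    + by rewrite setTD.
    + by rewrite setTD setCK.
    + by rewrite setIC.
  - move=> F FP e e0.
    have /choice[U /choice[V H]] n : exists U V, [/\ odometer_open U, odometer_open V,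
        F n `<=` U, ~` F n `<=` V & pr nu (U `&` V) < e / 4 * 2^-1 ^+ n].
      by apply: FP; rewrite mulr_gt0 ?exprn_gt0//; lra.
    have oU n : odometer_open (U n) by case: (H n).
    have oV n : odometer_open (V n) by case: (H n).
    have mU n := odometer_open_measurable (oU n).
    have mV n := odometer_open_measurable (oV n).
    (* Only finite intersections of the [V i] remain open. The sets [W n] increase to the difference
       obtained from the full intersection, so stopping at a large [n] costs less than [e / 2], the
       other half of [e] being the sum of the errors of the [F n]. *)
    pose W n := (\bigcup_i U i) `\` \bigcap_(i in [set i | (i < n)%N]) V i.
    have mW n : measurable (W n).
      apply: measurableD; first exact: bigcupT_measurable.
      exact: bigcap_measurableType.
    have ndW m n : (m <= n)%N -> W m `<=` W n.
      move=> mn x [Ux nV]; split=> // VV; apply: nV => i /= im.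
      by apply: VV => /=; exact: leq_trans mn.
    have e20 : 0 < e / 2 by lra.
    have [n] := @pr_bigcup_cvg _ _ _ nu W _ mW ndW e20.
    have -> : \bigcup_n W n = (\bigcup_i U i) `\` \bigcap_i V i.
      apply/seteqP; split=> y; first by move=> [m _ [Uy nV]]; split=> // VV; apply: nV => i _; exact: VV.
      move=> [Uy nV]; have [i nVi] : exists i, ~ V i y.
        by apply: contrapT => nE; apply: nV => i _; apply: contrapT => nVi; apply: nE; exists i.
      by exists i.+1 => //; split=> // VV; apply/nVi/VV => /=.
    set UU := \bigcup_i U i; set VV := \bigcap_i V i.
    set Vn := \bigcap_(i in [set i | (i < n)%N]) V i => Hn.
    have mUU : measurable UU by exact: bigcupT_measurable.
    have mVV : measurable VV by exact: bigcap_measurableType.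
    have mVn : measurable Vn by exact: bigcap_measurableType.
    exists UU, Vn; split.
    + exact: odometer_open_bigcup.
    + exact: odometer_open_bigcapn.
    + by move=> y [i _ Fy]; exists i => //; case: (H i) => _ _ + _ _; apply.
    + move=> y nF i _; case: (H i) => _ _ _ + _; apply => Fi; apply: nF; by exists i.
    have E1 : pr nu (UU `&` Vn) = pr nu UU - pr nu (W n).
      by rewrite -setDD prD//; exact: measurableD.
    have E2 : pr nu (UU `&` VV) = pr nu UU - pr nu (UU `\` VV).
      by rewrite -setDD prD//; exact: measurableD.
    have E3 : pr nu (UU `&` VV) <= e / 2.
      apply: (@le_trans _ _ (pr nu (\bigcup_i (U i `&` V i)))).
        apply: le_pr; [exact: measurableI| |].
          by apply: bigcupT_measurable => i; exact: measurableI.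
        by move=> y [[i _ Ui] Vy]; exists i => //; split=> //; exact: Vy.
      apply: pr_bigcup_le => [i|k]; first exact: measurableI.
      apply: (@le_trans _ _ (\sum_(i < k) e / 4 * 2^-1 ^+ i)).
        by apply: ler_sum => i _; apply/ltW; case: (H i).
      by rewrite -mulr_sumr; have := geometric_half_le R k; nra.
    rewrite E1; move: Hn E2 E3; lra.
move=> n P e e0; exists [set y | P (code y n)], (~` [set y | P (code y n)]).
split=> //.
- by move=> y Py; exists n => z /= ->.
- by move=> y Py; exists n => z /= ->.
- by rewrite setICr pr0.
Qed.

Lemma pr_cyl n c : (c < scale q n)%N -> pr nu (cyl (n, c)) = (scale q n)%:R^-1.
Proof. by move=> cn; rewrite /pr [nu _](odometer_measure_code R cn). Qed.

Lemma pr_cyl_le v : pr nu (cyl v) <= (scale q v.1)%:R^-1.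
Proof.
case: v => n c; have [cn|cn] := ltnP c (scale q n); first by rewrite pr_cyl.
rewrite (_ : cyl _ = set0) ?pr0 ?invr_ge0//.
by apply/seteqP; split=> y //= yc; have := code_lt y n; rewrite yc ltnNge cn.
Qed.

Variable Y0 : set (odometer_space q).
Hypotheses (mY0 : measurable Y0) (Y0_full : pr nu Y0 = 1).

(** [K] is the complement of an open set of measure less than 1 that contains the complement of
    [Y0]. Being closed, it contains every point all of whose cylinders it charges; limits of nested
    charged cylinders will thus stay in [Y0]. *)
Lemma perfect_core : exists K, [/\ measurable K, K `<=` Y0, 0 < pr nu K
  & forall y, (forall n, 0 < pr nu (K `&` cyl (n, code y n))) -> K y].
Proof.
have [U [V [oU oV YU YV UV]]] := odometer_regular (measurableC mY0) ltr01.
have mU := odometer_open_measurable oU; have mV := odometer_open_measurable oV.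
have V1 : pr nu V = 1.
  apply/eqP; rewrite eq_le pr_le1//= -Y0_full le_pr//.
  by rewrite -[X in X `<=` _]setCK.
have U1 : pr nu U < 1.

  have : pr nu U <= pr nu (U `&` V) + pr nu (~` V).
    have := @prU_le _ _ _ nu _ _ (measurableI _ _ mU mV) (measurableC mV).
    apply: le_trans.
    apply: le_pr => //.
      by apply: measurableU; [exact: measurableI|exact: measurableC].
    by move=> y Uy; have [Vy|nVy] := pselect (V y); [left|right].
  by rewrite prC// V1 subrr addr0 => /le_lt_trans; apply.
exists (~` U); split.
- exact: measurableC.
- by rewrite -[X in _ `<=` X]setCK; exact: subsetC.
- by rewrite prC// subr_gt0.
- move=> y H Uy; have [n nU] := oU _ Uy; have := H n.
  rewrite (_ : _ `&` _ = set0) ?pr0 ?ltxx//.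
  by apply/seteqP; split=> z //= [nUz /nU].
Qed.

Variable K : set (odometer_space q).
Hypotheses (mK : measurable K) (K_pos : 0 < pr nu K).
Hypothesis K_closed :
  forall y, (forall n, 0 < pr nu (K `&` cyl (n, code y n))) -> K y.

Definition heavy v := 0 < pr nu (K `&` cyl v).

(** The measure is diffuse: a cylinder of level [m] has measure at most the inverse of [scale q m].
    Once [scale q m] is large, fewer than [b] of them cannot carry the mass of [K] in [cyl v]. *)
Lemma heavy_split v b m0 : heavy v -> exists m (s : seq nat),
  [/\ (m0 <= m)%N, (v.1 <= m)%N, size s = b, uniq s
    & forall c, c \in s -> heavy (m, c) /\ c = v.2 %[mod scale q v.1] ].
Proof.
move=> hv; pose m := maxn (maxn m0 v.1) (Num.truncn (b%:R / pr nu (K `&` cyl v))).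
have mm0 : (m0 <= m)%N by rewrite !leq_max leqnn.
have mv : (v.1 <= m)%N by rewrite !leq_max leqnn orbT.
have bm : b%:R < pr nu (K `&` cyl v) * (scale q m)%:R.
  rewrite mulrC -ltr_pdivrMr// (lt_le_trans (truncnS_gt _))// ler_nat.
  by rewrite (leq_trans _ (ltn_scale q m))// ltnS leq_maxr.
pose s := [seq c <- iota 0 (scale q m) |
  (c == v.2 %[mod scale q v.1])%N && `[< heavy (m, c) >]].
have us : uniq s by rewrite filter_uniq ?iota_uniq.
have bs : (b <= size s)%N.
  rewrite -(ler_nat R); apply/ltW/(lt_le_trans bm).
  rewrite -ler_pdivlMr ?ltr0n ?scale_gt0//.
  pose t := [seq c <- iota 0 (scale q m) | (c == v.2 %[mod scale q v.1])%N].
  apply: (@le_trans _ _ (\sum_(c <- t) pr nu (K `&` cyl (m, c)))).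
    apply: le_trans (pr_seq_le _ _); last first.
      by move=> c _; apply: measurableI => //; exact: measurable_cyl.
    apply: le_pr.
    - by apply: measurableI => //; exact: measurable_cyl.
    - apply: fin_bigcup_measurable => // c _.
      by apply: measurableI => //; exact: measurable_cyl.
    - move=> y [Ky yv]; exists (code y m) => //=.
      rewrite mem_filter mem_iota add0n code_lt andbT.
      by rewrite (code_mod _ mv); move: yv => -> /=; rewrite eqxx.
  rewrite big_filter (bigID (fun c => `[< heavy (m, c) >]))/=.
  rewrite [X in _ + X]big1 ?addr0; last first.
    move=> c /andP[_ /asboolPn nh]; apply/eqP; rewrite eq_le pr_ge0 andbT leNgt.
    exact/negP.
  rewrite -big_filter -/s.
  apply: (@le_trans _ _ (\sum_(c <- s) (scale q m)%:R^-1)).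
    apply: ler_sum => c _; apply: le_trans (pr_cyl_le (m, c)).
    apply: le_pr; [|exact: measurable_cyl|by move=> y []].
    by apply: measurableI => //; exact: measurable_cyl.
  by rewrite big_const_seq count_predT iter_addr_0 mulr_natl.
exists m, (take b s); split=> //.
- by rewrite size_take_min; apply/minn_idPl.
- exact: take_uniq.
- by move=> c /mem_take; rewrite mem_filter => /andP[/andP[/eqP ? /asboolP ?] _].
Qed.

(** The square in the lower bound on levels makes the copy null: generation [n] has [scale q n]
    cylinders, each of measure at most the inverse square of that number. *)
Lemma split_function : exists (lev : nat * nat -> nat -> nat)
    (sub : nat * nat -> nat -> seq nat),
  forall v n, heavy v -> [/\ (scale q n.+1 ^ 2 <= lev v n)%N, (v.1 <= lev v n)%N,
    size (sub v n) = q n, uniq (sub v n)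
    & forall c, c \in sub v n ->
        heavy (lev v n, c) /\ c = v.2 %[mod scale q v.1] ].
Proof.
have /choice[f fP] (vn : (nat * nat) * nat) : exists ms : nat * seq nat,
    heavy vn.1 -> [/\ (scale q vn.2.+1 ^ 2 <= ms.1)%N, (vn.1.1 <= ms.1)%N,
      size ms.2 = q vn.2, uniq ms.2
      & forall c, c \in ms.2 ->
        heavy (ms.1, c) /\ c = vn.1.2 %[mod scale q vn.1.1] ].
  have [hv|nh] := pselect (heavy vn.1); last by exists (0, [::])%N.
  by have [m [s H]] := heavy_split (q vn.2) (scale q vn.2.+1 ^ 2)%N hv; exists (m, s).
by exists (fun v n => (f (v, n)).1), (fun v n => (f (v, n)).2) => v n; exact: (fP (v, n)).
Qed.

Section scheme.
Variables (lev : nat * nat -> nat -> nat) (sub : nat * nat -> nat -> seq nat).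
Hypothesis splitP : forall v n, heavy v -> [/\ (scale q n.+1 ^ 2 <= lev v n)%N,
  (v.1 <= lev v n)%N, size (sub v n) = q n, uniq (sub v n)
  & forall c, c \in sub v n ->
      heavy (lev v n, c) /\ c = v.2 %[mod scale q v.1] ].

(** A Cantor scheme of charged cylinders with [q n] branches at depth [n]; the digits of [y] select
    the branches. *)
Fixpoint node y n : nat * nat :=
  if n is m.+1 then (lev (node y m) m, nth 0%N (sub (node y m) m) (y m))
  else (0, 0)%N.

Lemma node_heavy y n : heavy (node y n).
Proof.
elim: n => [|n IH] /=.
  rewrite /heavy (_ : cyl _ = setT) ?setIT//.
  by apply/seteqP; split=> z // _; rewrite /cyl /= code0.
have [_ _ sz _ H] := splitP n IH.
by apply: (H _ _).1; rewrite mem_nth// sz.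
Qed.

(** The successor accommodates the root, of level 0 while [scale q 0] is 1. *)
Lemma node_level y n : (scale q n ^ 2 <= (node y n).1.+1)%N.
Proof.
case: n => [|n] /=; first by rewrite /scale big_ord0.
by have [H _ _ _ _] := splitP n (node_heavy y n); rewrite leqW.
Qed.

Lemma node_level_ge y n : (n <= (node y n).1)%N.
Proof. by have := node_level y n; have := ltn_scale q n; nia. Qed.

Lemma node_mono y m n : (m <= n)%N -> ((node y m).1 <= (node y n).1)%N /\
  (node y n).2 = (node y m).2 %[mod scale q (node y m).1].
Proof.
move=> /subnK <-; elim: (n - m)%N => // k [le eq]; rewrite addSn.
have [_ H sz _ E] := splitP (k + m) (node_heavy y (k + m)).
split; first exact: leq_trans le H.
rewrite -eq /=; have /E[_ {}E] : nth 0%N (sub (node y (k + m)) (k + m)) (y (k + m)%N)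
    \in sub (node y (k + m)) (k + m) by rewrite mem_nth// sz.
have d := scale_dvd q le.
by rewrite -(modn_dvdm _ d) E modn_dvdm.
Qed.

Lemma node_lt y n : ((node y n).2 < scale q (node y n).1)%N.
Proof.
rewrite ltnNge; apply/negP => H; have := node_heavy y n; rewrite /heavy.
rewrite (_ : _ `&` _ = set0) ?pr0 ?ltxx//.
apply/seteqP; split=> z //= [_ E].
by have := code_lt z (node y n).1; rewrite E ltnNge H.
Qed.

Lemma node_ext y z n : (forall i, (i < n)%N -> y i = z i) -> node y n = node z n.
Proof.
elim: n => // n IH H /=; rewrite (IH (fun i h => H i (ltnW h))).
by rewrite (H n).
Qed.

Definition scheme y : odometer_space q := @of_residues q (fun n => (node y n).2).

Lemma code_scheme y n : code (scheme y) n = ((node y n).2 %% scale q n)%N.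
Proof.
apply: code_of_residues => m; have [_ H] := node_mono y (leqnSn m).
have d := scale_dvd q (node_level_ge y m).
by rewrite -(modn_dvdm _ d) H modn_dvdm.
Qed.

Lemma scheme_node y n : cyl (node y n) (scheme y).
Proof.
rewrite /cyl /= code_scheme; have [_ ->] := node_mono y (node_level_ge y n).
by rewrite modn_small// node_lt.
Qed.

Lemma scheme_core y : K (scheme y).
Proof.
apply: K_closed => n; apply: lt_le_trans (node_heavy y n) _.
apply: le_pr; try by apply: measurableI => //; exact: measurable_cyl.
move=> z [Kz zn]; split=> //.
by rewrite /cyl /= code_scheme -zn code_modE// node_level_ge.
Qed.

Lemma cyl_node_le y m n : (m <= n)%N -> cyl (node y n) `<=` cyl (node y m).
Proof.
move=> mn z; rewrite /cyl /= => zn; have [le E] := node_mono y mn.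
by rewrite -(code_modE z le) zn E modn_small// node_lt.
Qed.

Lemma node_agree w y z n : cyl (node y n) w -> cyl (node z n) w ->
  forall i, (i < n)%N -> y i = z i.
Proof.
elim: n => // n IH wy wz.
have {}IH := IH (cyl_node_le (leqnSn n) wy) (cyl_node_le (leqnSn n) wz).
have E := node_ext IH.
move=> i; rewrite ltnS leq_eqVlt => /orP[/eqP ->|]; last exact: IH.
have [_ _ sz u _] := splitP n (node_heavy z n).
move: wy wz; rewrite /cyl /= E => -> /eqP; rewrite nth_uniq ?sz//.
by move=> /eqP; exact: val_inj.
Qed.

Lemma digits_agree y n i : (i < n)%N -> digits q (code y n) i = y i.
Proof.
move=> i_n; apply/val_inj; rewrite -[LHS]code_digit -[RHS]code_digit.
by rewrite code_digits code_mod// modn_small// code_lt.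
Qed.

(** By [node_agree] a point belongs to at most one cylinder of each generation. The range is
    therefore the intersection over the generations of countable unions of cylinders, and fixing a
    digit selects some of these cylinders. *)
Lemma scheme_image (A : set (odometer_space q)) :
  A = setT \/ (exists n (a : 'I_(q n)), A = [set y | y n = a]) ->
  measurable (scheme @` A).
Proof.
have sub_node n (C : nat -> Prop) :
    measurable [set w | exists c, C c /\ cyl (node (digits q c) n) w].
  apply: measurable_ex => c; apply: measurable_conj; first exact: measurable_cstP.
  exact: measurable_cyl.
have nodeE y n : node (digits q (code y n)) n = node y n.
  by apply: node_ext => i; exact: digits_agree.
have rE : range scheme =
    [set w | forall n, exists c, True /\ cyl (node (digits q c) n) w].
  apply/seteqP; split=> w.
    move=> [y _ <-] n; exists (code y n); split=> //; rewrite nodeE.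
    exact: scheme_node.
  (* Branches of different depths containing [w] agree on their common digits, so the diagonal
     sequence follows all of them. *)
  move=> /choice[c H]; pose y : odometer_space q := fun i => digits q (c i.+1) i.
  have wy n : cyl (node y n) w.
    have [_ Hn] := H n; rewrite (_ : node y n = node (digits q (c n)) n)//.
    apply: node_ext => i i_n; rewrite /y.
    apply: (@node_agree w _ _ i.+1) => //; first by case: (H i.+1).
    exact: cyl_node_le Hn.
  exists y => //; apply: code_inj => n; apply: code_le (node_level_ge y n) _.
  by have := scheme_node y n; rewrite /cyl /= => ->; rewrite wy.
have mr : measurable (range scheme) by rewrite rE; apply: measurable_all.
case=> [->|[n [a ->]]]; first exact: mr.
rewrite (_ : _ @` _ = range scheme `&` [set w | exists c,
    digits q c n = a /\ cyl (node (digits q c) n.+1) w]).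
  exact: measurableI.
apply/seteqP; split=> w.
  move=> [y yn <-]; split; first by exists y.
  exists (code y n.+1); rewrite digits_agree// nodeE; split=> //.
  exact: scheme_node.
move=> [[y _ <-] [c [ca yc]]]; exists y => //=; rewrite -ca.
exact: (node_agree (scheme_node y n.+1) yc).
Qed.

Lemma scheme_embedding : measurable_embedding scheme.
Proof.
have inj : injective scheme.
  move=> y z yz; apply: functional_extensionality_dep => n.
  apply: (node_agree (scheme_node y n.+1)) => //; rewrite yz; exact: scheme_node.
split=> //.
- apply: measurable_to_odometer => n a; rewrite (_ : [set _ | _] = [set y |
      (fun c => (node (digits q c) n.+1).2 %% scale q n.+1 %/ scale q n = a)%N
        (code y n.+1)]).
    exact: (measurable_code n.+1 (fun c =>
      (node (digits q c) n.+1).2 %% scale q n.+1 %/ scale q n = a)%N).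
  have E y : nat_of_ord (scheme y n) =
      ((node (digits q (code y n.+1)) n.+1).2 %% scale q n.+1 %/ scale q n)%N.
    rewrite -code_digit code_scheme (@node_ext (digits q (code y n.+1)) y)// => i.
    exact: digits_agree.
  apply/seteqP; split=> y /=; rewrite -E; first by move=> ->.
  exact: val_inj.
- have mr := scheme_image (or_introl erefl).
  apply: smallest_sub; last by move=> A H; apply: scheme_image; right.
  split=> /=.
  + by rewrite image_set0.
  + move=> B mB; rewrite setTD (_ : _ @` _ = range scheme `\` (scheme @` B)).
      exact: measurableD.
    apply/seteqP; split=> z.
      move=> [x nB <-]; split; first by exists x.
      by move=> [y By /inj yx]; rewrite -yx in nB.
    by move=> [[x _ <-] nB]; exists x => // Bx; apply: nB; exists x.
  + by move=> F mF; rewrite image_bigcup; exact: bigcupT_measurable.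
Qed.

Lemma scheme_null : pr nu (range scheme) = 0.
Proof.
have mr := scheme_image (or_introl erefl).
apply/eqP; rewrite eq_le pr_ge0 andbT; apply/ler_addgt0Pr => e e0; rewrite add0r.
pose n := Num.truncn e^-1.
have ne : n.+1%:R^-1 < e by rewrite invf_plt ?posrE// truncnS_gt.
apply: le_trans (ltW ne).
apply: (@le_trans _ _ (\sum_(c <- iota 0 (scale q n))
    pr nu (cyl (node (digits q c) n)))).
  apply: le_trans (pr_seq_le _ _); last by move=> c _; exact: measurable_cyl.
  apply: le_pr => //.
    by apply: fin_bigcup_measurable => // c _; exact: measurable_cyl.
  move=> w [y _ <-]; exists (code y n).
    by rewrite /= mem_iota code_lt.
  rewrite (@node_ext _ y); first exact: scheme_node.
  by move=> i; exact: digits_agree.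
apply: (@le_trans _ _ (\sum_(c <- iota 0 (scale q n)) ((scale q n ^ 2)%:R^-1 : R))).
  apply: ler_sum => c _; apply: le_trans (pr_cyl_le _) _.
  rewrite lef_pV2 ?posrE ?ltr0n ?expn_gt0 ?scale_gt0// ler_nat.
  by rewrite (leq_trans (node_level (digits q c) n))// ltn_scale.
rewrite big_const_seq count_predT iter_addr_0 size_iota -[X in X <= _]mulr_natl.
have s0 : (scale q n)%:R != 0 :> R by rewrite pnatr_eq0 -lt0n scale_gt0.
rewrite natrX expr2 invfM mulrA divff// mul1r.
by rewrite lef_pV2 ?posrE ?ltr0n ?scale_gt0// ler_nat ltn_scale.
Qed.

End scheme.

End null_copy.

Lemma null_copy_in_full (R : realType) (q : radix) (Y0 : set (odometer_space q)) :
  measurable Y0 -> pr (odometer_measure R q) Y0 = 1 ->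
  exists g : odometer_space q -> odometer_space q,
    [/\ measurable_embedding g, forall y, Y0 (g y)
      & pr (odometer_measure R q) (range g) = 0].
Proof.
move=> mY0 Y01; have [K [mK KY K0 Kc]] := perfect_core mY0 Y01.
have [lev [sub H]] := @split_function R q K mK.
exists (scheme lev sub); split.
- by apply: scheme_embedding; eassumption.
- by move=> y; apply/KY/(scheme_core mK K0 Kc H).
- by apply: scheme_null; eassumption.
Qed.

(** * From a factor map to an orbit equivalence *)

Section almost_everywhere.
Context (R : realType) d (X : measurableType d) (mu : probability X R).

Lemma ae_pr0 (N : set X) (P : X -> Prop) : measurable N -> pr mu N = 0 ->
  (forall x, ~ N x -> P x) -> {ae mu, forall x, P x}.
Proof.
move=> mN N0 NP; exists N; split=> //; first by rewrite prE// N0.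
by move=> x nP; apply: contrapT => /NP.
Qed.

Lemma pr0_ae (P : X -> Prop) : {ae mu, forall x, P x} ->
  exists N, [/\ measurable N, pr mu N = 0 & forall x, ~ N x -> P x].
Proof.
move=> [N [mN N0 PN]]; exists N; split=> //; first by rewrite /pr N0.
by move=> x nN; apply: contrapT => /PN.
Qed.

Section automorphism_powers.
Variables (S : X -> X) (S_aut : automorphism mu S).

Let S_bij : bijective S. Proof. by case: S_aut => -[]. Qed.

Lemma automorphism_iterz n : measurable_fun setT (iterz S n) /\
  forall A, measurable A -> pr mu (iterz S n @^-1` A) = pr mu A.
Proof.
have [[_ mS mSi] muS] := S_aut.
have muS' A : measurable A -> pr mu (S @^-1` A) = pr mu A.
  by move=> mA; rewrite /pr -(muS A mA).
have invE A : inverse S @^-1` A = S @` A.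
  apply/seteqP; split=> x.
    by move=> Ax; exists (inverse S x) => //; rewrite inverseKV.
  by move=> [y Ay <-]; rewrite /= inverseK.
have imK A : S @^-1` (S @` A) = A.
  apply/seteqP; split=> x; last by exists x.
  by move=> [y Ay /(bij_inj S_bij) <-].
elim/int_ind: n => [|n [IHm IHA]|n [IHm IHA]].
- by split=> //; exact: measurable_id.
- rewrite (_ : iterz S n.+1 = S \o iterz S n)//.
  split=> [|A mA]; first exact: measurableT_comp.
  by rewrite comp_preimage IHA ?muS'//; exact: measurable_preimage.
- rewrite (_ : iterz S (- n.+1%:Z) = inverse S \o iterz S (- n%:Z)); last first.
    apply/funext => x; rewrite -[RHS]/(inverse S (iterz S (- n%:Z) x)) -iterzB1//.
    by congr iterz; lia.
  have mi : measurable_fun setT (inverse S).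
    by move=> _ A mA; rewrite setTI invE; exact: mSi.
  split=> [|A mA]; first exact: measurableT_comp.
  rewrite comp_preimage IHA; last exact: measurable_preimage.
  by rewrite invE -muS' ?imK//; exact: mSi.
Qed.

Lemma ae_orbit (P : X -> Prop) : {ae mu, forall x, P x} ->
  {ae mu, forall x, forall n : int, P (iterz S n x)}.
Proof.
move=> /pr0_ae[N [mN N0 NP]].
have mi n : measurable (iterz S n @^-1` N).
  by apply: measurable_preimage => //; case: (automorphism_iterz n).
have i0 n : pr mu (iterz S n @^-1` N) = 0.
  by rewrite (automorphism_iterz n).2.
apply: (@ae_pr0 ((\bigcup_n iterz S (Posz n) @^-1` N) `|`
                 (\bigcup_n iterz S (Negz n) @^-1` N))).
- by apply: measurableU; exact: bigcupT_measurable.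
- apply/eqP; rewrite eq_le pr_ge0 andbT; apply: le_trans (prU_le _ _ _) _.
  + exact: bigcupT_measurable.
  + exact: bigcupT_measurable.
  + by rewrite !pr_bigcup0 ?addr0.
- move=> x nx; case=> n; apply: NP => Nn; apply: nx.
    by left; exists n.
  by right; exists n.
Qed.

End automorphism_powers.

Lemma orbit_of_iterz (S : X -> X) (bS : bijective S) x y n :
  y = iterz S n x -> orbit_of S y = orbit_of S x.
Proof.
move=> ->; apply/seteqP; split=> _ [k _ <-].
  by exists (k + n) => //; rewrite iterzD.
by exists (k - n) => //; rewrite -iterzD// subrK.
Qed.

Lemma sub_orbit_ae (S1 S2 : X -> X) : automorphism mu S1 -> automorphism mu S2 ->
  {ae mu, forall x, exists n, S1 x = iterz S2 n x} ->
  {ae mu, forall x, orbit_of S1 x `<=` orbit_of S2 x}.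
Proof.
(* Almost every point satisfies the hypothesis along its whole [S1]-orbit, so that each step of this
   orbit, in either direction, stays in the same [S2]-orbit. *)
move=> S1a S2a /(ae_orbit S1a); apply: filterS => x H _ [k _ <-].
have [[b1 _ _] _] := S1a; have [[b2 _ _] _] := S2a.
suff -> : orbit_of S2 x = orbit_of S2 (iterz S1 k x) by exists 0.
elim/int_ind: k => [//|n ->|n ->].
  have [m] := H n%:Z; rewrite -iterzS// => /(orbit_of_iterz b2) <-.
  by congr (orbit_of S2 (iterz S1 _ x)); lia.
have [m] := H (- n.+1%:Z); rewrite -iterzS// => /(orbit_of_iterz b2) <-.
by congr (orbit_of S2 (iterz S1 _ x)); lia.
Qed.

Lemma orbit_eq_ae (S1 S2 : X -> X) : automorphism mu S1 -> automorphism mu S2 ->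
  {ae mu, forall x, exists n, S1 x = iterz S2 n x} ->
  {ae mu, forall x, exists n, S2 x = iterz S1 n x} ->
  {ae mu, forall x, orbit_of S1 x = orbit_of S2 x}.
Proof.
move=> S1a S2a H12 H21; apply: filterS2 (sub_orbit_ae S1a S2a H12)
  (sub_orbit_ae S2a S1a H21) => x ? ?.
exact/seteqP.
Qed.

(** The solution of least absolute value, nonnegative in case of a tie, is unique; hence it depends
    measurably on [x] and is no larger than any other solution. The value is 0 where there is no
    solution. *)
Lemma measurable_int_choice (E : int -> set X) : (forall k, measurable (E k)) ->
  exists c : X -> int, (forall k, measurable (c @^-1` [set k])) /\
    forall x k, E k x -> E (c x) x /\ (absz (c x) <= absz k)%N.
Proof.
move=> mE.
pose Q x k := E k x /\ (forall j : int, (absz j < absz k)%N -> ~ E j x) /\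
  (k < 0 -> ~ E (- k) x).
have Quniq x k l : Q x k -> Q x l -> k = l.
  move=> [Ek [Mk Nk]] [El [Ml Nl]].
  have kl : absz k = absz l.
    have [h|h|//] := ltngtP (absz k) (absz l); first by case: (Ml k h).
    by case: (Mk l h).
  have [k0|k0] := ltP k 0; have [l0|l0] := ltP l 0; try lia.
    by case: (Nk k0); rewrite (_ : - k = l)//; lia.
  by case: (Nl l0); rewrite (_ : - l = k)//; lia.
have Qex x k : E k x -> exists l, Q x l /\ (absz l <= absz k)%N.
  move=> Ek; have exn : exists n, `[< E n%:Z x \/ E (- n%:Z) x >].
    exists (absz k); apply/asboolP; have [k0|k0] := leP 0 k.
      by left; rewrite (_ : (absz k)%:Z = k)//; lia.
    by right; rewrite (_ : - (absz k)%:Z = k)//; lia.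
  case: (ex_minnP exn) => n /asboolP En nmin.
  have nk : (n <= absz k)%N.
    apply: nmin; apply/asboolP; have [k0|k0] := leP 0 k.
      by left; rewrite (_ : (absz k)%:Z = k)//; lia.
    by right; rewrite (_ : - (absz k)%:Z = k)//; lia.
  have nj (j : int) : (absz j < n)%N -> ~ E j x.
    move=> jn Ej; have : (n <= absz j)%N; last by lia.
    apply: nmin; apply/asboolP; have [j0|j0] := leP 0 j.
      by left; rewrite (_ : (absz j)%:Z = j)//; lia.
    by right; rewrite (_ : - (absz j)%:Z = j)//; lia.
  have [Ep|nEp] := pselect (E n%:Z x).
    by exists n%:Z; split=> //; split=> //; split=> //; lia.
  have {}En : E (- n%:Z) x by case: En.
  exists (- n%:Z); split; last by lia.
  by split=> //; split=> [j jn|_]; [apply: nj; lia|rewrite opprK].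
exists (fun x => xget 0 [set k | Q x k]); split; last first.
  move=> x k /Qex[l [Ql lk]]; case: xgetP => [m _ Qm|/(_ l)//].
  by rewrite (Quniq _ _ _ Qm Ql); split=> //; case: Ql.
have mall (P : int -> X -> Prop) : (forall k, measurable [set x | P k x]) ->
    measurable [set x | forall k, P k x].
  move=> mP; rewrite (_ : [set _ | _] = [set x | (forall n, P (Posz n) x) /\
      (forall n, P (Negz n) x)]).
    by apply: measurable_conj; exact: measurable_all.
  apply/seteqP; split=> x /=; first by move=> H; split.
  by move=> [H1 H2] [].
have mnE k : measurable [set x | ~ E k x] by exact: measurableC (mE k).
have mQ k : measurable [set x | Q x k].
  apply: measurable_conj; first exact: mE.
  apply: measurable_conj; last first.
    by apply: measurable_imp; [exact: measurable_cstP|exact: mnE].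
  by apply: mall => j; apply: measurable_imp; [exact: measurable_cstP|exact: mnE].
move=> k; rewrite (_ : _ @^-1` _ =
    [set x | Q x k] `|` [set x | k = 0 /\ forall j, ~ E j x]).
  apply: measurableU; first exact: mQ.
  by apply: measurable_conj; [exact: measurable_cstP|exact: mall].
apply/seteqP; split=> x /=.
  case: xgetP => [l _ Ql <-|nQ <-]; first by left.
  by right; split=> // j /Qex[l [Ql _]]; exact: (nQ l).
move=> [Qk|[-> nE]].
  by case: xgetP => [l _ Ql|/(_ k)//]; exact: Quniq Ql Qk.
by case: xgetP => // l _ [/nE].
Qed.

(* The largest index of a bad set containing [x] controls [phi |c x|]. *)
Lemma phi_integrable_bad_sets (phi : R -> R) (c : X -> int)
    (B : nat -> set X) (Phi : nat -> R) :
  (forall t, 0 <= t -> 0 <= phi t) -> (forall n, 0 <= Phi n) ->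
  (forall k, measurable (c @^-1` [set k])) -> (forall n, measurable (B n)) ->
  (forall n, pr mu (B n) <= 2^-1 ^+ n) ->
  (forall n, pr mu (B n) * Phi n.+1 <= 2^-1 ^+ n) ->
  {ae mu, forall x, forall n, (forall j, (n <= j)%N -> ~ B j x) ->
    phi (absz (c x))%:R <= Phi n} ->
  phi_integrable mu phi c.
Proof.
move=> phi0 Phi0 mc mB B2 BPhi2 Bc.
pose f x := (phi (`|c x|%:~R))%:E.
have fE x : f x = (phi (absz (c x))%:R)%:E by rewrite /f -abszE -pmulrn.
pose g x := (\sum_(n <oo) (Phi n.+1 * \1_(B n) x)%:E + (Phi 0%N)%:E)%E.
have term0 n x : (0 <= (Phi n.+1 * \1_(B n) x)%:E)%E.
  by rewrite lee_fin mulr_ge0// Phi0.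
have mterm n : measurable_fun setT (fun x => (Phi n.+1 * \1_(B n) x)%:E : \bar R).
  by apply/measurable_EFinP; exact: measurable_funM.
have msum : measurable_fun setT
    (fun x => \sum_(n <oo) (Phi n.+1 * \1_(B n) x)%:E : \bar R)%E.
  by apply: ge0_emeasurable_sum => n *.
(* [c] takes countably many values, so [f] is measurable for an arbitrary [phi]. *)
have mf : measurable_fun setT f.
  move=> _ A mA; rewrite setTI.
  rewrite (_ : f @^-1` A = (\bigcup_(n in [set n | A (phi (`|Posz n|%:~R))%:E]) c @^-1` [set Posz n])
    `|` (\bigcup_(n in [set n | A (phi (`|Negz n|%:~R))%:E]) c @^-1` [set Negz n])).
    by apply: measurableU; apply: bigcup_measurable.
  apply/seteqP; split=> x; rewrite /f /preimage /=; last first.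
    by move=> [[n /= An ->]|[n /= An ->]].
  by case E : (c x) => [n|n] Ax; [left|right]; exists n.
rewrite /phi_integrable -/f.
have fg : {ae mu, forall x, setT x -> (f x <= g x)%E}.
  apply: filterS2 Bc (pr_borel_cantelli mB B2) => x Hx [n0 n0P] _; rewrite fE.
  (* Take the least [n] beyond which [x] avoids the bad sets. If it is a successor [n.+1],
     minimality puts [x] in [B n], and one term of the series is enough. *)
  have exn : exists n, `[< forall j, (n <= j)%N -> ~ B j x >].
    by exists n0; apply/asboolP.
  case: (ex_minnP exn) => -[|n] /asboolP nP nmin.
    apply: (@le_trans _ _ (Phi 0%N)%:E); first by rewrite lee_fin; exact: Hx.
    by rewrite leeDr// nneseries_ge0.
  have Bn : B n x.
    apply: contrapT => nBn; have : (n.+1 <= n)%N; last by rewrite ltnn.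
    apply: nmin; apply/asboolP => j; rewrite leq_eqVlt => /orP[/eqP <- //|].
    exact: nP.
  apply: (@le_trans _ _ (Phi n.+1)%:E); first by rewrite lee_fin; exact: Hx.
  apply: (@le_trans _ _ (\sum_(n <oo) (Phi n.+1 * \1_(B n) x)%:E)%E); last first.
    by rewrite leeDl// lee_fin.
  apply: le_trans (nneseries_lim_ge n.+1 _); last by move=> *.
  rewrite big_mkord big_ord_recr /= indicE mem_set// mulr1.
  by rewrite leeDr// sume_ge0.
apply: le_lt_trans (ae_ge0_le_integral _ _ _ _ _ fg) _ => //.
- by move=> x _; rewrite fE lee_fin phi0.
- by move=> x _; rewrite adde_ge0// ?lee_fin// nneseries_ge0.
- by apply: emeasurable_funD => //; exact: measurable_cst.
rewrite ge0_integralD//; last 2 first.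
- by move=> x _; rewrite nneseries_ge0.
- by move=> x _; rewrite lee_fin.
rewrite integral_cst// [X in ((Phi 0%N)%:E * X)%E](_ : _ = 1%E); last first.
  exact: probability_setT.
rewrite mule1 integral_nneseries//.
apply: (@le_lt_trans _ _ (2 + Phi 0%N)%:E); last by rewrite ltry.
rewrite EFinD leeD2r//; apply: lime_le.
  by apply: is_cvg_nneseries => *; apply: integral_ge0.
apply: nearW => k.
apply: (@le_trans _ _ (\sum_(0 <= n < k) (2^-1 ^+ n : R)%:E)%E).
  apply: lee_sum => n _.
  under eq_integral do rewrite EFinM.
  rewrite ge0_integralZl//=; last 2 first.
  - by apply/measurable_EFinP; exact: measurable_indic.
  - by rewrite lee_fin.
  rewrite (_ : \int[mu]_x (\1_(B n) x)%:E = (pr mu (B n))%:E)%E; last first.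
    by rewrite integral_indic// setIT; exact: prE.
  rewrite -EFinM lee_fin mulrC.
  exact: BPhi2.
rewrite sumEFin lee_fin big_mkord.
exact: geometric_half_le.
Qed.

End almost_everywhere.

Section isomorphism_of_factor.
Context (R : realType) d (X : measurableType d) (mu : probability X R) (q : radix).
Let nu := odometer_measure R q.

(** By the last hypothesis the digits of [e x] are almost surely functions of [pi x], which yields a
    Borel inverse [psi] of [pi] between sets of full measure. The remaining null sets may have
    different cardinalities, hence the detour through a null copy of the whole odometer space. *)
Lemma isomorphism_of_factor (pi : X -> odometer_space q) :
  standard_borel R X -> measurable_fun setT pi ->
  (forall A, measurable A -> pr mu (pi @^-1` A) = pr nu A) ->
  (forall V, measurable V -> exists2 W, measurable W &
    pr mu ((V `\` pi @^-1` W) `|` (pi @^-1` W `\` V)) = 0) ->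
  exists Psi : X -> odometer_space q, bimeasurable_bijection Psi /\
    {ae mu, forall x, Psi x = pi x}.
Proof.
move=> /(standard_borel_embedding q)[e [[ei em eA] e01]] mpi pimu gen.
have mpre A : measurable A -> measurable (pi @^-1` A) by exact: measurable_preimage.
have mV n : measurable [set x | e x n = bit q true n].
  exact: (measurable_preimage em (measurable_digit _)).
pose sdiff V W := (V `\` pi @^-1` W) `|` (pi @^-1` W `\` V).
have /choice[W WP] n : exists W, measurable W /\
    pr mu (sdiff [set x | e x n = bit q true n] W) = 0.
  by have [W ? ?] := gen _ (mV n); exists W.
have mW n : measurable (W n) by case: (WP n).
(* [eta (pi x)] is the value of [e x] predicted from [pi x]; decoding it by [e] gives [psi], with
   the default [point] off the range of [e]. *)
pose eta y : odometer_space q := fun n => bit q `[< W n y >] n.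
have meta : measurable_fun setT eta.
  apply: measurable_to_odometer => n a.
  rewrite (_ : [set x | _] =
    (W n `&` [set _ | bit q true n = a]) `|` (~` W n `&` [set _ | bit q false n = a])).
    apply: measurableU; apply: measurableI => //; try exact: measurable_cstP.
    exact: measurableC.
  apply/seteqP; split=> x /=; rewrite /eta; first by case: asboolP => ? ?; [left|right].
  by case: asboolP => ? [] [].
have mR : measurable (range e) by exact: eA.
pose psi y := xget point [set x | e x = eta y].
have psiP x y : e x = eta y -> psi y = x.
  rewrite /psi => xy; case: xgetP => [z _ /= zy|/(_ x)//].
  by apply: ei; rewrite zy xy.
have mpsi : measurable_fun setT psi.
  move=> _ A mA; rewrite setTI (_ : _ @^-1` _ = eta @^-1` (e @` A) `|`
      (eta @^-1` (~` range e) `&` [set _ | A point])).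
    apply: measurableU; first by apply: measurable_preimage => //; exact: eA.
    apply: measurableI; last exact: measurable_cstP.
    by apply: measurable_preimage => //; exact: measurableC.
  apply/seteqP; split=> y.
    have [[x _ xy]|nr] := pselect (range e (eta y)).
      by rewrite /preimage /= (psiP _ _ xy) => Ax; left; exists x.
    move=> Ay; right; split=> //; move: Ay; rewrite /preimage /= /psi.
    case: xgetP => // x _ xy; by case: nr; exists x.
  move=> [[x Ax /psiP]|[nr Ap]]; first by rewrite /preimage /= => ->.
  rewrite /preimage /= /psi; case: xgetP => // x _ xy; by case: nr; exists x.
pose X2 := [set x | psi (pi x) = x]; pose Y2 := [set y | pi (psi y) = y].
have mX2 : measurable X2.
  rewrite (_ : X2 = [set x | (e \o psi \o pi) x = e x]).
    by apply: measurable_odometer_eq => //; do 2 apply: measurableT_comp => //.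
  by apply/seteqP; split=> x /= => [->//|/ei].
have mY2 : measurable Y2.
  by apply: (@measurable_odometer_eq _ _ _ (pi \o psi) id) => //;
    apply: measurableT_comp.
have msd n : measurable (sdiff [set x | e x n = bit q true n] (W n)).
  by apply: measurableU; apply: measurableD => //; exact: mpre.
have X2_full : pr mu X2 = 1.
  apply/eqP; rewrite eq_le pr_le1//= -subr_le0 -prC//.
  have -> : 0 = pr mu (\bigcup_n sdiff [set x | e x n = bit q true n] (W n)) :> R.
    by rewrite pr_bigcup0// => n; case: (WP n).
  apply: le_pr; [exact: measurableC|exact: bigcupT_measurable|].
  move=> x nX; apply: contrapT => nS; apply: nX; apply: psiP.
  apply: functional_extensionality_dep => n; rewrite /eta.
  have H : e x n = bit q true n <-> W n (pi x).
    split=> h; apply: contrapT => nh; apply: nS; exists n => //; first by left.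
    by right.
  case: asboolP => [/H//|nW]; apply/val_inj => /=.
  have : nat_of_ord (e x n) <> 1%N by move=> E; apply/nW/H/val_inj.
  by have := e01 x n; case: (nat_of_ord (e x n)) => [|[|]].
have Y2_full : pr nu Y2 = 1.
  apply/eqP; rewrite eq_le pr_le1//= -pimu// -X2_full le_pr//; first exact: mpre.
  by move=> x; rewrite /X2 /Y2 /preimage /= => ->.
have [g [[gi gm gA] gY gnull]] := null_copy_in_full mY2 Y2_full.
pose M := range g; have mM : measurable M by exact: gA.
have gM y : M (g y) by exists y.
have X2Y x : X2 x -> Y2 (pi x) by rewrite /X2 /Y2 /= => ->.
have Y2X y : Y2 y -> X2 (psi y) by rewrite /X2 /Y2 /= => ->.
pose X3 := X2 `\` pi @^-1` M; pose Y3 := Y2 `\` M.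
have mX3 : measurable X3 by apply: measurableD => //; exact: mpre.
have mY3 : measurable Y3 by exact: measurableD.
(* Removing [M] makes room: [F] sends what is left of [X] into [M], and [G] sends what is left of
   the odometer space into the copy [psi (M)] of [M]. *)
pose F x := if `[< X3 x >] then pi x else g (e x).
pose G y := if `[< Y3 y >] then psi y else psi (g y).
have F3 x : X3 x -> F x = pi x by rewrite /F; case: asboolP.
have Fn3 x : ~ X3 x -> F x = g (e x) by rewrite /F; case: asboolP.
have G3 y : Y3 y -> G y = psi y by rewrite /G; case: asboolP.
have Gn3 y : ~ Y3 y -> G y = psi (g y) by rewrite /G; case: asboolP.
have F_emb : measurable_embedding F.
  split.
  - move=> x z; have [hx|hx] := pselect (X3 x); have [hz|hz] := pselect (X3 z).
    + by rewrite !F3// => E; case: hx => <- _; case: hz => <- _; rewrite E.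
    + by rewrite F3// Fn3// => E; case: hx => _ []; rewrite /preimage /= E.
    + by rewrite Fn3// F3// => E; case: hz => _ []; rewrite /preimage /= -E.
    + by rewrite !Fn3// => /gi/ei.
  - move=> _ A mA; rewrite setTI (_ : _ @^-1` _ =
      (X3 `&` pi @^-1` A) `|` (~` X3 `&` (g \o e) @^-1` A)).
      apply: measurableU; apply: measurableI => //; first exact: mpre.
        exact: measurableC.
      by apply: measurable_preimage => //; exact: measurableT_comp.
    apply/seteqP; split=> x; rewrite /preimage /=.
      have [hx|hx] := pselect (X3 x); first by rewrite F3//; left.
      by rewrite Fn3//; right.
    by move=> [[hx]|[hx]]; [rewrite F3|rewrite Fn3].
  - move=> A mA; rewrite (_ : _ @` _ = (Y2 `&` psi @^-1` (A `&` X3)) `|`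
        (g @` (e @` (A `\` X3)))).
      apply: measurableU; last exact: (gA _ (eA _ (measurableD mA mX3))).
      apply: measurableI; first exact: mY2.
      exact: (measurable_preimage mpsi (measurableI _ _ mA mX3)).
    apply/seteqP; split=> y.
      move=> [x Ax <-]; have [hx|hx] := pselect (X3 x).
        rewrite F3//; left; have [x2 _] := hx; split; first exact: X2Y.
        by rewrite /preimage /= x2.
      by rewrite Fn3//; right; exists (e x) => //; exists x.
    move=> [[y2 [Ay hy]]|[_ [x [Ax hx] <-] <-]].
      by exists (psi y) => //; rewrite F3.
    by exists x => //; rewrite Fn3.
have G_emb : measurable_embedding G.
  split.
  - move=> y z; have [hy|hy] := pselect (Y3 y); have [hz|hz] := pselect (Y3 z).
    + by rewrite !G3// => E; case: hy => <- _; case: hz => <- _; rewrite E.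
    + rewrite G3// Gn3// => E; case: hy => y2 []; rewrite -y2 E gY.
      exact: gM.
    + rewrite Gn3// G3// => E; case: hz => z2 []; rewrite -z2 -E gY.
      exact: gM.
    + by rewrite !Gn3// => E; apply: gi; rewrite -(gY y) -(gY z) E.
  - move=> _ A mA; rewrite setTI (_ : _ @^-1` _ =
      (Y3 `&` psi @^-1` A) `|` (~` Y3 `&` (psi \o g) @^-1` A)).
      apply: measurableU; apply: measurableI => //.
      + exact: measurable_preimage.
      + exact: measurableC.
      + by apply: measurable_preimage => //; exact: measurableT_comp.
    apply/seteqP; split=> x; rewrite /preimage /=.
      have [hx|hx] := pselect (Y3 x); first by rewrite G3//; left.
      by rewrite Gn3//; right.
    by move=> [[hx]|[hx]]; [rewrite G3|rewrite Gn3].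
  - move=> A mA; rewrite (_ : _ @` _ = (X2 `&` pi @^-1` (A `&` Y3)) `|`
        (X2 `&` pi @^-1` (g @` (A `\` Y3)))).
      apply: measurableU; apply: measurableI => //; apply: mpre.
        exact: measurableI.
      by apply: gA; exact: measurableD.
    apply/seteqP; split=> x.
      move=> [y Ay <-]; have [hy|hy] := pselect (Y3 y).
        rewrite G3//; left; have [y2 _] := hy; split; first exact: Y2X.
        by rewrite /preimage /= y2.
      rewrite Gn3//; right; split; first exact/Y2X/gY.
      by rewrite /preimage /= gY; exists y.
    move=> [[x2 [Ax hx]]|[x2 [y [Ay hy] yx]]].
      by exists (pi x) => //; rewrite G3.
    by exists y => //; rewrite Gn3// yx.
have [Psi [Psib PsiP]] := measurable_bernstein F_emb G_emb.
exists Psi; split=> //.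
apply: (@ae_pr0 _ _ _ mu (~` X2 `|` pi @^-1` M)).
- by apply: measurableU; [exact: measurableC|exact: mpre].
- apply/eqP; rewrite eq_le pr_ge0 andbT; apply: le_trans (prU_le _ _ _) _.
  + exact: measurableC.
  + exact: mpre.
  + by rewrite prC// X2_full subrr add0r pimu// gnull.
move=> x nx; have x3 : X3 x.
  by split; [apply: contrapT => h; apply: nx; left|move=> h; apply: nx; right].
(* At a point of [X3], the second branch of [G] would put [pi x] in [M], and the first one again
   gives [Psi x = pi x]. *)
case: (PsiP x) => [->|]; first exact: F3.
have [h|h] := pselect (Y3 (Psi x)).
  by rewrite G3// => E; rewrite -[in RHS]E; case: h => ->.
by rewrite Gn3// => E; case: x3 => _ []; rewrite /preimage /= -E gY; exact: gM.
Qed.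

(** The measurable cocycle chosen here is only known to be at most [absz k] in absolute value, and
    [phi] need not be monotone: the bound is thus required for every [j] up to [absz k]. *)
Lemma phi_oe_of_cocycle_bounds (phi : R -> R) (T : X -> X)
    (Psi : X -> odometer_space q) (B : nat -> set X) (Phi : nat -> R) :
  (forall t, 0 <= t -> 0 <= phi t) -> (forall n, 0 <= Phi n) ->
  automorphism mu T -> aperiodic mu T ->
  bimeasurable_bijection Psi ->
  (forall A, measurable A -> pr mu (Psi @^-1` A) = pr nu A) ->
  (forall n, measurable (B n)) ->
  (forall n, pr mu (B n) <= 2^-1 ^+ n) ->
  (forall n, pr mu (B n) * Phi n.+1 <= 2^-1 ^+ n) ->
  {ae mu, forall x, forall n, (forall j, (n <= j)%N -> ~ B j x) ->
    exists2 k, Psi (T x) = iterz (@odometer q) k (Psi x)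
      & forall j, (j <= absz k)%N -> phi j%:R <= Phi n} ->
  {ae mu, forall x, forall n, (forall j, (n <= j)%N -> ~ B j x) ->
    exists2 k, odometer (Psi x) = Psi (iterz T k x)
      & forall j, (j <= absz k)%N -> phi j%:R <= Phi n} ->
  phi_integrably_orbit_equivalent mu nu phi T (@odometer q).
Proof.
move=> phi0 Phi0 Taut Tap Psib Psimu mB B2 BPhi2 HT HO.
have [[Tb mT _] _] := Taut; have [Pb mP PA] := Psib.
have Oaut := odometer_automorphism q R; have [[Ob mO _] _] := Oaut.
have PK := inverseK Pb; have PKV := inverseKV Pb.
have mPi : measurable_fun setT (inverse Psi).
  move=> _ A mA; rewrite setTI (_ : _ @^-1` _ = Psi @` A); first exact: PA.
  apply/seteqP; split=> y; first by exists (inverse Psi y).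
  by move=> [x Ax <-]; rewrite /preimage /= PK.
have prP A : measurable A -> pr nu (Psi @` A) = pr mu A.
  move=> mA; rewrite -Psimu; last exact: PA.
  congr (pr mu _); apply/seteqP; split=> x; last by exists x.
  by move=> [y Ay /(bij_inj Pb) <-].
have ae_push (P : odometer_space q -> Prop) : {ae mu, forall x, P (Psi x)} ->
    {ae nu, forall y, P y}.
  move=> /pr0_ae[N [mN N0 NP]]; apply: (@ae_pr0 _ _ _ nu (Psi @` N)).
  - exact: PA.
  - by rewrite prP.
  - move=> y nN; rewrite -(PKV y); apply: NP => Nx; apply: nN.
    by exists (inverse Psi y).
have BC := pr_borel_cantelli mB B2.
pose S2 := inverse Psi \o @odometer q \o Psi.
have S2b : bijective S2.
  by apply: bij_comp => //; apply: bij_comp => //; exists Psi.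
have S2V z : S2 (inverse Psi z) = inverse Psi (odometer z) by rewrite /S2 /= PKV.
have S2E k x : iterz S2 k x = inverse Psi (iterz (@odometer q) k (Psi x)).
  elim/int_ind: k => [/=|k IH|k IH]; first by rewrite PK.
  - rewrite -[iterz S2 k.+1 x]/(S2 (iterz S2 k x)) IH /S2 /= PKV//.
  - apply: (bij_inj S2b); rewrite -iterzS//.
    rewrite (_ : - k.+1%:Z + 1 = - k%:Z); last by lia.
    rewrite IH S2V -iterzS//; congr (inverse Psi (iterz _ _ _)); lia.
have S2aut : automorphism mu S2.
  split; first split=> //.
  - by apply: measurableT_comp => //; exact: measurableT_comp.
  - move=> A mA; have -> : S2 @` A = Psi @^-1` ((@odometer q) @` (Psi @` A)).
      apply/seteqP; split=> x.
        move=> [z Az <-]; rewrite /preimage /= PKV; exists (Psi z) => //.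
        by exists z.
      by move=> [_ [z Az <-] zx]; exists z => //; rewrite /S2 /= zx PK.
    apply: measurable_preimage => //.
    by case: Oaut => -[_ _ OA] _; exact: (OA _ (PA _ mA)).
  - move=> A mA; rewrite /pushforward.
    have mS : measurable (S2 @^-1` A).
      apply: measurable_preimage => //.
      by apply: measurableT_comp => //; exact: measurableT_comp.
    rewrite !prE//; congr (_%:E).
    have -> : S2 @^-1` A = Psi @^-1` ((@odometer q) @^-1` (Psi @` A)).
      apply/seteqP; split=> x.
        by move=> Ax; exists (S2 x) => //; rewrite /S2 /= PKV.
      by move=> [z Az zx]; rewrite /preimage /S2 /= -zx PK.
    rewrite Psimu; last by apply: measurable_preimage => //; exact: PA.
    by rewrite /pr [nu _](Oaut.2 _ (PA _ mA)) -/(pr _ _) prP.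
split=> //; first exact: odometer_aperiodic.
exists Psi; split.
  split=> //.
    move=> A mA; rewrite /pushforward prE; last exact: measurable_preimage.
    by rewrite [in RHS]prE// Psimu.
  apply: orbit_eq_ae => //.
  - apply: filterS2 BC HT => x [n nP] /(_ n nP)[k E _]; exists k.
    by rewrite S2E -E PK.
  - apply: filterS2 BC HO => x [n nP] /(_ n nP)[k E _]; exists k.
    by rewrite /S2 /= E PK.
have mit k : measurable_fun setT (iterz T k) by case: (automorphism_iterz Taut k).
have mito k : measurable_fun setT (iterz (@odometer q) k).
  by case: (automorphism_iterz Oaut k).
have [cS [mcS cSP]] := @measurable_int_choice _ X
  (fun k => [set x | Psi (T x) = iterz (@odometer q) k (Psi x)])
  (fun k => measurable_odometer_eq (measurableT_comp mP mT) (measurableT_comp (mito k) mP)).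
have [cT [mcT cTP]] := @measurable_int_choice _ (odometer_space q)
  (fun k => [set y | odometer y = Psi (iterz T k (inverse Psi y))])
  (fun k => measurable_odometer_eq mO
    (measurableT_comp mP (measurableT_comp (mit k) mPi))).
exists cS, cT; split=> //.
- apply: filterS2 BC HT => x [n nP] /(_ n nP)[k E _].
  by have [<- _] := cSP x k E; rewrite PK.
- apply: ae_push; apply: filterS2 BC HO => x [n nP] /(_ n nP)[k E _].
  by have [<- _] := cTP (Psi x) k (etrans E (congr1 (fun z => Psi (iterz T k z)) (esym (PK x)))).
split.
- apply: (@phi_integrable_bad_sets _ _ _ _ phi cS B Phi) => //.
  apply: filterS HT => x H n /H[k E]; apply.
  by have [_] := cSP x k E.
- have PB j x : (Psi @` B j) (Psi x) -> B j x by move=> [z Bz /(bij_inj Pb) <-].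
  apply: (@phi_integrable_bad_sets _ _ _ _ phi cT (fun n => Psi @` B n) Phi) => //.
  + by move=> n; exact: PA.
  + by move=> n; rewrite prP.
  + by move=> n; rewrite prP.
  apply: ae_push; apply: filterS HO => x H n nB.
  have [j nj Bj|k E] := H n; first by apply: (nB j nj); exists x.
  apply.
  by have [_] := cTP (Psi x) k (etrans E (congr1 (fun z => Psi (iterz T k z)) (esym (PK x)))).
Qed.

End isomorphism_of_factor.

(** * The odometer factor of a sequence of listed towers *)

Section level.
Context (X : pointedType) (T : X -> X).

(** The image of [A] under the [p]-th power of [T], written as a preimage so that measurability and
    measure come from those of the powers of [T]. *)
Definition level (A : set X) (p : nat) : set X :=
  [set x | A (iterz T (- p%:Z) x)].

Hypothesis T_bij : bijective T.

Lemma level0 A : level A 0 = A.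
Proof. by []. Qed.

Lemma levelD A p r : level (level A p) r = level A (r + p)%N.
Proof.
apply/seteqP; split=> x; rewrite /level /= -iterzD//;
  by rewrite (_ : - p%:Z + - r%:Z = - (r + p)%N%:Z)//; lia.
Qed.

Lemma image_level A p : iter p T @` A = level A p.
Proof.
apply/seteqP; split=> x.
  move=> [y Ay <-]; rewrite /level /= -[iter p T y]/(iterz T p y) -iterzD//.
  by rewrite addNr.
move=> Ax; exists (iterz T (- p%:Z) x) => //.
by rewrite -[iter p T _]/(iterz T p _) -iterzD// subrr.
Qed.

Lemma level_shift A p r x : level A p x ->
  level A r (iterz T (r%:Z - p%:Z) x).
Proof. by rewrite /level /= -iterzD// addrA addNr add0r. Qed.

End level.

Section measurable_level.
Context (R : realType) d (X : measurableType d) (mu : probability X R).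
Variables (T : X -> X) (T_aut : automorphism mu T).

Lemma measurable_level A p : measurable A -> measurable (level T A p).
Proof.
move=> mA; apply: measurable_preimage => //.
by case: (automorphism_iterz T_aut (- p%:Z)).
Qed.

Lemma pr_level A p : measurable A -> pr mu (level T A p) = pr mu A.
Proof. by move=> mA; exact: (automorphism_iterz T_aut (- p%:Z)).2. Qed.

End measurable_level.

Section towers.
Context (R : realType) d (X : measurableType d) (mu : probability X R).
Variables (T : X -> X) (q : radix).
Hypothesis T_aut : automorphism mu T.
Variables (base : nat -> set X) (h k : nat -> nat) (o : nat -> nat -> nat).
Variables (l : nat -> seq nat) (C : nat).

Let L n p := level T (base n) p.
Let H n := size (l n).

Hypothesis base_meas : forall n, measurable (base n).
Hypothesis level_disj : forall n p r x, (p < h n)%N -> (r < h n)%N ->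
  L n p x -> L n r x -> p = r.
Hypothesis base_refine : forall n x, base n x <->
  exists2 i, (i < k n)%N & L n.+1 (o n i) x.
Hypothesis offset_lt : forall n i, (i < k n)%N -> (o n i + h n <= h n.+1)%N.
Hypothesis l_uniq : forall n, uniq (l n).
Hypothesis l_lt : forall n p, p \in l n -> (p < h n)%N.
Hypothesis l_block : forall n i, (i < k n)%N ->
  (exists b, (b.+1 * H n <= H n.+1)%N /\
     forall t, (t < H n)%N -> nth 0%N (l n.+1) (b * H n + t) = (o n i + nth 0 (l n) t)%N)
  \/ (forall t, (t < H n)%N -> (o n i + nth 0 (l n) t)%N \notin l n.+1).
Hypothesis H_gt0 : forall n, (0 < H n)%N.
Hypothesis H_dvd : forall n, (H n %| H n.+1)%N.
Hypothesis H_scale : forall m n, (m < n)%N -> (scale q m %| H n)%N.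
Hypothesis tower_large : forall n, 1 <= (h n + C)%:R * pr mu (base n).

Let T_bij : bijective T. Proof. by case: T_aut => -[]. Qed.

Lemma measurable_L n p : measurable (L n p).
Proof. by apply: measurable_level => //; exact: T_aut. Qed.

Lemma level_refine n p x : L n p x <->
  exists2 i, (i < k n)%N & L n.+1 (o n i + p)%N x.
Proof.
have E i : L n.+1 (o n i + p) = level T (L n.+1 (o n i)) p.
  by rewrite /L levelD// addnC.
split=> [Lx|[i ik]].
  have [i ik Li] := (base_refine n _).1 Lx.
  by exists i => //; rewrite E.
by rewrite E => Li; apply: (base_refine n _).2; exists i.
Qed.

Lemma level_nested n m p x : (n <= m)%N -> (p < h n)%N -> L n p x ->
  exists r, [/\ (r < h m)%N, L m r x & L m r `<=` L n p].
Proof.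
move=> /subnK <-; elim: (m - n)%N => [|j IH] ph Lx.
  by exists p; split.
have [r [rh Lr rL]] := IH ph Lx.
have [i ik Li] := (level_refine _ _ _).1 Lr.
exists (o (j + n) i + r)%N; split=> //.
  by have := offset_lt ik; rewrite addSn; lia.
by move=> z Lz; apply: rL; apply/level_refine; exists i.
Qed.


Definition at_rank n x t := (t < H n)%N /\ L n (nth 0%N (l n) t) x.

Lemma nth_lt n t : (t < H n)%N -> (nth 0%N (l n) t < h n)%N.
Proof. by move=> tH; apply: l_lt; exact: mem_nth. Qed.

Lemma at_rank_inj n x t u : at_rank n x t -> at_rank n x u -> t = u.
Proof.
move=> [tH Lt] [uH Lu]; apply/eqP.
rewrite -(nth_uniq 0%N tH uH (l_uniq n)); apply/eqP.
exact: (level_disj (nth_lt tH) (nth_lt uH) Lt Lu).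
Qed.

(** Being listed at stage [n.+1] excludes the second alternative of [l_block]; the whole string of
    the copy containing [x] is then a translated block of the new listing. *)
Lemma at_rank_step n x t u : at_rank n x t -> at_rank n.+1 x u ->
  exists b, [/\ (b.+1 * H n <= H n.+1)%N, u = (b * H n + t)%N &
    exists c, forall v, (v < H n)%N ->
      nth 0%N (l n.+1) (b * H n + v) = (c + nth 0 (l n) v)%N].
Proof.
move=> [tH Lt] [uH Lu].
have [i ik Li] := (level_refine _ _ _).1 Lt.
have e : (o n i + nth 0 (l n) t)%N = nth 0%N (l n.+1) u.
  apply: level_disj Li Lu; last exact: nth_lt.
  by have := offset_lt ik; have := nth_lt tH; lia.
case: (l_block ik) => [[b [bH bE]]|nl]; last first.
  by have := nl t tH; rewrite e mem_nth.
have btH : (b * H n + t < H n.+1)%N.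
  by rewrite (leq_trans _ bH)// mulSn addnC ltn_add2r.
exists b; split=> //; last by exists (o n i).
by apply/eqP; rewrite -(nth_uniq 0%N uH btH (l_uniq n.+1)) -e bE.
Qed.

(** Every later listing contains a translate of the stage [n] string through [x], aligned modulo
    [H n]. Moving from one entry of the string to another thus changes the level and the rank by the
    same amounts at all later stages. *)
Lemma at_rank_stable n x (t : nat -> nat) u : (u < H n)%N ->
  (forall m, (n <= m)%N -> at_rank m x (t m)) ->
  forall m, (n <= m)%N -> exists b, t m = (b * H n + t n)%N /\
    at_rank m (iterz T ((nth 0%N (l n) u)%:Z - (nth 0%N (l n) (t n))%:Z) x)
      (b * H n + u).
Proof.
move=> uH xt m nm; set z := iterz _ _ _.
suff [b [tb bH [c cE]]] : exists b, [/\ t m = (b * H n + t n)%N,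
    (b.+1 * H n <= H m)%N & exists c, forall v, (v < H n)%N ->
      nth 0%N (l m) (b * H n + v) = (c + nth 0 (l n) v)%N].
  exists b; split=> //; split.
    by rewrite (leq_trans _ bH)// mulSn addnC ltn_add2r.
  have [tnH _] := xt n (leqnn n).
  rewrite cE//; have [_] := xt m nm; rewrite tb cE// => /(level_shift (T:=T)).
  move=> /(_ T_bij (c + nth 0 (l n) u)%N).
  by rewrite (_ : (c + nth 0 (l n) u)%N%:Z - _ =
    (nth 0%N (l n) u)%:Z - (nth 0%N (l n) (t n))%:Z)//; lia.
elim: m nm {z} => [|m IH] nm.
  move: nm xt uH; rewrite leqn0 => /eqP -> xt uH; exists 0%N; split=> //.
  - by rewrite mul1n.
  - by exists 0%N.
move: nm; rewrite leq_eqVlt => /orP[/eqP <-|nm].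
  by exists 0%N; split=> //; [rewrite mul1n|exists 0%N].
have [b [tb bH [c cE]]] := IH nm.
have [e [eH te [f fE]]] := at_rank_step (xt m nm) (xt m.+1 (ltnW nm)).
have /dvdnP[g gE] : (H n %| H m)%N.
  move: nm; rewrite ltnS => /subnK <-; elim: (m - n)%N => // j; rewrite addSn.
  by move=> /dvdn_trans; apply; exact: H_dvd.
have E v : ((e * g + b) * H n + v = e * H m + (b * H n + v))%N.
  by rewrite gE mulnDl mulnA addnA.
exists (e * g + b)%N; split.
- by rewrite E te tb.
- by rewrite -addnS mulnDl -mulnA -gE (leq_trans _ eH)// mulSn addnC leq_add2r.
- exists (f + c)%N => v vH; rewrite E fE ?cE ?addnA//.
  by rewrite (leq_trans _ bH)// mulSn addnC ltn_add2r.
Qed.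

Definition limit_digit x n (a : nat) :=
  exists n0, forall m, (n0 <= m)%N ->
    exists t, at_rank m x t /\ digits q t n = a :> nat.

(** A digit without limit is set to 0; by Borel-Cantelli almost every point has all its limits. *)
Definition odometer_name (x : X) : odometer_space q :=
  fun n => xget (zero_digits q n) [set a | limit_digit x n a].

Lemma limit_digit_inj x n a b : limit_digit x n a -> limit_digit x n b -> a = b.
Proof.
move=> [m Hm] [r Hr]; have [t [xt <-]] := Hm (maxn m r) (leq_maxl _ _).
have [u [xu <-]] := Hr (maxn m r) (leq_maxr _ _).
by rewrite (at_rank_inj xt xu).
Qed.

Lemma measurable_at_rank n t : measurable [set x | at_rank n x t].
Proof. by apply: measurable_conj; [exact: measurable_cstP|exact: measurable_L]. Qed.

Lemma measurable_odometer_name : measurable_fun setT odometer_name.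
Proof.
apply: measurable_to_odometer => n a.
have mlim b : measurable [set x | limit_digit x n b].
  apply: measurable_ex => n0; apply: measurable_all => m.
  apply: measurable_imp; first exact: measurable_cstP.
  apply: measurable_ex => t; apply: measurable_conj; last exact: measurable_cstP.
  exact: measurable_at_rank.
rewrite (_ : [set _ | _] = [set x | limit_digit x n a] `|`
    [set x | zero_digits q n = a /\ forall b, (b < q n)%N -> limit_digit x n b -> False]).
  apply: measurableU => //; apply: measurable_conj; first exact: measurable_cstP.
  apply: measurable_all => b; apply: measurable_imp; first exact: measurable_cstP.
  by apply: measurable_imp; [exact: mlim|exact: measurable_cstP].
apply/seteqP; split=> x /=; rewrite /odometer_name.
  case: xgetP => [b _ Hb <-|nH <-]; first by left.
  by right; split=> // b bq Hb; exact: (nH (Ordinal bq)).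
move=> [Ha|[<- nH]].
  case: xgetP => [b _ Hb|/(_ a)//]; apply/val_inj; exact: limit_digit_inj Hb Ha.
by case: xgetP => // b _ Hb; case: (nH b (ltn_ord b) Hb).
Qed.

Lemma code_odometer_name n x (t : nat -> nat) :
  (forall m, (n <= m)%N -> at_rank m x (t m)) ->
  forall r m, (n <= m)%N -> (r < m)%N ->
    code (odometer_name x) r = (t m %% scale q r)%N.
Proof.
move=> xt r m nm rm; rewrite -code_digits; apply: eq_bigr => i _.
congr (_ * _)%N; suff E : limit_digit x i (digits q (t m) i).
  rewrite /odometer_name; case: xgetP => [b _ Hb|/(_ (digits q (t m) i))//].
  exact: limit_digit_inj Hb E.
exists m => j mj; exists (t j); split; first exact: xt (leq_trans nm mj).
have [tH _] := xt m nm.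
have xt' j' : (m <= j')%N -> at_rank j' x (t j').
  by move=> mj'; apply: xt; exact: leq_trans mj'.
have [b [-> _]] := at_rank_stable tH xt' mj.
rewrite -[LHS]code_digit -[RHS]code_digit; congr (_ %/ _)%N.
(* Later ranks differ from [t m] by multiples of [H m], which [scale q i.+1] divides. *)
rewrite !code_digits -modnDml; have /eqP -> : (scale q i.+1 %| b * H m)%N.
  by apply: dvdn_mull; apply: H_scale; have := ltn_ord i; lia.
by rewrite add0n.
Qed.

(** The ranks of the two points differ by [u - t n] at every stage from [n] on, hence modulo every
    [scale q r]. This converts displacements along [T] into powers of the odometer, and both
    cocycles are read from it. *)
Lemma odometer_name_shift n x (t : nat -> nat) u : (u < H n)%N ->
  (forall m, (n <= m)%N -> at_rank m x (t m)) ->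
  odometer_name (iterz T ((nth 0%N (l n) u)%:Z - (nth 0%N (l n) (t n))%:Z) x) =
  iterz (@odometer q) (u%:Z - (t n)%:Z) (odometer_name x).
Proof.
move=> uH xt; apply: odometer_iterz => r.
pose m := maxn n r.+1.
have nm : (n <= m)%N by exact: leq_maxl.
have rm : (r < m)%N by exact: leq_maxr.
set z := iterz _ _ _.
have zt m' : (n <= m')%N -> at_rank m' z (t m' - t n + u).
  by move=> nm'; have [b [-> H']] := at_rank_stable uH xt nm'; rewrite addnK.
rewrite (code_odometer_name zt nm rm) (code_odometer_name xt nm rm).
have [b [tb _]] := at_rank_stable uH xt nm.
by rewrite modnDml modnDml tb addnK addnAC.
Qed.

(** * Regular points, distribution of the names and cocycles *)

Section bad_sets.

(** The next rank exists, which determines the cocycle of the odometer, and the next level is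
    listed, which determines that of [T]. *)
Definition regular_set n : set X :=
  [set x | exists t, [/\ at_rank n x t, (t.+1 < H n)%N
                       & (nth 0%N (l n) t).+1 \in l n]].

Lemma measurable_regular_set n : measurable (regular_set n).
Proof.
rewrite (_ : regular_set n = [set x | exists t, at_rank n x t /\
    ((t.+1 < H n)%N /\ (nth 0%N (l n) t).+1 \in l n)]).
  apply: measurable_ex => t; apply: measurable_conj; last exact: measurable_cstP.
  exact: measurable_at_rank.
by apply/seteqP; split=> x [t]; [move=> [? ? ?]|move=> [? [? ?]]]; exists t.
Qed.

Lemma pr_levels n (s : seq nat) : uniq s -> (forall t, t \in s -> (t < H n)%N) ->
  pr mu (\bigcup_(t in [set` s]) L n (nth 0%N (l n) t)) =
  (size s)%:R * pr mu (base n).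
Proof.
move=> us sH; rewrite pr_seq//.
- under eq_bigr do rewrite [pr mu (L _ _)]pr_level//.
  by rewrite big_const_seq count_predT iter_addr_0 mulr_natl.
- by move=> t _; exact: measurable_L.
- move=> t u ts us' [x [Lt Lu]]; apply: (@at_rank_inj n x).
    by split=> //; exact: sH.
  by split=> //; exact: sH.
Qed.

(** Sending a rank to the successor of its level is injective into the numbers up to [h n] that are
    not listed. The value [h n] is allowed, since the top level may be listed. *)
Lemma card_skipped n : (size [seq t <- iota 0 (H n).-1 |
  (nth 0%N (l n) t).+1 \notin l n] <= (h n).+1 - H n)%N.
Proof.
pose s := [seq p <- iota 0 (h n).+1 | p \notin l n].
have -> : ((h n).+1 - H n = size s)%N.
  rewrite size_filter -[in LHS](size_iota 0 (h n).+1).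
  rewrite -(count_predC (mem (l n))) -size_filter.
  have /perm_size -> : perm_eq [seq p <- iota 0 (h n).+1 | p \in l n] (l n).
    apply: uniq_perm => //; first by rewrite filter_uniq// iota_uniq.
    move=> p; rewrite mem_filter mem_iota /=; case: (boolP (p \in l n)) => //= pl.
    by rewrite ltnS ltnW// l_lt.
  by rewrite addKn; apply: eq_count => p.
rewrite -(size_map (fun t => (nth 0%N (l n) t).+1)).
apply: uniq_leq_size.
  rewrite map_inj_in_uniq ?filter_uniq ?iota_uniq//.
  move=> t u; rewrite !mem_filter !mem_iota /= !add0n => /andP[_ tH] /andP[_ uH].
  have tH' : (t < H n)%N by lia.
  have uH' : (u < H n)%N by lia.
  by move=> /succn_inj/eqP; rewrite nth_uniq// => /eqP.
move=> p /mapP[t]; rewrite mem_filter mem_iota /= add0n => /andP[nl tH] ->.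
rewrite /s mem_filter nl mem_iota /= add0n ltnS.
by apply: nth_lt; lia.
Qed.

(** At least [(H n).-1 - ((h n).+1 - H n)] ranks are regular and they have equal weight; the
    constant is the difference with [h n + C], the bound on the total mass in units of the base. *)
Lemma pr_irregular n : pr mu (~` regular_set n) <=
  (C + 2 * (h n - H n) + 2)%:R * pr mu (base n).
Proof.
pose s := [seq t <- iota 0 (H n).-1 | (nth 0%N (l n) t).+1 \in l n].
have sP t : t \in s -> (t.+1 < H n)%N.
  by rewrite mem_filter mem_iota /= add0n => /andP[_]; have := H_gt0 n; lia.
have -> : regular_set n = \bigcup_(t in [set` s]) L n (nth 0%N (l n) t).
  apply/seteqP; split=> x.
    move=> [t [[_ Lx] tH tl]]; exists t => //=.
    by rewrite mem_filter tl mem_iota /= add0n; lia.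
  move=> [t /= ts Lx]; have tH := sP t ts; exists t; split=> //.
    by split=> //; exact: ltnW.
  by move: ts; rewrite mem_filter => /andP[].
rewrite prC; last by apply: fin_bigcup_measurable => // t _; exact: measurable_L.
rewrite pr_levels ?filter_uniq ?iota_uniq//; last by move=> t /sP/ltnW.
rewrite lerBlDr -mulrDl -natrD; apply: le_trans (tower_large n) _.
rewrite ler_wpM2r ?pr_ge0// ler_nat.
have := card_skipped n.
have : (size s + size [seq t <- iota 0 (H n).-1 | (nth 0%N (l n) t).+1 \notin l n]
    = (H n).-1)%N.
  by rewrite !size_filter -[RHS](size_iota 0 (H n).-1) -(count_predC
    (fun t => (nth 0%N (l n) t).+1 \in l n)).
have := H_gt0 n; lia.
Qed.

Hypothesis pr_bad : forall n, pr mu (~` regular_set n) <= 2^-1 ^+ n.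

Let bad n := ~` regular_set n.

Let measurable_bad n : measurable (bad n).
Proof. exact/measurableC/measurable_regular_set. Qed.

Lemma regular_ranks n x : (forall j, (n <= j)%N -> ~ bad j x) ->
  exists t : nat -> nat, forall m, (n <= m)%N ->
    [/\ at_rank m x (t m), ((t m).+1 < H m)%N & (nth 0%N (l m) (t m)).+1 \in l m].
Proof.
move=> xn; have /choice[t tP] m : exists t, (n <= m)%N ->
    [/\ at_rank m x t, (t.+1 < H m)%N & (nth 0%N (l m) t).+1 \in l m].
  have [nm|nm] := leqP n m; last by exists 0%N.
  by have /contrapT[t tP] := xn m nm; exists t.
by exists t.
Qed.

Lemma ae_regular : {ae mu, forall x, exists n, forall j, (n <= j)%N -> ~ bad j x}.
Proof. exact: pr_borel_cantelli. Qed.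

(** A periodic orbit regular at one common stage would climb through consecutive levels of a single
    tower, while distinct levels are disjoint. *)
Lemma tower_aperiodic : aperiodic mu T.
Proof.
have := ae_orbit T_aut ae_regular; apply: filterS => x xorb n n0 xn.
have [m mP] : exists m, forall i, (i < n.+1)%N -> regular_set m (iter i T x).
  have /choice[f fP] i := xorb (Posz i).
  exists (\max_(i < n.+1) f i) => i i_n.
  apply: contrapT; apply: (fP i).
  exact: (@leq_bigmax _ (fun i : 'I_n.+1 => f i) (Ordinal i_n)).
have [t [[tH Lt] _ _]] := mP 0%N (ltn0Sn n); set p := nth _ _ t in Lt.
have L_iter i : (L m (p + i) (iter i T x)).
  have := level_shift (T:=T) T_bij (p + i)%N Lt.
  by rewrite (_ : (p + i)%N%:Z - p%:Z = i%:Z)//; lia.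
have ph i : (i <= n)%N -> (p + i < h m)%N.
  elim: i => [|i IH] i_n; first by rewrite addn0; exact: nth_lt.
  have [u [[uH Lu] _ ul]] := mP i (ltnW i_n).
  rewrite addnS (level_disj (IH (ltnW i_n)) (nth_lt uH) (L_iter i) Lu).
  exact: l_lt ul.
have := L_iter n; rewrite xn => Lx.
have := level_disj (ph n (leqnn n)) (ph 0%N (leq0n n)) Lx.
rewrite addn0 => /(_ Lt) E; lia.
Qed.

(** Off the later bad sets, the event means that the rank at stage [m] is [c] modulo [scale q r].
    Each residue has the same number of ranks, and the listed levels fill the space up to
    [2^-1 ^+ m]. *)
Lemma pr_name_code r c : (c < scale q r)%N ->
  pr mu [set x | code (odometer_name x) r = c] = (scale q r)%:R^-1.
Proof.
move=> cr; set V := [set x | _].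
have mV : measurable V.
  exact: (measurable_preimage measurable_odometer_name (measurable_code_eq r c)).
have s0 : 0 < (scale q r)%:R :> R by rewrite ltr0n scale_gt0.
pose E m := [set x | exists t, at_rank m x t /\ (t %% scale q r = c)%N].
have mE m : measurable (E m).
  apply: measurable_ex => t; apply: measurable_conj; last exact: measurable_cstP.
  exact: measurable_at_rank.
have prE m : (r < m)%N ->
    pr mu (E m) = (H m)%:R * pr mu (base m) / (scale q r)%:R.
  move=> rm; have /dvdnP[g gE] := H_scale rm.
  pose s := [seq (c + scale q r * i)%N | i <- iota 0 g].
  have sP t : (t \in s) = (t < H m)%N && (t %% scale q r == c)%N.
    apply/mapP/andP => [[i]|[tH /eqP tc]].
      rewrite mem_iota /= add0n => ig ->; split.
        by rewrite gE; nia.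
      by rewrite mulnC addnC modnMDl modn_small.
    exists (t %/ scale q r)%N; last by rewrite -tc addnC mulnC -divn_eq.
    by rewrite mem_iota /= add0n ltn_divLR ?scale_gt0// -gE.
  have -> : E m = \bigcup_(t in [set` s]) L m (nth 0%N (l m) t).
    apply/seteqP; split=> x.
      by move=> [t [[tH Lx] tc]]; exists t => //=; rewrite sP tH tc eqxx.
    move=> [t /=]; rewrite sP => /andP[tH /eqP tc] Lx.
    by exists t; split.
  rewrite pr_levels; last by move=> t; rewrite sP => /andP[].
    by rewrite size_map size_iota gE natrM; field; rewrite gt_eqF.
  rewrite map_inj_uniq ?iota_uniq// => i j /addnI/eqP.
  by rewrite eqn_pmul2l ?scale_gt0// => /eqP.
pose tail m := \bigcup_(j in [set j | (m <= j)%N]) bad j.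
have mt m : measurable (tail m) by exact: bigcup_measurable.
have tailP x m : ~ tail m x -> forall j, (m <= j)%N -> ~ bad j x.
  by move=> nt j mj Bj; apply: nt; exists j.
have VE x m : (r < m)%N -> ~ tail m x -> V x <-> E m x.
  move=> rm /tailP/regular_ranks[t tP].
  have xt j : (m <= j)%N -> at_rank j x (t j) by case/tP.
  rewrite /V /= (code_odometer_name xt (leqnn m) rm); split=> [tc|].
    by exists (t m); split=> //; exact: xt.
  by move=> [u [xu <-]]; rewrite (at_rank_inj xu (xt m (leqnn m))).
(* The tail of the bad sets contributes 2, and the part which is not listed contributes 1. *)
have bound m : (r < m)%N ->
    `|pr mu V - (scale q r)%:R^-1| <= 3 * 2^-1 ^+ m.
  move=> rm; have tm : pr mu (tail m) <= 2 * 2^-1 ^+ m by exact: pr_tail.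
  have VEt : pr mu V <= pr mu (E m) + pr mu (tail m).
    apply: le_trans (prU_le _ (mE m) (mt m)); apply: le_pr => //.
      exact: measurableU.
    by move=> x Vx; have [?|/VE H1] := pselect (tail m x); [right|left; exact/H1].
  have EVt : pr mu (E m) <= pr mu V + pr mu (tail m).
    apply: le_trans (prU_le _ mV (mt m)); apply: le_pr => //.
      exact: measurableU.
    by move=> x Ex; have [?|/VE H1] := pselect (tail m x); [right|left; exact/H1].
  have G1 : (H m)%:R * pr mu (base m) <= 1.
    rewrite -[H m](size_iota 0) -pr_levels ?iota_uniq//.
      by apply: pr_le1; apply: fin_bigcup_measurable => // t _; exact: measurable_L.
    by move=> t; rewrite mem_iota.
  have G2 : 1 - 2^-1 ^+ m <= (H m)%:R * pr mu (base m).
    rewrite -[H m](size_iota 0) -pr_levels ?iota_uniq//; last first.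
      by move=> t; rewrite mem_iota.
    apply: (@le_trans _ _ (pr mu (regular_set m))).
      have := pr_bad m; rewrite prC; last exact: measurable_regular_set.
      lra.
    apply: le_pr; first exact: measurable_regular_set.
      by apply: fin_bigcup_measurable => // t _; exact: measurable_L.
    by move=> x [t [[tH Lx] _ _]]; exists t => //=; rewrite mem_iota.
  rewrite prE// in VEt EVt.
  set s := (scale q r)%:R in s0 VEt EVt *.
  set g := _ * pr mu (base m) in VEt EVt G1 G2.
  have s1 : s^-1 <= 1 by rewrite invf_le1// ler1n scale_gt0.
  have si0 : 0 < s^-1 by rewrite invr_gt0.
  have e0 : 0 <= 2^-1 ^+ m :> R by rewrite exprn_ge0.
  have gs1 : g / s <= s^-1 by rewrite -[leRHS]mul1r ler_wpM2r// ltW.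
  have gs2 : s^-1 - 2^-1 ^+ m <= g / s.
    apply: (@le_trans _ _ ((1 - 2^-1 ^+ m) / s)); last by rewrite ler_wpM2r// ltW.
    rewrite mulrBl mul1r lerD2l lerN2 ler_piMr//.
  by rewrite ler_norml; apply/andP; split; lra.
apply/eqP; rewrite -subr_eq0 -normr_le0; apply/ler_addgt0Pr => e e0; rewrite add0r.
have : (2^-1 : R) ^+ n @[n --> \oo] --> 0 by apply: cvg_expr; rewrite ger0_norm; lra.
move=> /cvgrPdist_lt /(_ (e / 3)); rewrite divr_gt0// => /(_ erefl)[n _].
move=> /(_ (maxn n r.+1) (leq_maxl _ _)) /=; rewrite sub0r normrN ger0_norm ?exprn_ge0// => He.
apply: le_trans (bound _ (leq_maxr n r.+1)) _; lra.
Qed.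

Lemma pr_name A : measurable A ->
  pr mu (odometer_name @^-1` A) = pr (odometer_measure R q) A.
Proof.
move=> mA; rewrite /pr; congr fine.
pose m : probability (odometer_space q) R :=
  distribution mu (mfun_Sub (mem_set measurable_odometer_name)).
change (m A = odometer_measure R q A).
apply: odometer_measure_unique mA.
  exact: (le_lt_trans (@probability_le1 _ _ R m setT measurableT) (ltry 1)).
move=> n c cn; rewrite [RHS](odometer_measure_code R cn) -(pr_name_code cn).
by apply: prE; exact: measurable_code_eq.
Qed.

Hypothesis q_large : forall n, exists r, (H n %| scale q r)%N.

(** Enough digits of the name give the rank modulo [H m], hence the stage [m] level of a regular
    point. [W] asks that this level eventually lie inside the given one. *)
Lemma level_name n p : (p < h n)%N -> exists2 W, measurable W &
  pr mu ((L n p `\` odometer_name @^-1` W) `|` (odometer_name @^-1` W `\` L n p)) = 0.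
Proof.
move=> ph; have /choice[N NP] m : exists r, (m <= r)%N /\ (H m %| scale q r)%N.
  have [r Hr] := q_large m; exists (maxn r m); split; first exact: leq_maxr.
  by apply: dvdn_trans Hr _; apply: scale_dvd; exact: leq_maxl.
pose inside m c := L m (nth 0%N (l m) (c %% H m)) `<=` L n p.
pose W := [set y : odometer_space q | exists n0, forall m, (n0 <= m)%N ->
  inside m (code y (N m))].
have mW : measurable W.
  apply: measurable_ex => n0; apply: measurable_all => m.
  apply: measurable_imp; first exact: measurable_cstP.
  exact: measurable_code (inside m).
exists W => //.
have [Z [mZ Z0 ZP]] := pr0_ae ae_regular.
apply/eqP; rewrite eq_le pr_ge0 andbT -Z0; apply: le_pr => //.
  have mWn : measurable (odometer_name @^-1` W).
    exact: measurable_preimage measurable_odometer_name mW.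
  by apply: measurableU; apply: measurableD => //; exact: measurable_L.
move=> x HD; apply: contrapT => /ZP[n1 /regular_ranks[t tP]].
have xt j : (n1 <= j)%N -> at_rank j x (t j) by case/tP.
have codeE m : (n1 <= m)%N -> (code (odometer_name x) (N m) %% H m)%N = t m.
  move=> nm; have [mN HN] := NP m; have [tH _] := xt m nm.
  have nN : (n1 <= (N m).+1)%N by lia.
  rewrite (code_odometer_name xt nN (ltnSn _)) modn_dvdm//.
  have xt' j : (m <= j)%N -> at_rank j x (t j).
    by move=> mj; apply: xt; exact: leq_trans mj.
  have [b [-> _]] := at_rank_stable tH xt' (leqW mN).
  by rewrite modnMDl modn_small.
have LW : L n p x <-> W (odometer_name x).
  split=> [Lx|[n0 Hn0]].
    exists (maxn n n1) => m; rewrite geq_max => /andP[nm n1m].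
    rewrite /inside codeE//; have [r [rh Lr rL]] := level_nested nm ph Lx.
    have [tH Lt] := xt m n1m.
    by rewrite (level_disj (nth_lt tH) rh Lt Lr).
  have := Hn0 (maxn n0 n1) (leq_maxl _ _); rewrite /inside codeE ?leq_maxr//.
  by apply; have [] := xt (maxn n0 n1) (leq_maxr _ _).
by case: HD => -[h1 h2]; [apply: h2|apply: h2]; apply/LW.
Qed.

Variable D : nat -> nat.
Hypothesis l_disp : forall n j, (j < H n)%N ->
  (nth 0%N (l n) j <= j + D n)%N /\ (j <= nth 0%N (l n) j + D n)%N.

(** Ranks are within [D n] of their levels, so consecutive levels have ranks at most [2 * D n + 1]
    apart. *)
Lemma name_cocycle_T n x : (forall j, (n <= j)%N -> ~ bad j x) ->
  exists2 c, odometer_name (T x) = iterz (@odometer q) c (odometer_name x)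
    & (absz c <= 2 * D n + 1)%N.
Proof.
move=> /regular_ranks[t tP]; have [[tH Lt] _ tl] := tP n (leqnn n).
have xt j : (n <= j)%N -> at_rank j x (t j) by case/tP.
set u := index (nth 0%N (l n) (t n)).+1 (l n).
have uH : (u < H n)%N by rewrite /H index_mem.
have := odometer_name_shift uH xt; rewrite nth_index//.
rewrite (_ : _%:Z - _%:Z = 1); last by lia.
move=> E; exists (u%:Z - (t n)%:Z); first by rewrite -E.
have [a b] := l_disp uH; have [c e] := l_disp tH.
rewrite nth_index// in a b; lia.
Qed.

Lemma name_cocycle_odometer n x : (forall j, (n <= j)%N -> ~ bad j x) ->
  exists2 c, odometer (odometer_name x) = odometer_name (iterz T c x)
    & (absz c <= 2 * D n + 1)%N.
Proof.
move=> /regular_ranks[t tP]; have [[tH Lt] uH _] := tP n (leqnn n).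
have xt j : (n <= j)%N -> at_rank j x (t j) by case/tP.
have := odometer_name_shift uH xt.
rewrite (_ : (t n).+1%:Z - _ = 1); last by lia.
move=> E; eexists; first exact: esym E.
have [a b] := l_disp uH; have [c e] := l_disp tH.
lia.
Qed.

End bad_sets.

End towers.

(** * Towers of a rank-one system *)

Lemma universal_scale (q : radix) : universal q ->
  forall m, (0 < m)%N -> exists r, (m %| scale q r)%N.
Proof.
move=> qu m m0; have /choice[f fP] p : exists n, prime p ->
    (logn p m <= logn p (scale q n))%N.
  have [pp|np] := boolP (prime p); last by exists 0%N.
  have [n Hn] := qu p pp (logn p m); exists n => _; apply: leq_trans Hn _.
  rewrite leq_eqVlt; apply/orP; left; apply/eqP.
  elim: n => [|n IH]; first by rewrite big_ord0 /scale big_ord0 logn1.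
  by rewrite big_ord_recr /= IH scaleS lognM ?scale_gt0 ?radix_gt0// addnC.
exists (\max_(p <- primes m) f p)%N; apply/dvdn_partP => // p.
rewrite mem_primes => /and3P[pp _ pm].
rewrite p_part pfactor_dvdn ?scale_gt0//; apply: leq_trans (fP p pp) _.
apply: dvdn_leq_log; first exact: scale_gt0.
apply: scale_dvd; apply: (@leq_bigmax_seq _ _ _ _ p) => //.
by rewrite mem_primes pp m0.
Qed.

Section cost.
Variables (R : realType) (phi : R -> R).
Hypothesis phi_ge0 : forall t : R, 0 <= t -> 0 <= phi t.
Hypothesis phi_littleo : forall eps : R, 0 < eps ->
  \forall t \near +oo, phi t <= eps * t `^ 3^-1.

(* Twice the displacement of the listing following a tower of height [h],
   plus one: it bounds both cocycles at the next stage. *)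
Definition jump_bound (C h : nat) := (2 * (h.+1 * (h + C)) + 1)%N.

(** A cube is the shape that the exponent 1/3 turns into a linear function of [h], to be cancelled
    by the measure of order [1 / h] of a bad set. *)
Lemma jump_bound_cube C h : (0 < h)%N -> (jump_bound C h <= ((4 * C + 5) * h) ^ 3)%N.
Proof.
move=> h0; apply: (@leq_trans ((4 * C + 5) * (h * h))).
  have a : (h.+1 <= 2 * h)%N by lia.
  have b : (h + C <= (C + 1) * h)%N by nia.
  have := leq_mul a b; have : (1 <= h * h)%N by rewrite muln_gt0 h0.
  rewrite /jump_bound; set x := (_ * (h + C))%N; nia.
set K := (4 * C + 5)%N; have K0 : (0 < K)%N by rewrite /K addnS.
have -> : (((K * h) ^ 3) = (K * (h * h)) * (K * (K * h)))%N.
  by rewrite !expnS expn0; ring.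
by rewrite leq_pmulr// !muln_gt0 K0.
Qed.

(** [rho] is fixed before [h]. Below a threshold [J] the little-o bound says nothing, and the sum
    [S] of these finitely many values replaces it; above, [phi] is at most [eps * (K * h)]. *)
Lemma littleo_cost (C rho : nat) (e : R) : 0 < e -> exists h0, forall h : nat,
  (h0 <= h)%N -> (0 < h)%N -> rho%:R / h%:R <= e /\
  exists Phi, [/\ 0 <= Phi, forall j, (j <= jump_bound C h)%N -> phi j%:R <= Phi
                & rho%:R / h%:R * Phi <= e].
Proof.
move=> e0; pose K : R := (4 * C + 5)%:R; pose r : R := rho.+1%:R.
have K0 : 0 < K by rewrite ltr0n addnS.
have r0 : 0 < r by rewrite ltr0n.
pose eps := e / (2 * r * K).
have eps0 : 0 < eps by rewrite divr_gt0// !mulr_gt0.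
have [M [_ HM]] := phi_littleo eps0.
pose J := (Num.truncn M).+1.
pose S := \sum_(j < J) phi j%:R.
have S0 : 0 <= S by apply: sumr_ge0 => j _; apply: phi_ge0.
(* This one threshold gives both [rho / h <= e] and [rho * S / h <= e / 2]; [r] is [rho + 1] so that
   it is positive. *)
pose h0 := (Num.truncn ((r * (2 * S + 1)) / e)).+1.
exists h0 => h hh0 hpos; have h1 : 0 < h%:R :> R by rewrite ltr0n.
have rhor : rho%:R <= r by rewrite ler_nat.
have big : r * (2 * S + 1) <= e * h%:R.
  rewrite -[e * _]mulrC -ler_pdivrMr//; apply/ltW/(lt_le_trans (truncnS_gt _)).
  by rewrite ler_nat.
have rho0 : 0 <= rho%:R :> R by [].
split; first by rewrite ler_pdivrMr//; nra.
have t0 : 0 <= eps * (K * h%:R) by apply/ltW/mulr_gt0 => //; exact: mulr_gt0.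
exists (S + eps * (K * h%:R)); split.
- exact: addr_ge0.
- move=> j jb; have [jJ|Jj] := ltnP j J.
    rewrite (@le_trans _ _ S)//; last by rewrite lerDl.
    rewrite /S (bigD1 (Ordinal jJ))//= lerDl sumr_ge0// => i _.
    exact: phi_ge0.
  apply: (@le_trans _ _ (eps * j%:R `^ 3^-1)).
    by apply: HM; rewrite (lt_le_trans (truncnS_gt _))// ler_nat.
  rewrite (@le_trans _ _ (eps * (K * h%:R)))//; last by rewrite lerDr.
  rewrite ler_pM2l//.
  have Kh0 : 0 <= K * h%:R by rewrite mulr_ge0// ltW.
  have <- : ((K * h%:R) ^+ 3) `^ 3^-1 = K * h%:R.
    by rewrite -powR_mulrn// -powRrM mulfV ?powRr1// pnatr_eq0.
  apply: ge0_ler_powR.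
  + by rewrite invr_ge0.
  + by rewrite nnegrE.
  + by rewrite nnegrE exprn_ge0.
  + by rewrite -natrM -natrX ler_nat (leq_trans jb)// jump_bound_cube.
- have -> : rho%:R / h%:R * (S + eps * (K * h%:R)) = rho%:R * S / h%:R + rho%:R * eps * K.
    by field; rewrite gt_eqF.
  have a : rho%:R * S / h%:R <= e / 2 by rewrite ler_pdivrMr//; nra.
  have b : rho%:R * eps * K <= e / 2.
    have -> : e / 2 = r * eps * K by rewrite /eps; field; rewrite !gt_eqF.
    by rewrite ler_pM2r// ler_pM2r.
  lra.
Qed.

End cost.

Section offsets.
Variables (h C k : nat) (o : nat -> nat).
Hypothesis oS : forall i, (i < k)%N -> (o i + h <= o i.+1 <= o i + h + C)%N.

Lemma offset_mono i j : (i <= j <= k)%N -> (o i <= o j)%N.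
Proof.
move=> /andP[/subnK <-]; elim: (j - i)%N => // m IH; rewrite addSn => mk.
by have := IH (ltnW mk); have := oS mk; lia.
Qed.

Lemma offset_le i : (i < k)%N -> (o i + h <= o k)%N.
Proof. by move=> ik; have := oS ik; have := @offset_mono i.+1 k; lia. Qed.

Lemma offset_inj i j : (0 < h)%N -> (i < k)%N -> (j < k)%N -> o i = o j -> i = j.
Proof.
move=> h0; wlog ij : i j / (i <= j)%N => [H ik jk E|ik jk E].
  by have [?|/ltnW ?] := leqP i j; [|symmetry]; exact: H.
apply/eqP; rewrite eqn_leq ij /= leqNgt; apply/negP => lt_ij.
by have := oS ik; have := @offset_mono i.+1 j; lia.
Qed.

Lemma offset_total : o 0%N = 0%N -> (o k <= k * (h + C))%N.
Proof.
move=> o0; suff H i : (i <= k)%N -> (o i <= i * (h + C))%N by exact: H.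
elim: i => [|i IH] ik; first by rewrite o0.
by have := IH (ltnW ik); have := oS ik; rewrite mulSn; lia.
Qed.

End offsets.

(** * Copies of a tower inside the later ones *)

Section extraction.
Context (R : realType) d (X : measurableType d) (mu : probability X R).
Variables (T : X -> X) (T_aut : automorphism mu T) (mu_atomless : atomless mu).
Variables (p : nat -> cs_param) (B : nat -> set X) (Bsub : nat -> nat -> set X).
Variables (Sigma : nat -> nat -> nat -> set X) (C : nat).
Hypothesis cs : cutting_and_stacking mu T p B Bsub Sigma.
Hypothesis BSP : forall n,
  [/\ (max_spacer p n <= C)%N, spacer p n 0 = 0%N & spacer p n (Defs.cut (p n)) = 0%N].

Let T_bij : bijective T. Proof. by case: T_aut => -[]. Qed.

Let hh := height p.

Lemma spacer_le n i : (i <= Defs.cut (p n))%N -> (spacer p n i <= C)%N.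
Proof.
move=> ic; have [h _ _] := BSP n; apply: leq_trans h.
rewrite /max_spacer; apply: leq_trans (leq_bigmax (ord_max : 'I_n.+1)).
have ic' : (i < (Defs.cut (p n)).+1)%N by [].
exact: (@leq_bigmax _ (fun i : 'I_(Defs.cut (p n)).+1 => spacer p n i) (Ordinal ic')).
Qed.

(** Position of the [i]-th copy of tower [n] in tower [n.+1], the spacer below the first copy being
    0. *)
Definition off n i := (i * hh n + \sum_(j < i) spacer p n j.+1)%N.

Lemma offS n i : off n i.+1 = (off n i + hh n + spacer p n i.+1)%N.
Proof. by rewrite /off big_ord_recr mulSn /=; lia. Qed.

Lemma off_cut n : off n (Defs.cut (p n)) = hh n.+1.
Proof.
have [_ s0 _] := BSP n; rewrite /off /hh /= /total_spacers big_ord_recl /=.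
by rewrite s0 add0n.
Qed.

Lemma height_ge n : (n < hh n)%N.
Proof.
elim: n => // n IH; rewrite /hh /= -/hh; have := cut_ge2 (p n).
by move: IH; rewrite /hh; nia.
Qed.

Lemma Bsub_level n i : (i < Defs.cut (p n))%N -> Bsub n i = level T (B n.+1) (off n i).
Proof.
have [_ s0 _] := BSP n.
elim: i => [|i IH] ic.
  by rewrite /off big_ord0 addn0 mul0n level0 (cs_base_no_spacer cs s0).
have top : iter (height p n) T @` Bsub n i = level T (B n.+1) (off n i + hh n).
  by rewrite image_level// IH ?levelD// ?(ltnW ic)// addnC.
have i1 : (i < (Defs.cut (p n)).-1)%N by lia.
rewrite offS; have [s|s] := posnP (spacer p n i.+1).
  by rewrite s addn0 -top (cs_top_no_spacer cs i1 s).
have Sig j : (j < spacer p n i.+1)%N ->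
    Sigma n i.+1 j.+1 = level T (B n.+1) (off n i + hh n + j).
  elim: j => [|j IHj] js; first by rewrite addn0 -top (cs_top_spacer cs (ltnW ic) s).
  rewrite -(cs_spacer_next cs (ltnW ic))//.
  rewrite (IHj (ltnW js)) -[T]/(iter 1 T) image_level// levelD//.
  by rewrite add1n addnS.
have i2 : (i.+1 <= (Defs.cut (p n)).-1)%N by lia.
rewrite -(cs_spacer_last cs i2 s) -(prednK s) Sig ?prednK//.
rewrite -[X in X @` _]/(iter 1 T) image_level// levelD//; congr level.
by rewrite -[in RHS](prednK s); lia.
Qed.

Lemma base_split n x : B n x <->
  exists2 i, (i < Defs.cut (p n))%N & level T (B n.+1) (off n i) x.
Proof.
rewrite -(cs_partition_cover cs n); split=> -[i /= ic].
  by rewrite Bsub_level// => Lx; exists i.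
by move=> Lx; exists i => //=; rewrite Bsub_level.
Qed.

Lemma level_split n r x : level T (B n) r x <->
  exists2 i, (i < Defs.cut (p n))%N & level T (B n.+1) (r + off n i) x.
Proof.
split=> [Lx|[i ic]].
  have [i ic Li] := (base_split n _).1 Lx.
  by exists i => //; rewrite -levelD.
by rewrite -levelD// => Li; apply: (base_split n _).2; exists i.
Qed.

(** The induction also carries that the last copy ends at the top of the tower. With no spacers at
    either end of a tower, the gap between copies in two successive towers is a single spacer of the
    current stage, so the gaps do not accumulate with [j] and remain bounded by [C]. *)
Lemma composite_offsets n j : exists k o, [/\ o 0%N = 0%N,
  forall i, (i < k)%N -> (o i + hh n <= o i.+1 <= o i + hh n + C)%N,
  o k = hh (j + n)
  & forall x, B n x <-> exists2 i, (i < k)%N & level T (B (j + n)) (o i) x].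
Proof.
suff [k [u [H1 H2 H3 H4 [H5 H6]]]] : exists k o, [/\ o 0%N = 0%N,
  forall i, (i < k)%N -> (o i + hh n <= o i.+1 <= o i + hh n + C)%N,
  o k = hh (j + n), (0 < k)%N & o k = (o k.-1 + hh n)%N /\
  forall x, B n x <-> exists2 i, (i < k)%N & level T (B (j + n)) (o i) x].
  by exists k, u.
elim: j => [|j [k [u [u0 uS uk k0 [ul uB]]]]].
  exists 1%N, (fun i => i * hh n)%N; split=> //.
  - by move=> i; rewrite ltnS leqn0 => /eqP ->; lia.
  - by rewrite mul1n.
  - split=> //; first by rewrite mul1n mul0n.
    move=> x; rewrite add0n; split; first by exists 0%N.
    by move=> [i]; rewrite ltnS leqn0 => /eqP ->.
pose c := Defs.cut (p (j + n)).
have c0 : (0 < c)%N by exact: ltnW (cut_ge2 _).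
have [_ _ sc] := BSP (j + n).
(* Copy number [a * k + b] is the [b]-th copy inside the [a]-th intermediate tower. *)
pose o' i := (off (j + n) (i %/ k) + u (i %% k))%N.
have o'E a b : (b < k)%N -> o' (a * k + b)%N = (off (j + n) a + u b)%N.
  by move=> bk; rewrite /o' divnMDl// divn_small// modnMDl modn_small// addn0.
have o'k a : o' (a * k)%N = off (j + n) a.
  by rewrite -[(a * k)%N]addn0 o'E// u0 addn0.
have last a : o' (a * k + k.-1)%N = (off (j + n) a + (hh (j + n) - hh n))%N.
  rewrite o'E; last by rewrite prednK.
  by rewrite -uk ul addnK.
have hn : (hh n <= hh (j + n))%N by rewrite -uk ul leq_addl.
exists (c * k)%N, o'; split.
- by rewrite -(mul0n k) o'k /off big_ord0.
- move=> i ick; rewrite (divn_eq i k); set a := (i %/ k)%N; set b := (i %% k)%N.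
  have bk : (b < k)%N by rewrite ltn_pmod.
  have ac : (a < c)%N by rewrite ltn_divLR.
  have := bk; rewrite leq_eqVlt => /orP[/eqP bE|b1].
    have -> : b = k.-1 by rewrite -bE.
    rewrite last -addnS prednK// -mulSnr o'k offS.
    have := spacer_le ac; lia.
  by rewrite -addnS !o'E//; have := uS b bk; lia.
- by rewrite o'k off_cut.
- by rewrite muln_gt0 c0.
- split.
    have -> : (c * k).-1 = (c.-1 * k + k.-1)%N.
      by rewrite -{1}(prednK c0) mulSnr -{2}(prednK k0) addnS.
    rewrite last o'k -{1}(prednK c0) offS (prednK c0) sc addn0; lia.
  move=> x; rewrite uB; split=> -[i].
    move=> ik /level_split[a ac Lx].
    exists (a * k + i)%N; last by rewrite o'E// [(off _ _ + _)%N]addnC.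
    by apply: (@leq_trans (a.+1 * k)); [rewrite mulSnr ltn_add2l|rewrite leq_mul2r ac orbT].
  move=> ick Lx; exists (i %% k)%N; first by rewrite ltn_pmod.
  apply/level_split; exists (i %/ k)%N; first by rewrite ltn_divLR.
  by rewrite [(u _ + _)%N]addnC.
Qed.

Lemma level_disjoint n r s x : (r < hh n)%N -> (s < hh n)%N ->
  level T (B n) r x -> level T (B n) s x -> r = s.
Proof.
move=> rh sh Lr Ls; apply: (cs_disjoint cs rh sh).
by exists x; rewrite !image_level.
Qed.

Definition tower n := \bigcup_(r in [set` iota 0 (hh n)]) level T (B n) r.

Let mB n : measurable (B n). Proof. exact: (cs_measurable_base cs). Qed.

Lemma measurable_tower n : measurable (tower n).
Proof.
by apply: fin_bigcup_measurable => // r _; exact: (measurable_level T_aut).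
Qed.

Lemma pr_tower n : pr mu (tower n) = (hh n)%:R * pr mu (B n).
Proof.
rewrite pr_seq ?iota_uniq//.
- under eq_bigr do rewrite (pr_level T_aut)//.
  by rewrite big_const_seq count_predT iter_addr_0 size_iota mulr_natl.
- by move=> r _; exact: (measurable_level T_aut).
- move=> r s /=; rewrite !mem_iota !add0n /= => rh sh [x [Lr Ls]].
  exact: level_disjoint Lr Ls.
Qed.

Lemma tower_level n r : (r < hh n)%N -> level T (B n) r `<=` tower n.
Proof. by move=> rh x Lx; exists r => //=; rewrite mem_iota. Qed.

Lemma level_in_later n j r x : (r < hh n)%N -> level T (B n) r x ->
  exists s, [/\ (s < hh (j + n))%N, level T (B (j + n)) s x
    & level T (B (j + n)) s `<=` level T (B n) r].
Proof.
move=> rh Lx; have [k [u [u0 uS uk uB]]] := composite_offsets n j.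
have [i ik Li] := (uB _).1 Lx.
exists (r + u i)%N; split.
- by have := offset_le uS ik; rewrite uk; lia.
- by rewrite -levelD.
- by move=> z; rewrite -levelD// => Lz; apply: (uB _).2; exists i.
Qed.

Lemma tower_mono m n : (m <= n)%N -> tower m `<=` tower n.
Proof.
move=> /subnK <- x [r /=]; rewrite mem_iota add0n => rh.
by move=> /(level_in_later (n - m) rh)[s [sh Ls _]]; apply: tower_level Ls.
Qed.

(* The levels do not separate the points outside of all towers. *)
Lemma towers_full : pr mu (\bigcup_n tower n) = 1.
Proof.
have mU : measurable (\bigcup_n tower n).
  by apply: bigcupT_measurable => n; exact: measurable_tower.
set U := \bigcup_n tower n in mU *.
have mnU : measurable (~` U) by exact: measurableC.
suff : pr mu (~` U) = 0 by rewrite prC//; lra.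
apply/eqP; rewrite eq_le pr_ge0 andbT leNgt; apply/negP => U0.
have [|V [mV VU V0]] := mu_atomless mnU; first by rewrite prE// lte_fin.

move: V0; rewrite !prE// !lte_fin => /andP[V1 V2].
have [W sW VW] := cs_generates cs mV.
(* [V] cuts the complement of [U] into two parts of positive measure, which a set containing or
   missing this complement cannot approximate. *)
have WP : measurable W /\ (~` U `<=` W \/ ~` U `&` W = set0).
  move: W sW {VW}; apply: smallest_sub.
    split.
    - by split=> //; right; rewrite setI0.
    - move=> A [mA AU]; rewrite setTD; split; first exact: measurableC.
      case: AU => [h|h].
        by right; apply/seteqP; split=> x //= [/h].
      left => x nx Ax; have : (~` U `&` A) x by [].
      by rewrite h.
    - move=> F FP; split; first by apply: bigcupT_measurable => n; case: (FP n).
      have [[n h]|nh] := pselect (exists n, ~` U `<=` F n).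
        by left=> x /h Fx; exists n.
      right; apply/seteqP; split=> x //= [nx [n _ Fx]].
      have [_ [h|h]] := FP n; first by apply: nh; exists n.
      have : (~` U `&` F n) x by [].
      by rewrite h.
  move=> _ [n [r [rh ->]]]; rewrite image_level//.
  split; first exact: (measurable_level T_aut).
  right; apply/seteqP; split=> x //= [nU Lx]; apply: nU.
  by exists n => //; exact: tower_level Lx.
have [mW WU] := WP.
have sub0 Z : measurable Z -> Z `<=` V `+` W -> pr mu Z = 0.
  move=> mZ ZVW; apply/eqP; rewrite eq_le pr_ge0 andbT.
  have mVW : measurable (V `+` W) by apply: measurableU; exact: measurableD.
  have : pr mu (V `+` W) = 0 by rewrite /pr VW.
  by move=> <-; exact: le_pr.
case: WU => h.
  have : pr mu (~` U `\` V) = 0.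
    apply: sub0; first exact: measurableD.
    by move=> x [nx nV]; right; split=> //; exact: h.
  by rewrite prD//; lra.
have : pr mu V = 0; last by lra.
apply: sub0 => // x Vx; left; split=> // Wx.
have : (~` U `&` W) x by split=> //; exact: VU.
by rewrite h.
Qed.

(* This is where bounded spacers are used: consecutive copies of a tower are
   at most [C] apart. *)
Lemma tower_large_height n : 1 <= (hh n + C)%:R * pr mu (B n).
Proof.
apply/ler_addgt0Pr => e e0.
have [m Hm] := @pr_bigcup_cvg _ _ _ mu tower e measurable_tower tower_mono e0.
rewrite towers_full in Hm; apply/ltW/(lt_le_trans Hm); rewrite lerD2r.
apply: (@le_trans _ _ (pr mu (tower (maxn n m - n + n)))).
  apply: le_pr; try exact: measurable_tower.
  by apply: tower_mono; rewrite subnK ?leq_maxl ?leq_maxr.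
set j := (maxn n m - n)%N.
have [k [u [u0 uS uk uB]]] := composite_offsets n j.
have hn0 : (0 < hh n)%N by exact: leq_ltn_trans (height_ge n).
have -> : pr mu (B n) = k%:R * pr mu (B (j + n)).
  have -> : B n = \bigcup_(i in [set` iota 0 k]) level T (B (j + n)) (u i).
    apply/seteqP; split=> x.
      by move=> /uB[i ik Lx]; exists i => //=; rewrite mem_iota.
    by move=> [i /=]; rewrite mem_iota add0n => ik Lx; apply/uB; exists i.
  rewrite pr_seq ?iota_uniq//.
  - under eq_bigr do rewrite (pr_level T_aut)//.
    by rewrite big_const_seq count_predT iter_addr_0 size_iota mulr_natl.
  - by move=> r _; exact: (measurable_level T_aut).
  - move=> r s /=; rewrite !mem_iota !add0n /= => rk sk [x [Lr Ls]].
    apply: (offset_inj uS hn0 rk sk); apply: level_disjoint Lr Ls.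
      by have := offset_le uS rk; rewrite uk; lia.
    by have := offset_le uS sk; rewrite uk; lia.
rewrite pr_tower mulrA -natrM ler_wpM2r ?pr_ge0// ler_nat -uk mulnC.
exact: (offset_total uS).
Qed.

Lemma pr_base_le n : pr mu (B n) <= (hh n)%:R^-1.
Proof.
have h0 : 0 < (hh n)%:R :> R by rewrite ltr0n (leq_ltn_trans _ (height_ge n)).
rewrite -[leRHS]mul1r ler_pdivlMr// mulrC -pr_tower.
by apply: pr_le1; exact: measurable_tower.
Qed.

End extraction.

(** * Choice of the parameters *)

(* [N n] is the stage of the given construction used at step [n], and [H n] the
   height of the tower of the odometer at step [n]; the part of the tower of
   height [ht (N n)] left out has at most [slack H n] levels. *)
Definition slack (q : radix) (H : nat -> nat) n :=
  if n is m.+1 then (H m * scale q m + H m)%N else 1%N.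

Lemma stage_choice (q : radix) (ht : nat -> nat) (g : nat -> nat -> nat) :
  (forall n, n < ht n)%N -> exists N H : nat -> nat, forall n,
  [/\ (N n < N n.+1)%N, (0 < H n)%N, (H n < ht (N n))%N,
      (ht (N n) - H n <= slack q H n)%N
    & [/\ (H n * scale q n %| H n.+1)%N, (H n.+1 + H n <= ht (N n.+1))%N
        & (g (slack q H n) n <= ht (N n))%N]].
Proof.
move=> hg.
(* [M] is the divisor imposed on the new [H]. The old [H] is subtracted before dividing, as room for
   the final queue of the listing. The loss, at most [M + s.2], depends on the old stage only, so
   [m] can be adapted to it. *)
pose next n (s : nat * nat) :=
  let M := (s.2 * scale q n)%N in
  let m := maxn s.1.+1 (maxn (g (M + s.2)%N n.+1) (M + s.2)) in
  (m, M * ((ht m - s.2) %/ M))%N.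
pose m0 := maxn 1 (g 1%N 0%N).
(* The first string omits one level, as the listing requires it to be strictly shorter than the
   tower. *)
pose s := fix s n := if n is m.+1 then next m (s m) else (m0, (ht m0).-1).
exists (fun n => (s n).1), (fun n => (s n).2) => n.
have sS m : s m.+1 = next m (s m) by [].
have ge2 : (1 < ht m0)%N.
  by rewrite (leq_ltn_trans _ (hg m0))// leq_maxl.
have step m : (0 < (s m).2)%N -> let M := ((s m).2 * scale q m)%N in
    [/\ ((s m).1 < (s m.+1).1)%N, (0 < (s m.+1).2)%N,
      ((s m.+1).2 + (s m).2 <= ht (s m.+1).1)%N,
      (ht (s m.+1).1 - (s m.+1).2 <= M + (s m).2)%N
    & (M %| (s m.+1).2)%N /\ (g (M + (s m).2) m.+1 <= ht (s m.+1).1)%N].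
  move=> s0 M; rewrite sS /next -/M /=.
  set r := maxn _ (maxn _ _); have hr := hg r.
  have r1 : ((s m).1 < r)%N by rewrite leq_maxl.
  have r2 : (g (M + (s m).2) m.+1 <= r)%N by rewrite /r !leq_max leqnn orbT.
  have r3 : (M + (s m).2 <= r)%N by rewrite /r !leq_max leqnn !orbT.
  have M0 : (0 < M)%N by rewrite muln_gt0 s0 scale_gt0.
  have d := divn_eq (ht r - (s m).2) M; have dm := ltn_pmod (ht r - (s m).2) M0.
  have dp : (0 < (ht r - (s m).2) %/ M)%N by rewrite divn_gt0//; lia.
  move: d dm dp; set a := (_ %/ M)%N; set b := (_ %% M)%N => d dm dp.
  rewrite mulnC in d; split=> //; try lia.

  - by split; [exact: dvdn_mulr|lia].
have s0 m : (0 < (s m).2)%N.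
  by elim: m => [|m IH]; [rewrite /=; lia|have [] := step m IH].
have [h1 h2 h3 h4 [h5 h6]] := step n (s0 n).
split=> //.
- case: n {h1 h2 h3 h4 h5 h6} => [|m]; first by rewrite /= prednK//; lia.
  by have [_ _ h _ _] := step m (s0 m); have := s0 m; lia.
- case: n {h1 h2 h3 h4 h5 h6} => [|m]; first by rewrite /= ; lia.
  by have [_ _ _ h _] := step m (s0 m).
- split=> //; case: n {h1 h2 h3 h4 h5 h6} => [|m].
    by rewrite /= (leq_trans _ (ltnW (hg m0)))// leq_maxr.
  by have [_ _ _ _ [_ h]] := step m (s0 m).
Qed.

Lemma listing_sequence (C : nat) (h H k : nat -> nat) (o : nat -> nat -> nat) :
  (forall n, o n 0%N = 0%N) ->
  (forall n i, (i < k n)%N -> (o n i + h n <= o n i.+1 <= o n i + h n + C)%N) ->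
  (forall n, o n (k n) = h n.+1) ->
  (forall n, 0 < H n < h n)%N -> (forall n, H n %| H n.+1)%N ->
  (forall n, H n.+1 + H n <= h n.+1)%N ->
  exists l : nat -> seq nat, forall n,
  [/\ uniq (l n), {in l n, forall p, (p < h n)%N}, size (l n) = H n,
    forall j, (j < H n)%N ->
      let D := if n is m.+1 then ((H m).+1 * (h m + C))%N else 0%N in
      (nth 0%N (l n) j <= j + D)%N /\ (j <= nth 0%N (l n) j + D)%N
    & forall i, (i < k n)%N ->
      (exists b, (b.+1 * H n <= H n.+1)%N /\ forall t, (t < H n)%N ->
         nth 0%N (l n.+1) (b * H n + t) = (o n i + nth 0 (l n) t)%N)
      \/ (forall t, (t < H n)%N -> (o n i + nth 0 (l n) t)%N \notin l n.+1)].
Proof.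
move=> o0 oS ok Hh Hd HS.
pose D n := if n is m.+1 then ((H m).+1 * (h m + C))%N else 0%N.
pose valid n (l : seq nat) := [/\ uniq l, {in l, forall p, (p < h n)%N},
  size l = H n & forall j, (j < H n)%N ->
    (nth 0%N l j <= j + D n)%N /\ (j <= nth 0%N l j + D n)%N].
pose block n (l l' : seq nat) := forall i, (i < k n)%N ->
  (exists b, (b.+1 * H n <= H n.+1)%N /\ forall t, (t < H n)%N ->
     nth 0%N l' (b * H n + t) = (o n i + nth 0 l t)%N)
  \/ (forall t, (t < H n)%N -> (o n i + nth 0 l t)%N \notin l').
have /choice[f fP] (nl : nat * seq nat) : exists l',
    valid nl.1 nl.2 -> valid nl.1.+1 l' /\ block nl.1 nl.2 l'.
  case: nl => n l /=; have [[lu ll ls ld]|] := pselect (valid n l); last by exists [::].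
  have lh : (0 < size l < h n)%N by rewrite ls.
  have Hd' : (size l %| H n.+1)%N by rewrite ls.
  have HS' : (H n.+1 + size l <= o n (k n))%N by rewrite ls ok.
  have [l' [l'u l'l l's l'd l'b]] := listing_step (o0 n) (oS n) lu ll lh Hd' HS'.
  by exists l' => _; rewrite ls ok in l'l l'd l'b; split.
(* The initial listing is in natural order, hence the displacement 0 at stage 0. *)
pose l := fix l n := if n is m.+1 then f (m, l m) else iota 0 (H 0%N).
have lv n : valid n (l n).
  elim: n => [|n IH]; last by have [] := fP (n, l n) IH.
  split.
  - exact: iota_uniq.
  - by move=> p; rewrite mem_iota add0n => /andP[_ pH]; have := Hh 0%N; lia.
  - by rewrite size_iota.
  - by move=> j jH; rewrite nth_iota// add0n addn0.
exists l => n; have [lu ll ls ld] := lv n; split=> //.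
by have [_] := fP (n, l n) (lv n).
Qed.

(** * The sigma-algebra of a factor up to null sets *)

Section factor_mod_null.
Context (R : realType) d (X : measurableType d) (mu : probability X R).
Context d2 (Y : measurableType d2) (f : X -> Y) (mf : measurable_fun setT f).

Let sdiff V W : set X := (V `\` f @^-1` W) `|` (f @^-1` W `\` V).

Let mpre W : measurable W -> measurable (f @^-1` W).
Proof. exact: measurable_preimage. Qed.

Let msdiff V W : measurable V -> measurable W -> measurable (sdiff V W).
Proof. by move=> mV /mpre mW; apply: measurableU; exact: measurableD. Qed.

Definition factor_sets : set (set X) := [set V | measurable V /\
  exists2 W, measurable W & pr mu (sdiff V W) = 0].

Lemma sigma_algebra_factor_sets : sigma_algebra setT factor_sets.
Proof.
split.
- split=> //; exists set0 => //.
  by rewrite /sdiff preimage_set0 setD0 setU0 pr0.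
- move=> V [mV [W mW VW]]; rewrite setTD; split; first exact: measurableC.
  exists (~` W); first exact: measurableC.
  rewrite -VW; congr (pr mu _); apply/seteqP; split=> x.
    move=> [[nV nW]|[nW nV]]; [right|left]; split=> //.
      by apply: contrapT => nW'; apply: nW.
    by apply: contrapT => nV'; apply: nV.
  by move=> [[Vx nW]|[Wx nV]]; [right|left]; split.
- move=> V FV; split; first by apply: bigcupT_measurable => n; case: (FV n).
  have /choice[W WP] n : exists W, measurable W /\ pr mu (sdiff (V n) W) = 0.
    by have [_ [W ? ?]] := FV n; exists W.
  have mW n : measurable (W n) by case: (WP n).
  have mV n : measurable (V n) by case: (FV n).
  exists (\bigcup_n W n); first exact: bigcupT_measurable.
  have m1 n : measurable (sdiff (V n) (W n)) by exact: msdiff.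
  apply/eqP; rewrite eq_le pr_ge0 andbT.
  have <- : pr mu (\bigcup_n sdiff (V n) (W n)) = 0.
    by rewrite pr_bigcup0// => n; case: (WP n).
  apply: le_pr.
  + by apply: msdiff; exact: bigcupT_measurable.
  + exact: bigcupT_measurable.
  + move=> x [[[n _ Vx] nW]|[[n _ Wx] nV]]; exists n => //; [left|right]; split=> //.
      by move=> Wx; apply: nW; exists n.
    by move=> Vx; apply: nV; exists n.
Qed.

Lemma factor_sets_null V V' : measurable V -> factor_sets V' ->
  pr mu (V `+` V') = 0 -> factor_sets V.
Proof.
move=> mV [mV' [W mW V'W]] VV'; split=> //; exists W => //.
have mVV : measurable (V `+` V') by apply: measurableU; exact: measurableD.
apply/eqP; rewrite eq_le pr_ge0 andbT.
apply: (@le_trans _ _ (pr mu ((V `+` V') `|` sdiff V' W))); last first.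
  by apply: le_trans (prU_le mu mVV (msdiff mV' mW)) _; rewrite VV' V'W addr0.
apply: le_pr; [exact: msdiff|by apply: measurableU => //; exact: msdiff|].
move=> x [[Vx nW]|[Wx nV]]; have [V'x|nV'] := pselect (V' x).
- by right; left.
- by left; left.
- by left; right.
- by right; right.
Qed.

End factor_mod_null.

Lemma pr_ae_eq (R : realType) d (X : measurableType d) (mu : probability X R)
    d2 (Y : measurableType d2) (f g : X -> Y) A :
  measurable_fun setT f -> measurable_fun setT g -> measurable A ->
  {ae mu, forall x, f x = g x} -> pr mu (f @^-1` A) = pr mu (g @^-1` A).
Proof.
move=> mf mg mA /pr0_ae[N [mN N0 NE]].
have H (u v : X -> Y) : measurable_fun setT u -> measurable_fun setT v ->
    (forall x, ~ N x -> u x = v x) -> pr mu (u @^-1` A) <= pr mu (v @^-1` A).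
  move=> mu' mv uv; have mvA := measurable_preimage mv mA.
  rewrite -[leRHS]addr0 -N0; apply: le_trans (prU_le _ mvA mN).
  apply: le_pr; [exact: measurable_preimage|exact: measurableU|].
  move=> x Ax; have [Nx|nN] := pselect (N x); [by right|left].
  by rewrite /preimage /= -uv.
by apply/eqP; rewrite eq_le !H// => x /NE.
Qed.

Theorem theorem1 (R : realType) (phi : R -> R)
    (phi_ge0 : forall t : R, 0 <= t -> 0 <= phi t)
    (phi_littleo : forall eps : R, 0 < eps ->
       \forall t \near +oo, phi t <= eps * t `^ 3^-1)
    (d : measure_display) (X : measurableType d) (mu : probability X R)
    (X_standard : standard_borel R X) (mu_atomless : atomless mu)
    (T : X -> X) (T_BSP : BSP_rank_one mu T)
    (q : radix) (q_universal : universal q) :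
  phi_integrably_orbit_equivalent mu (odometer_measure R q) phi
    T (@odometer q).
Proof.
case: T_BSP => T_aut [p [B [Bsub [Sigma [cs [C [_ BSP]]]]]]].
have T_bij : bijective T by case: T_aut => -[].
have ht_ge := @height_ge p.
have e0 n : 0 < (2^-1 : R) ^+ n by rewrite exprn_gt0.
(* For a slack [rn.1], this [rho] is the numerator of the bound in [pr_irregular]; the cost allowed
   at stage [rn.2] is [2^-1 ^+ rn.2]. *)
have /choice[g0 g0P] := fun rn : nat * nat =>
  littleo_cost phi_ge0 phi_littleo C (C + 2 * rn.1 + 2) (e0 rn.2).
pose g r n := g0 (r, n).
have [N [H NH]] := stage_choice q g ht_ge.
pose h n := height p (N n).
have N_lt n : (N n < N n.+1)%N by case: (NH n).
have H0 n : (0 < H n)%N by case: (NH n).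
have Hh n : (H n < h n)%N by case: (NH n).
have h0 n : (0 < h n)%N by exact: leq_trans (Hh n).
have Hslack n : (h n - H n <= slack q H n)%N by case: (NH n).
have HM n : (H n * scale q n %| H n.+1)%N by case: (NH n) => _ _ _ _ [].
have HS n : (H n.+1 + H n <= h n.+1)%N by case: (NH n) => _ _ _ _ [].
have gh n : (g (slack q H n) n <= h n)%N by case: (NH n) => _ _ _ _ [].
have Hd n : (H n %| H n.+1)%N.
  by apply: dvdn_trans (HM n); exact: dvdn_mulr.
have Hscale m n : (m < n)%N -> (scale q m %| H n)%N.
  elim: n => // n IH; rewrite ltnS leq_eqVlt => /orP[/eqP ->|/IH mn].
    by apply: dvdn_trans (HM n); exact: dvdn_mull.
  exact: dvdn_trans (Hd n).
have /choice[Phi1 Phi1P] n : exists Phi, [/\ 0 <= Phi,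
    forall j, (j <= jump_bound C (h n))%N -> phi j%:R <= Phi
    & (C + 2 * slack q H n + 2)%:R / (h n)%:R * Phi <= 2^-1 ^+ n].
  by have [_] := g0P (slack q H n, n) (h n) (gh n) (h0 n).
have small n : (C + 2 * slack q H n + 2)%:R / (h n)%:R <= 2^-1 ^+ n :> R.
  by have [] := g0P (slack q H n, n) (h n) (gh n) (h0 n).
have /choice[k /choice[os ko]] n : exists k o, [/\ o 0%N = 0%N,
    forall i, (i < k)%N -> (o i + h n <= o i.+1 <= o i + h n + C)%N,
    o k = h n.+1
    & forall x, B (N n) x <->
        exists2 i, (i < k)%N & level T (B (N n.+1)) (o i) x].
  have := composite_offsets T_aut cs BSP (N n) (N n.+1 - N n).
  by rewrite subnK// ltnW.
have oS n : forall i, (i < k n)%N -> (os n i + h n <= os n i.+1 <= os n i + h n + C)%N.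
  by case: (ko n).
have ok n : os n (k n) = h n.+1 by case: (ko n).
have [||||||l lP] := @listing_sequence C h H k os; rewrite //.
- by move=> n; case: (ko n).
- by move=> n; rewrite H0 Hh.
have lu n : uniq (l n) by case: (lP n).
have ll n r : r \in l n -> (r < h n)%N by case: (lP n) => _ + _ _ _; apply.
have ls n : size (l n) = H n by case: (lP n).
pose base n := B (N n).
have mB n : measurable (B n) by exact: (cs_measurable_base cs).
have mbase n : measurable (base n) by exact: mB.
have disj n r s x : (r < h n)%N -> (s < h n)%N ->
    level T (base n) r x -> level T (base n) s x -> r = s.
  exact: (level_disjoint T_aut cs).
have refine n x : base n x <->
    exists2 i, (i < k n)%N & level T (base n.+1) (os n i) x.
  by case: (ko n) => _ _ _; apply.
have olt n i : (i < k n)%N -> (os n i + h n <= h n.+1)%N.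
  by rewrite -ok; exact: (offset_le (oS n)).
have lb n i : (i < k n)%N ->
    (exists b, (b.+1 * size (l n) <= size (l n.+1))%N /\ forall t, (t < size (l n))%N ->
       nth 0%N (l n.+1) (b * size (l n) + t) = (os n i + nth 0 (l n) t)%N)
    \/ (forall t, (t < size (l n))%N -> (os n i + nth 0 (l n) t)%N \notin l n.+1).
  by rewrite !ls; case: (lP n) => _ _ _ _; apply.
have l0 n : (0 < size (l n))%N by rewrite ls.
have ld n : (size (l n) %| size (l n.+1))%N by rewrite !ls.
have lscale m n : (m < n)%N -> (scale q m %| size (l n))%N.
  by rewrite ls; exact: Hscale.
have large n : 1 <= (h n + C)%:R * pr mu (base n).
  exact: (tower_large_height T_aut mu_atomless cs BSP).
have base_le n : pr mu (base n) <= (h n)%:R^-1 by exact: (pr_base_le T_aut cs).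
pose reg := regular_set T base l.
have mreg n : measurable (~` reg n).
  exact/measurableC/(measurable_regular_set T_aut).
have bad_le n : pr mu (~` reg n) <= (C + 2 * slack q H n + 2)%:R / (h n)%:R.
  apply: le_trans (pr_irregular T_aut mbase disj lu ll l0 large n) _.
  rewrite ls; apply: ler_pM => //; first exact: pr_ge0.
  by rewrite ler_nat; have := Hslack n; lia.
have bad n : pr mu (~` reg n) <= 2^-1 ^+ n by exact: le_trans (bad_le n) (small n).
pose name := odometer_name T q base l.
have mname : measurable_fun setT name.
  exact: (measurable_odometer_name T_aut mbase disj lu ll).
have prname A : measurable A ->
    pr mu (name @^-1` A) = pr (odometer_measure R q) A.
  by move=> mA; apply: (pr_name T_aut mbase disj refine olt lu ll lb) => //.
have q_large n : exists r, (size (l n) %| scale q r)%N.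
  exact: universal_scale.
have gen V : measurable V -> exists2 W, measurable W &
    pr mu ((V `\` name @^-1` W) `|` (name @^-1` W `\` V)) = 0.
  move=> mV; suff : factor_sets mu name V by case.
  have [V' sV' VV'] := cs_generates cs mV.
  have Nge n : (n <= N n)%N by elim: n => // n IH; exact: leq_ltn_trans (N_lt n).
  have [F0 FC FU] := sigma_algebra_factor_sets mu mname.
  apply: (factor_sets_null mname mV _ (_ : pr mu (V `+` V') = 0)); last first.
    by rewrite /pr VV'.
  move: V' sV' {VV'}; apply: smallest_sub; first by split.
  move=> _ [n [r [rn ->]]]; rewrite image_level//.
  (* The generators use all stages of the construction, the names only the stages [N n]; as
     [n <= N n], each generator is a union of levels of a selected tower. *)
  have -> : level T (B n) r = \bigcup_s
      (if `[< (s < h n)%N /\ level T (base n) s `<=` level T (B n) r >]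
       then level T (base n) s else set0).
    apply/seteqP; split=> x; last by move=> [s _]; case: asboolP => // -[_]; apply.
    move=> /(level_in_later T_aut cs BSP (N n - n) rn).
    rewrite subnK// => -[s [sh Ls sub]]; exists s => //.
    by case: asboolP => // -[].
  apply: FU => s; case: asboolP => [[sh _]|_]; last exact: F0.
  split; first exact: (measurable_level T_aut).
  exact: (level_name T_aut mbase disj refine olt lu ll lb ld lscale bad q_large sh).
have [Psi [Psib PsiE]] := isomorphism_of_factor X_standard mname prname gen.
have orbE := ae_orbit T_aut PsiE.
(* At stage 0 the displacement is 0, so the cocycles are at most 1 in absolute value; afterwards the
   displacement comes from the preceding tower, hence the shift of index. *)
pose Phi n := if n is m.+1 then Phi1 m else phi 0 + phi 1.
pose D n := if n is m.+1 then ((H m).+1 * (h m + C))%N else 0%N.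
have disp n j : (j < size (l n))%N ->
    (nth 0%N (l n) j <= j + D n)%N /\ (j <= nth 0%N (l n) j + D n)%N.
  by rewrite ls; case: (lP n) => _ _ _ + _; apply.
have PhiP n c : (absz c <= 2 * D n + 1)%N -> forall j, (j <= absz c)%N -> phi j%:R <= Phi n.
  move=> cD j jc; have {c cD jc} jD : (j <= 2 * D n + 1)%N by exact: leq_trans cD.
  case: n jD => [|n] /=.
    by case: j => [|[|//]] _; rewrite ?lerDl ?lerDr phi_ge0.
  move=> jD; have [_ + _] := Phi1P n; apply; apply: leq_trans jD _.
  rewrite /jump_bound leq_add2r leq_mul2l /= leq_mul2r ltnS ltnW ?orbT//.
apply: (@phi_oe_of_cocycle_bounds _ _ _ _ _ phi T Psi (fun n => ~` reg n) Phi) => //.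
- by case=> [|n] /=; [rewrite addr_ge0 ?phi_ge0|case: (Phi1P n)].
- exact: (tower_aperiodic T_aut mbase disj ll).
- move=> A mA; rewrite -prname//; case: Psib => _ mPsi _.
  exact: pr_ae_eq.
- move=> n /=; have [P0 _ Ple] := Phi1P n; apply: le_trans Ple.
  by rewrite ler_wpM2r.
- apply: filterS orbE => x xE n /(name_cocycle_T T_aut disj refine olt lu ll lb ld lscale disp).
  move=> [c E cD]; exists c; last exact: PhiP cD.
  by rewrite (xE 1) (xE 0).
- apply: filterS orbE => x xE n /(name_cocycle_odometer T_aut disj refine olt lu ll lb ld lscale disp).
  move=> [c E cD]; exists c; last exact: PhiP cD.
  by rewrite (xE c) (xE 0).
Qed.
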